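(* (Regularization Lemma) There is an absolute constant $C_0$ such that the following holds. Let $\Xi\ge3$, $e_v\ge e_R>0$, let $J\subseteq\mathbb{R}$ be an interval, and let $(v_0,p_0,R_0)$ be an Euler–Reynolds flow with frequency-energy levels bounded by $(\Xi,e_v,e_R)$ to order $3$ in $C^0$ such that $\mathrm{supp}_t\,v_0\cup\mathrm{supp}_t\,R_0\subseteq J$. Define $\widehat{N}:=(e_v/e_R)^{1/2}$. Then there exists an Euler–Reynolds flow $(v,p,R)$ with $\mathrm{supp}_t\,v\cup\mathrm{supp}_t\,R\subseteq J$ satisfying $$\|\nabla^kv\|_{C^0}\le C_0\widehat{N}^{(k-3)_+}\Xi^ke_v^{1/2},\quad k=1,\dots,5,$$ $$\|\nabla^kR\|_{C^0}\le C_0\widehat{N}^{(k-2)_+}\Xi^ke_R,\quad k=0,\dots,5,$$ $$\|v-v_0\|_{C^0}\le C_0e_R^{1/2}.$$ Furthermore, one can arrange that $v,R\in\bigcap_{k\ge0}C_tC_x^k$ (all spatial derivatives of $v$ and $R$ are continuous on $\mathbb{R}\times\mathbb{T}^3$).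
   Context: $\mathbb{T}^3=(\mathbb{R}/\mathbb{Z})^3$; repeated indices are summed; $\mathcal{S}$ is the space of symmetric $(2,0)$ tensors on $\mathbb{R}^3$; $(x)_+=\max\{x,0\}$. An Euler–Reynolds flow is a triple $(v,p,R)$ with $v:\mathbb{R}\times\mathbb{T}^3\to\mathbb{R}^3$, $p:\mathbb{R}\times\mathbb{T}^3\to\mathbb{R}$, $R^{j\ell}:\mathbb{R}\times\mathbb{T}^3\to\mathcal{S}$ satisfying $\partial_tv^\ell+\nabla_j(v^jv^\ell)+\nabla^\ell p=\nabla_jR^{j\ell}$ and $\nabla_jv^j=0$ on $\mathbb{R}\times\mathbb{T}^3$ (in the sense of distributions). $\|\cdot\|_{C^0}$ is the supremum norm over $\mathbb{R}\times\mathbb{T}^3$; $\nabla^k$ is the $k$-th full spatial derivative. $(v,p,R)$ has frequency-energy levels bounded by $(\Xi,e_v,e_R)$ to order $L$ in $C^0$ if $\nabla^kv,\nabla^kR$ are continuous for $k\le L$, $\|\nabla^kv\|_{C^0}\le\Xi^ke_v^{1/2}$ for $1\le k\le L$, and $\|\nabla^kR\|_{C^0}\le\Xi^ke_R$ for $0\le k\le L$. $\mathrm{supp}_tf=\{t:\mathrm{supp}f\cap(\{t\}\times\mathbb{T}^3)\ne\emptyset\}$. *)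

(* Defs.v *)
From HB Require Import structures.
From mathcomp Require Import all_boot all_order all_algebra.
From mathcomp Require Import all_classical all_reals all_analysis.

Set Implicit Arguments.
Unset Strict Implicit.
Unset Printing Implicit Defensive.
Import Order.TTheory GRing.Theory Num.Theory.
Import numFieldNormedType.Exports.
Local Open Scope classical_set_scope.
Local Open Scope ring_scope.

(* A function on R x T^3, T^3 = (R/Z)^3, is a function on R x R^3 that is
   Z^3-periodic in its second argument. *)
Notation spacetime R := (R * 'rV[R]_3)%type.

Definition periodic (R : realType) (W : Type) (F : spacetime R -> W) : Prop :=
  forall (z : spacetime R) (k : 'rV[int]_3),
    F (z.1, z.2 + map_mx intr k) = F z.

Definition e_t (R : realType) : spacetime R := (1, 0).
Definition e_x (R : realType) (i : 'I_3) : spacetime R := (0, delta_mx 0 i).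

Definition iter_derive (R : realType) (W : normedModType R)
    (s : seq (spacetime R)) (F : spacetime R -> W) : spacetime R -> W :=
  foldr (fun h G => 'D_h G) F s.

Definition nabla_seq (R : realType) (W : normedModType R) (s : seq 'I_3)
    (F : spacetime R -> W) : spacetime R -> W :=
  iter_derive (map (@e_x R) s) F.

(* For every k <= L, nabla^k F exists everywhere and is (jointly) continuous
   on R x T^3; nothing is required of time derivatives. *)
Definition nabla_continuous (R : realType) (W : normedModType R) (L : nat)
    (F : spacetime R -> W) : Prop :=
  forall s : seq 'I_3, (size s <= L)%N ->
    continuous (nabla_seq s F) /\
    ((size s < L)%N ->
       forall z i, derivable (nabla_seq s F) z (e_x R i)).

Definition sup_norm (R : realType) (f : spacetime R -> R) : \bar R :=
  ereal_sup (range (fun z => `|f z|%:E)).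

(* Euclidean norm of the tensor nabla^k F(z), whose components are indexed by
   the k derivative indices and the entries of F. *)
Definition nabla_norm (R : realType) (m n k : nat)
    (F : spacetime R -> 'M[R]_(m, n)) (z : spacetime R) : R :=
  Num.sqrt (\sum_(I : k.-tuple 'I_3) \sum_(i < m) \sum_(j < n)
              (nabla_seq I F z i j) ^+ 2).

Definition C0_nabla (R : realType) (m n k : nat)
    (F : spacetime R -> 'M[R]_(m, n)) : \bar R :=
  sup_norm (nabla_norm k F).

Definition supp_t (R : realType) (W : zmodType) (F : spacetime R -> W)
    : set R :=
  [set t | exists x, closure [set z | F z != 0] (t, x)].

Definition row3 (R : realType) (y : R * R * R) : 'rV[R]_3 :=
  \row_(i < 3) nth 0 [:: y.1.1; y.1.2; y.2] i.

Definition of_coords (R : realType) (q : R * (R * R * R)) : spacetime R :=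
  (q.1, row3 q.2).

Lemma product_sigma_finite d1 d2 (T1 : measurableType d1)
    (T2 : measurableType d2) (R : realType)
    (m1 : {sigma_finite_measure set T1 -> \bar R})
    (m2 : {sigma_finite_measure set T2 -> \bar R}) :
  sigma_finite setT (m1 \x m2)%E.
Proof.
have /sigma_finiteP[F [TF ndF Foo]] := sigma_finiteT m1.
have /sigma_finiteP[G [TG ndG Goo]] := sigma_finiteT m2.
exists (fun n => F n `*` G n).
  rewrite -setXTT TF TG predeqE => -[x y]; split.
    move=> [/= [n _ Fnx] [k _ Gky]]; exists (maxn n k) => //; split.
    - by move: x Fnx; exact/subsetPset/ndF/leq_maxl.
    - by move: y Gky; exact/subsetPset/ndG/leq_maxr.
  by move=> [n _ []/= ? ?]; split; exists n.
move=> k; have [? ?] := Foo k; have [? ?] := Goo k.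
split; first exact: measurableX.
by rewrite product_measure1E// lte_mul_pinfty// ge0_fin_numE.
Qed.

(* The sigma-finiteness instances are declared by hand: the library's instance
   on m1 \x m2 is only found for sub-probabilities. *)
Definition leb2 (R : realType) :=
  (@lebesgue_measure R \x @lebesgue_measure R)%E.
HB.instance Definition _ (R : realType) := Measure.on (@leb2 R).
HB.instance Definition _ (R : realType) :=
  Measure_isSigmaFinite.Build _ _ _ (@leb2 R)
    (product_sigma_finite (@lebesgue_measure R) (@lebesgue_measure R)).

Definition leb3 (R : realType) := (@leb2 R \x @lebesgue_measure R)%E.
HB.instance Definition _ (R : realType) := Measure.on (@leb3 R).
HB.instance Definition _ (R : realType) :=
  Measure_isSigmaFinite.Build _ _ _ (@leb3 R)
    (product_sigma_finite (@leb2 R) (@lebesgue_measure R)).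

Definition leb4 (R : realType) := (@lebesgue_measure R \x @leb3 R)%E.
HB.instance Definition _ (R : realType) := Measure.on (@leb4 R).
HB.instance Definition _ (R : realType) :=
  Measure_isSigmaFinite.Build _ _ _ (@leb4 R)
    (product_sigma_finite (@lebesgue_measure R) (@leb3 R)).
Arguments leb4 : clear implicits.

(* Integrals over T^3 are taken over the fundamental domain [0, 1]^3. *)
Definition cube (R : realType) : set (R * R * R) :=
  `[0, 1] `*` `[0, 1] `*` `[0, 1].
Arguments cube : clear implicits.

Definition loc_integrable (R : realType) (f : spacetime R -> R) : Prop :=
  forall M : R,
    (leb4 R).-integrable (`[- M, M] `*` cube R) (EFin \o (f \o @of_coords R)).

Definition integral_RT3 (R : realType) (f : spacetime R -> R) : R :=
  (\int[leb4 R]_(q in setT `*` cube R) f (of_coords q))%R.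

(* Test functions of class C_c^oo(R x T^3). *)
Definition test_function (R : realType) (phi : spacetime R -> R) : Prop :=
  [/\ periodic phi,
      forall s : seq (spacetime R), continuous (iter_derive s phi) /\
        forall z h, derivable (iter_derive s phi) z h
    & exists M : R, forall z, M < `|z.1| -> phi z = 0].

(* The row vector v z has entries v^l = v z 0 l. The local integrability
   conditions are what is needed for v^l, v^j v^l, p and R^{jl} to define
   distributions on R x T^3. *)
Record euler_reynolds (R : realType) (v : spacetime R -> 'rV[R]_3)
    (p : spacetime R -> R) (Rey : spacetime R -> 'M[R]_3) : Prop := {
  er_periodic_v : periodic v ;
  er_periodic_p : periodic p ;
  er_periodic_R : periodic Rey ;
  er_sym : forall z, (Rey z)^T = Rey z ;
  er_int_v : forall l, loc_integrable (fun z => v z 0 l) ;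
  er_int_vv : forall j l, loc_integrable (fun z => v z 0 j * v z 0 l) ;
  er_int_p : loc_integrable p ;
  er_int_R : forall j l, loc_integrable (fun z => Rey z j l) ;
  er_momentum : forall (l : 'I_3) (phi : spacetime R -> R),
    test_function phi ->
    integral_RT3 (fun z =>
      v z 0 l * 'D_(e_t R) phi z
      + \sum_(j < 3) v z 0 j * v z 0 l * 'D_(e_x R j) phi z
      + p z * 'D_(e_x R l) phi z)
    = integral_RT3 (fun z => \sum_(j < 3) Rey z j l * 'D_(e_x R j) phi z) ;
  er_div_free : forall phi : spacetime R -> R,
    test_function phi ->
    integral_RT3 (fun z => \sum_(j < 3) v z 0 j * 'D_(e_x R j) phi z) = 0
}.

Record freq_energy_levels (R : realType) (L : nat) (Xi ev eR : R)
    (v : spacetime R -> 'rV[R]_3) (Rey : spacetime R -> 'M[R]_3) : Prop := {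
  fel_cont_v : nabla_continuous L v ;
  fel_cont_R : nabla_continuous L Rey ;
  fel_v : forall k, (1 <= k <= L)%N ->
    (C0_nabla k v <= (Xi ^+ k * Num.sqrt ev)%:E)%E ;
  fel_R : forall k, (k <= L)%N ->
    (C0_nabla k Rey <= (Xi ^+ k * eR)%:E)%E
}.

(* Main.v *)
Require Import Defs.
From HB Require Import structures.
From mathcomp Require Import all_boot all_order all_algebra.
From mathcomp Require Import all_classical all_reals all_analysis measurable_realfun.
From mathcomp Require Import ring lra zify.
Import Order.TTheory GRing.Theory Num.Theory.
Import numFieldNormedType.Exports.
Local Open Scope classical_set_scope.
Local Open Scope ring_scope.

(* The flow is mollified in space only, by the de la Vallee-Poussin kernel
   K(u) = prod_i cos(pi u_i)^(2n) / I_n with n comparable to (N Xi)^2, so that K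
   has width 1/sqrt(n) ~ 1/(N Xi) and costs sqrt(n) per derivative. Being a
   trigonometric polynomial, K splits as a finite sum of products
   a_r(x) b_r(y), so K * f is a finite sum of a_r(x) F_r(t): smoothness in x is
   immediate, the pressure needs only Fubini in (t, y), and the weak equation
   passes to K * (v0, p0, R0) because K * is symmetric and commutes with
   derivatives of the test function.
   The new stress is K * R0 + (K*v)(K*v) - K*(v v). The commutator
   (K*f)(K*g) - K*(fg) does not change when constants are subtracted from f and
   g; choosing them to vanish at the evaluation point gives the quadratic gain
   1/n. The first two derivatives are distributed on v by Leibniz' rule, the
   remaining ones fall on the kernel. *)

Set Implicit Arguments.
Unset Strict Implicit.
Unset Printing Implicit Defensive.

(** Smoothing in space alone keeps the time slices separate, and this confines the time supports to
    [J]. The price is that the new fields are only continuous in time, so the balance laws have to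
    be carried over in weak form. The kernel is periodic but has no small support. Its tails are
    controlled by the weight 1 + n sin^2(pi u) in each coordinate: the weight dominates the growth
    of f(y) - f(x), measured in kernel widths, and K and its derivatives up to order three have
    weighted L^1 norms of the order expected from scaling. With sqrt n ~ N Xi both errors meet their
    targets: v - v0 has size Xi ev^(1/2) / sqrt n ~ eR^(1/2), and the commutator has size Xi^2 ev /
    n ~ eR. The thresholds 3 and 2 come from counting derivatives. The field v keeps three of them;
    in the commutator each factor spends one more on its oscillation, which leaves two to
    distribute. As k is at most 5, no more than three derivatives ever reach the kernel. The
    pressure is only locally integrable, so some of its time slices may fail to be integrable; there
    the real-valued integral takes a default value. *)

Lemma continuous_pair (S T U : topologicalType) (f : S -> T) (g : S -> U) :
  continuous f -> continuous g -> continuous (fun x => (f x, g x)).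
Proof. by move=> cf cg x; exact: (cvg_pair (cf x) (cg x)). Qed.

(** * Continuity, measurability and Fubini's theorem *)

Section continuous_real.
Context (R : realType) (T : topologicalType).
Implicit Types f g : T -> R.

Lemma continuousM_fun f g : continuous f -> continuous g -> continuous (fun x => f x * g x).
Proof. by move=> cf cg x; exact: (@cvgM _ _ _ _ f g _ _ (cf x) (cg x)). Qed.

Lemma continuousD_fun f g : continuous f -> continuous g -> continuous (fun x => f x + g x).
Proof. by move=> cf cg x; exact: (@cvgD _ _ _ _ _ f g _ _ (cf x) (cg x)). Qed.

Lemma continuousB_fun f g : continuous f -> continuous g -> continuous (fun x => f x - g x).
Proof. by move=> cf cg x; exact: (@cvgB _ _ _ _ _ f g _ _ (cf x) (cg x)). Qed.

Lemma continuous_norm_fun f : continuous f -> continuous (fun x => `|f x|).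
Proof. by move=> cf x; apply: cvg_norm; exact: cf. Qed.

Lemma continuous_cst_fun (c : R) : continuous (fun _ : T => c).
Proof. by move=> x; exact: cvg_cst. Qed.

Lemma continuous_prod_fun (I : Type) (r : seq I) (F : I -> T -> R) :
  (forall i, continuous (F i)) -> continuous (fun x => \prod_(i <- r) F i x).
Proof.
move=> cF; elim: r => [|i r IH].
  by under eq_fun do rewrite big_nil; exact: continuous_cst_fun.
by under eq_fun do rewrite big_cons; exact: continuousM_fun.
Qed.

End continuous_real.

(* [g] is the limit of its discretizations (x, y) |-> g(x, floor(ny)/n). *)
Lemma caratheodory_measurable (R : realType) d (T : measurableType d) (g : T * R -> R) :
  (forall y, measurable_fun setT (fun x => g (x, y))) ->
  (forall x, continuous (fun y => g (x, y))) ->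
  measurable_fun setT g.
Proof.
move=> gm gc.
pose h n (q : T * R) := g (q.1, (Num.floor (q.2 * n.+1%:R))%:~R / n.+1%:R).
apply: (@measurable_realfun.measurable_fun_cvg _ _ _ _ h) => [n|[x y] _].
  move=> _ /= Y mY; rewrite setTI.
  (* On the strip where floor(y n.+1) = k the function [h n] depends on x only, so the preimage is a
     countable union of measurable rectangles. *)
  have -> : h n @^-1` Y = \bigcup_k
     ([set x | Y (g (x, k%:~R / n.+1%:R))] `*`
        `[(k%:~R / n.+1%:R)%R, ((k + 1)%:~R / n.+1%:R)%R[).
    apply/seteqP; split => [[x y] /= Yq|[x y] [k _ [/= Yk]]].
      exists (Num.floor (y * n.+1%:R)) => //; split => //=.
      rewrite in_itv/= ler_pdivrMr ?ltr_pdivlMr ?ltr0n//.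
      by rewrite real_floor_itv ?num_real.
    rewrite in_itv/= ler_pdivrMr ?ltr_pdivlMr ?ltr0n// => yk.
    by rewrite /h/= (floor_def yk).
  apply: countable_bigcupT_measurable => // k; apply: measurableX => //.
  by have := gm (k%:~R / n.+1%:R) measurableT Y mY; rewrite setTI.
apply: (cvg_comp (fun n : nat => (Num.floor (y * n.+1%:R))%:~R / n.+1%:R : R)
  (fun y => g (x, y))); last exact: gc.
apply/cvgrPdist_le => e e0.
near=> n.
have n0 : 0 < n.+1%:R :> R by rewrite ltr0n.
have /andP[l u] := real_floor_itv (num_real (y * n.+1%:R)).
have -> : y - (Num.floor (y * n.+1%:R))%:~R / n.+1%:R = (y * n.+1%:R - (Num.floor (y * n.+1%:R))%:~R) / n.+1%:R.
  by rewrite mulrBl mulfK// gt_eqF.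
rewrite ger0_norm; last by rewrite divr_ge0 ?subr_ge0// ltW.
rewrite ler_pdivrMr// (@le_trans _ _ 1)//.
  by rewrite lerBlDl ltW// -intrD1.
rewrite mulrC -ler_pdivrMr// div1r.
rewrite (@le_trans _ _ n%:R) ?ler_nat//.
by near: n; exact: nbhs_infty_ger.
Unshelve. all: by end_near. Qed.

Lemma continuous_measurable2 (R : realType) (g : R * R -> R) :
  continuous g -> measurable_fun setT g.
Proof.
move=> cg; apply: caratheodory_measurable => [y|x].
  apply: continuous_measurable_fun => x.
  apply: (@continuous_comp _ _ _ (fun x => (x, y)) g); last exact: cg.
  by apply: continuous_pair => ?; [exact: cvg_id|exact: cvg_cst].
move=> y; apply: (@continuous_comp _ _ _ (fun y => (x, y)) g); last exact: cg.
by apply: continuous_pair => ?; [exact: cvg_cst|exact: cvg_id].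
Qed.

Lemma continuous_measurable3 (R : realType) (g : R * R * R -> R) :
  continuous g -> measurable_fun setT g.
Proof.
move=> cg; apply: caratheodory_measurable => [y|x].
  apply: continuous_measurable2 => x.
  apply: (@continuous_comp _ _ _ (fun x => (x, y)) g); last exact: cg.
  by apply: continuous_pair => ?; [exact: cvg_id|exact: cvg_cst].
move=> y; apply: (@continuous_comp _ _ _ (fun y => (x, y)) g); last exact: cg.
by apply: continuous_pair => ?; [exact: cvg_cst|exact: cvg_id].
Qed.

Lemma continuous_measurable4 (R : realType) (g : R * (R * R * R) -> R) :
  continuous g -> measurable_fun setT g.
Proof.
move=> cg.
(* [caratheodory_measurable] discretizes the last factor, while time is the first one here, hence
   the swap. *)
have -> : g = (fun q => g (q.2, q.1)) \o @unstable.swap R (R * R * R)%type.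
  by apply/funext => -[].
apply: measurableT_comp; last exact: measurable_swap.
apply: caratheodory_measurable => [y|x].
  apply: continuous_measurable3 => x.
  apply: (@continuous_comp _ _ _ (fun x => (y, x)) g); last exact: cg.
  by apply: continuous_pair => ?; [exact: cvg_cst|exact: cvg_id].
move=> y; apply: (@continuous_comp _ _ _ (fun y => (y, x)) g); last exact: cg.
by apply: continuous_pair => ?; [exact: cvg_id|exact: cvg_cst].
Qed.

(** * Fubini's theorem for real-valued integrals of integrable functions *)

Section fubini.
Context (R : realType) d1 d2 (T1 : measurableType d1) (T2 : measurableType d2).
Variables (m1 : {sigma_finite_measure set T1 -> \bar R})
  (m2 : {sigma_finite_measure set T2 -> \bar R}).
Variables (D1 : set T1) (D2 : set T2).
Hypotheses (mD1 : measurable D1) (mD2 : measurable D2).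
Variable g : T1 * T2 -> R.
Hypothesis ig : (m1 \x m2)%E.-integrable (D1 `*` D2) (EFin \o g).

Let G := (EFin \o g) \_ (D1 `*` D2).

Let iG : (m1 \x m2)%E.-integrable setT G.
Proof. by apply/(integrable_mkcond _ (measurableX mD1 mD2)). Qed.

Let GE x y : G (x, y) = (((fun y => (g (x, y))%:E) \_ D2) y * (\1_D1 x)%:E)%E.
Proof.
rewrite /G patchE /patch in_setX /= indicE.
by case: ifPn => /=; case: (x \in D1); case: (y \in D2) => //=; rewrite ?mule1 ?mule0 ?mul0e.
Qed.

Let FE x : D1 x -> fubini_F m2 G x = (\int[m2]_(y in D2) (g (x, y))%:E)%E.
Proof.
move=> D1x; rewrite /fubini_F [in RHS]integral_mkcond.
by apply: eq_integral => y _; rewrite GE indicE mem_set// mule1.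
Qed.

(** The real slice integral is [fine] of the extended one: it is 0 where the latter is infinite and
    equal to it elsewhere, so it is dominated by the integrable [fubini_F]. *)
Lemma Rintegral_slice_integrable1 :
  m1.-integrable D1 (fun x => (\int[m2]_(y in D2) g (x, y))%:E).
Proof.
have iF := integrable_fubini_F iG.
have [mF _] := integrableP _ _ _ iF.
apply: (le_integrable _ _ _ (integrableS measurableT mD1 (@subsetT _ _) iF)) => //.
  have mm : measurable_fun D1 (fun x => fine (fubini_F m2 G x)).
    by apply: measurable_funTS; exact: measurableT_comp.
  apply/measurable_EFinP; apply: eq_measurable_fun mm => x /set_mem D1x.
  by rewrite FE.
move=> x D1x; rewrite /Rintegral FE//.
by case: (integral _ _ _) => //= *; rewrite normr0 leey.
Qed.

(** The two inner integrals can differ only at points whose slice is not integrable, and these form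
    a null set. *)
Lemma Rintegral_fubini1 :
  \int[(m1 \x m2)%E]_(z in D1 `*` D2) g z
  = \int[m1]_(x in D1) (\int[m2]_(y in D2) g (x, y)).
Proof.
rewrite {1}/Rintegral integral_mkcond -(integral12_prod_meas1 iG).
rewrite [in RHS]/Rintegral [in RHS]integral_mkcond; congr fine.
apply: ae_eq_integral => //.
- by have /integrableP[] := integrable_fubini_F iG.
- have := Rintegral_slice_integrable1.
  by move=> /(integrable_mkcond _ mD1)/integrableP[].
have := ae_integrable1 iG; apply: filterS => x iGx _.
rewrite patchE; case: ifPn => [/set_mem D1x|D1x].
  rewrite FE// /Rintegral fineK//.
  apply: integrable_fin_num => //.
  apply/(integrable_mkcond _ mD2); apply: eq_integrable iGx => // y _.
  by rewrite GE indicE mem_set// mule1.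
by apply: integral0_eq => y _; rewrite GE indicE (negbTE D1x) mule0.
Qed.


Lemma Rintegral_slice_integrable2 :
  m2.-integrable D2 (fun y => (\int[m1]_(x in D1) g (x, y))%:E).
Proof.
have FE2 y : D2 y -> fubini_G m1 G y = (\int[m1]_(x in D1) (g (x, y))%:E)%E.
  move=> D2y; rewrite /fubini_G [in RHS]integral_mkcond.
  apply: eq_integral => x _.
  by rewrite GE indicE patchE mem_set// patchE; case: (x \in D1); rewrite ?mule1 ?mule0.
(* The case of the first variable is applied to [G] with its arguments swapped; Tonelli transfers
   the finiteness of the integral of |G|. *)
have iF : m2.-integrable setT (fubini_G m1 G).
  apply: (@integrable_fubini_F _ _ _ _ _ m2 m1 (G \o unstable.swap)) => /=.
  have mG : measurable_fun setT (G \o unstable.swap).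
    by apply: measurableT_comp (@measurable_swap _ _ _ _); have /integrableP[] := iG.
  apply/(integrable12ltyP m2 m1 mG) => /=.
  by apply/(integrable21ltyP m1 m2 _).1 => //; have /integrableP[] := iG.
have [mF _] := integrableP _ _ _ iF.
apply: (le_integrable _ _ _ (integrableS measurableT mD2 (@subsetT _ _) iF)) => //.
  have mm : measurable_fun D2 (fun x => fine (fubini_G m1 G x)).
    by apply: measurable_funTS; exact: measurableT_comp.
  apply/measurable_EFinP; apply: eq_measurable_fun mm => x /set_mem D2x.
  by rewrite FE2.
move=> x D2x; rewrite /Rintegral FE2//.
by case: (integral _ _ _) => //= *; rewrite normr0 leey.
Qed.

Lemma Rintegral_fubini2 :
  \int[(m1 \x m2)%E]_(z in D1 `*` D2) g z
  = \int[m2]_(y in D2) (\int[m1]_(x in D1) g (x, y)).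
Proof.
rewrite {1}/Rintegral integral_mkcond -(integral21_prod_meas1 iG).
rewrite [in RHS]/Rintegral [in RHS]integral_mkcond; congr fine.
apply: ae_eq_integral => //.
- exact: (measurable_fubini_G iG).
- have := Rintegral_slice_integrable2.
  by move=> /(integrable_mkcond _ mD2)/integrableP[].
have := ae_integrable2 iG; apply: filterS => y iGy _.
have GE2 x : G (x, y) = ((((fun x => (g (x, y))%:E) \_ D1) x) * (\1_D2 y)%:E)%E.
  by rewrite GE !patchE !indicE; case: (x \in D1); case: (y \in D2);
    rewrite ?mule1 ?mule0 ?mul0e.
rewrite /fubini_G patchE; case: ifPn => [/set_mem D2y|D2y].
  have HE x : G (x, y) = ((fun x => (g (x, y))%:E) \_ D1) x.
    by rewrite GE2 indicE mem_set// mule1.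
  under eq_integral do rewrite HE.
  rewrite -integral_mkcond /Rintegral fineK//.
  apply: integrable_fin_num => //.
  by apply/(integrable_mkcond _ mD1); apply: eq_integrable iGy => // x _.
by apply: integral0_eq => x _; rewrite GE2 indicE (negbTE D2y) mule0.
Qed.

End fubini.

Lemma continuous_compact_bounded (R : realType) (T : topologicalType) (A : set T)
    (f : T -> R) : compact A -> continuous f ->
  exists M : R, 0 < M /\ forall x, A x -> `|f x| <= M.
Proof.
move=> cA cf.
have /compact_bounded[M [Mr HM]] : compact (f @` A).
  by apply: continuous_compact => //; exact: continuous_subspaceT.
exists (Num.max M 0 + 1); split; first by rewrite ltr_wpDl// le_max lexx orbT.
move=> x Ax; apply: HM; first by rewrite ltr_pwDr// le_max lexx.
by exists x.
Qed.


Lemma continuous_mx (R : realFieldType) (T : topologicalType) m n (f : T -> 'M[R]_(m, n)) :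
  (forall i j, continuous (fun x => f x i j)) -> continuous f.
Proof.
move=> cf x; apply/cvgrPdist_le => /= e e0.
near=> y.
rewrite /Num.Def.normr/= mx_normrE (bigmax_le _ (ltW e0))//= => i _.
rewrite !mxE/=.
move: i; near: y; apply: filter_forall => /= i.
by have /cvgrPdist_le := cf i.1 i.2 x; apply.
Unshelve. all: by end_near. Qed.

(** * Integration over the fundamental domain *)

Section cube.
Context (R : realType).
Local Notation mu := (@lebesgue_measure R).
Local Notation I01 := (`[0%R, 1%R]%classic : set R).

Lemma row3_continuous : continuous (@row3 R).
Proof.
apply: continuous_mx => i j.
have -> : (fun x : R * R * R => row3 x i j) =
   (fun x => nth 0 [:: x.1.1; x.1.2; x.2] j) by apply/funext => x; rewrite mxE.
case: j => -[|[|[|//]]] /= _ x.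
- by apply: (@continuous_comp _ _ _ fst fst); exact: cvg_fst.
- by apply: (@continuous_comp _ _ _ fst snd); [exact: cvg_fst|exact: cvg_snd].
- exact: cvg_snd.
Qed.

Lemma of_coords_continuous : continuous (@of_coords R).
Proof.
apply: continuous_pair => x; first exact: cvg_fst.
apply: (@continuous_comp _ _ _ snd (@row3 R)); first exact: cvg_snd.
exact: row3_continuous.
Qed.

Lemma measurable_cube : measurable
  (cube R : set (measurableTypeR R * measurableTypeR R * measurableTypeR R)).
Proof. by apply: measurableX => //; exact: measurableX. Qed.

Lemma compact_cube : compact (cube R).
Proof. by do 2?[apply: compact_setX => //]; exact: segment_compact. Qed.

Lemma mu_itv (a b : R) : (mu `[a, b] < +oo)%E.
Proof. by rewrite lebesgue_measure_itv /=; case: ifP => _; rewrite ?ltry. Qed.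

Lemma leb2E (A B : set R) : measurable A -> measurable B ->
  leb2 (A `*` B) = (mu A * mu B)%E.
Proof. by move=> mA mB; exact: (@product_measure1E _ _ _ _ R mu mu A B mA mB). Qed.

Lemma leb3E (A : set (R * R)) (B : set R) : measurable A -> measurable B ->
  @leb3 R (A `*` B) = (leb2 A * mu B)%E.
Proof. by move=> mA mB; exact: (@product_measure1E _ _ _ _ R (@leb2 R) mu A B mA mB). Qed.

Lemma leb4E (A : set R) (B : set (R * R * R)) : measurable A -> measurable B ->
  leb4 R (A `*` B) = (mu A * @leb3 R B)%E.
Proof. by move=> mA mB; exact: (@product_measure1E _ _ _ _ R mu (@leb3 R) A B mA mB). Qed.

Lemma leb2_square : (leb2 (I01 `*` I01) < +oo)%E.
Proof. by rewrite leb2E// lte_mul_pinfty ?mu_itv// ge0_fin_numE ?mu_itv. Qed.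

Lemma leb3_cube : (@leb3 R (cube R) < +oo)%E.
Proof.
rewrite leb3E//; last exact: measurableX.
rewrite lte_mul_pinfty ?mu_itv// ge0_fin_numE; [exact: leb2_square|exact: measure_ge0].
Qed.

Lemma leb4_itv_cube (a b : R) : (leb4 R (`[a, b]%classic `*` cube R) < +oo)%E.
Proof.
rewrite leb4E//; last exact: measurable_cube.
by rewrite lte_mul_pinfty ?leb3_cube// ge0_fin_numE ?mu_itv.
Qed.

Lemma continuous_integrable2 (g : R * R -> R) : continuous g ->
  (@leb2 R).-integrable (I01 `*` I01) (EFin \o g).
Proof.
move=> cg; apply: measurable_bounded_integrable.
- exact: measurableX.
- exact: leb2_square.
- by apply: measurable_funTS; exact: continuous_measurable2.
- have [|M [M0 HM]] := @continuous_compact_bounded R _ (I01 `*` I01) g _ cg.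
    by apply: compact_setX; exact: segment_compact.
  exists M; split; first exact: num_real.
  by move=> x Mx y /= yA; rewrite (le_trans (HM _ yA))// ltW.
Qed.

Lemma continuous_integrable3 (g : R * R * R -> R) : continuous g ->
  (@leb3 R).-integrable (cube R) (EFin \o g).
Proof.
move=> cg; apply: measurable_bounded_integrable.
- exact: measurable_cube.
- exact: leb3_cube.
- by apply: measurable_funTS; exact: continuous_measurable3.
- have [|M [M0 HM]] := @continuous_compact_bounded R _ (cube R) g _ cg.
    exact: compact_cube.
  exists M; split; first exact: num_real.
  by move=> x Mx y /= yA; rewrite (le_trans (HM _ yA))// ltW.
Qed.

Lemma continuous_integrable4 (g : R * (R * R * R) -> R) (M : R) : continuous g ->
  (leb4 R).-integrable (`[- M, M] `*` cube R) (EFin \o g).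
Proof.
move=> cg; apply: measurable_bounded_integrable.
- by apply: measurableX => //; exact: measurable_cube.
- exact: leb4_itv_cube.
- by apply: measurable_funTS; exact: continuous_measurable4.
- have [|N [N0 HN]] := @continuous_compact_bounded R _ (`[- M, M] `*` cube R) g _ cg.
    by apply: compact_setX; [exact: segment_compact|exact: compact_cube].
  exists N; split; first exact: num_real.
  by move=> x Nx y /= yA; rewrite (le_trans (HN _ yA))// ltW.
Qed.

Lemma continuous_loc_integrable (f : spacetime R -> R) :
  continuous f -> loc_integrable f.
Proof.
move=> cf M; apply: continuous_integrable4 => q.
by apply: continuous_comp; [exact: of_coords_continuous|exact: cf].
Qed.

Lemma continuous_pair1 (T U V : topologicalType) (g : T * U -> V) y :
  continuous g -> continuous (fun x => g (x, y)).
Proof.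
move=> cg x; apply: (@continuous_comp _ _ _ (fun x => (x, y)) g); last exact: cg.
by apply: continuous_pair => ?; [exact: cvg_id|exact: cvg_cst].
Qed.

(** This lemma and the next two place the coordinate 0, 1, 2 respectively in the innermost integral,
    so that the fundamental theorem of calculus can be applied in any direction. *)
Lemma Rintegral_cube0 (g : R * R * R -> R) : continuous g ->
  \int[@leb3 R]_(y in cube R) g y =
  \int[mu]_(c in I01) \int[mu]_(b in I01) \int[mu]_(a in I01) g (a, b, c).
Proof.
move=> cg; have m1 : measurable (I01 `*` I01) by exact: measurableX.
rewrite (@Rintegral_fubini2 _ _ _ _ _ (@leb2 R) mu _ _ m1 _ _ (continuous_integrable3 cg))//.
apply: eq_Rintegral => c _.
by rewrite (Rintegral_fubini2 _ _ (continuous_integrable2 (continuous_pair1 cg))).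
Qed.

Lemma Rintegral_cube1 (g : R * R * R -> R) : continuous g ->
  \int[@leb3 R]_(y in cube R) g y =
  \int[mu]_(c in I01) \int[mu]_(a in I01) \int[mu]_(b in I01) g (a, b, c).
Proof.
move=> cg; have m1 : measurable (I01 `*` I01) by exact: measurableX.
rewrite (@Rintegral_fubini2 _ _ _ _ _ (@leb2 R) mu _ _ m1 _ _ (continuous_integrable3 cg))//.
apply: eq_Rintegral => c _.
by rewrite (Rintegral_fubini1 _ _ (continuous_integrable2 (continuous_pair1 cg))).
Qed.

Lemma Rintegral_cube2 (g : R * R * R -> R) : continuous g ->
  \int[@leb3 R]_(y in cube R) g y =
  \int[@leb2 R]_(ab in I01 `*` I01) \int[mu]_(c in I01) g (ab, c).
Proof.
move=> cg; have m1 : measurable (I01 `*` I01) by exact: measurableX.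
by rewrite (@Rintegral_fubini1 _ _ _ _ _ (@leb2 R) mu _ _ m1 _ _ (continuous_integrable3 cg)).
Qed.

Lemma Rintegral_is_derive (f df : R -> R) :
  (forall s : R, is_derive s 1 f (df s)) -> continuous df ->
  \int[mu]_(s in I01) df s = f 1 - f 0.
Proof.
move=> fdf cdf.
have cf : continuous f.
  by move=> s; apply/differentiable_continuous/derivable1_diffP; have [] := fdf s.
rewrite /Rintegral (@continuous_FTC2 _ df f)//.
- exact: continuous_subspaceT.
- split => [s _||]; first by have [] := fdf s.
    exact/cvg_at_right_filter/cf.
  exact/cvg_at_left_filter/cf.
- by move=> s _; rewrite derive1E; exact: derive_val.
Qed.

Lemma is_derive_line (V W : normedModType R) (F : V -> W) (p : R -> V) (s : R) (v : V) :
  (forall h, p (h + s) = h *: v + p s) -> derivable F (p s) v ->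
  is_derive s 1 (F \o p) ('D_v F (p s)).
Proof.
move=> ps dF.
have E : (fun h => h^-1 *: (F (p (h *: 1 + s)) - F (p s))) =
         (fun h => h^-1 *: (F (h *: v + p s) - F (p s))).
  by apply/funext => h; rewrite -ps /GRing.scale/= mulr1.
by split; rewrite ?/derivable ?/derive /comp E.
Qed.

(** Integrating first along the direction j leaves the difference of g on two opposite faces, which
    periodicity cancels. This is the absence of boundary terms on the torus. *)
Lemma Rintegral_cube_derive (g : spacetime R -> R) t j :
  Defs.periodic g -> (forall z, derivable g z (e_x R j)) ->
  continuous ('D_(e_x R j) g) ->
  \int[@leb3 R]_(y in cube R) 'D_(e_x R j) g (t, row3 y) = 0.
Proof.
move=> pg dg cg.
have cg' : continuous (fun y : R * R * R => 'D_(e_x R j) g (t, row3 y)).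
  move=> y; apply: (@continuous_comp _ _ _ (fun y => (t, row3 y)) ('D_(e_x R j) g)); last exact: cg.
  by apply: continuous_pair => ?; [exact: cvg_cst|exact: row3_continuous].
have row30 (q : R -> R * R * R) : (forall s h, row3 (q (h + s)) = h *: delta_mx 0 j + row3 (q s)) ->
   continuous q -> \int[mu]_(s in I01) 'D_(e_x R j) g (t, row3 (q s)) = 0.
  move=> hq cq.
  have H (s : R) : is_derive s 1 (fun s => g (t, row3 (q s))) ('D_(e_x R j) g (t, row3 (q s))).
    apply: (@is_derive_line _ _ g (fun s => (t, row3 (q s))) s (e_x R j)) => // h.
    by rewrite hq; congr pair; rewrite /= scaler0 add0r.
  rewrite (Rintegral_is_derive H); last first.
    move=> s; apply: (@continuous_comp _ _ _ q (fun y => 'D_(e_x R j) g (t, row3 y))).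
      exact: cq.
    exact: cg'.
  (* The endpoints of the segment differ by the unit vector [delta_mx 0 j], which is an integer
     translation. *)
  rewrite -[X in row3 (q X)]addr0 hq scale1r addrC.
  have -> : delta_mx 0 j = map_mx intr (delta_mx 0 j) :> 'rV[R]_3.
    by apply/matrixP => a b; rewrite !mxE; case: (_ && _).
  by rewrite (addrC (map_mx _ _)) (pg (t, _)) addrC subrr.
have J0 : \int[mu]_(c in I01) (0 : R) = 0.
  by rewrite Rintegral_cst// mul0r.
have row3D (a b c a' b' c' h : R) (k : 'I_3) :
    a' = h * (k == 0 :> nat)%:R + a -> b' = h * (k == 1%N :> nat)%:R + b ->
    c' = h * (k == 2 :> nat)%:R + c ->
    row3 (a', b', c') = h *: delta_mx 0 k + row3 (a, b, c).
  move=> -> -> ->; apply/rowP => i; rewrite !mxE.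
  by case: i => -[|[|[|//]]] Hi; case: k => -[|[|[|//]]] Hk; rewrite /= ?mulr1 ?mulr0.
case: j dg cg cg' row30 => -[|[|[|//]]] Hj dg cg cg' row30.
- rewrite Rintegral_cube0// -[RHS]J0; apply: eq_Rintegral => c _.
  rewrite -[RHS]J0; apply: eq_Rintegral => b _.
  apply: (row30 (fun a => (a, b, c))) => [s h|].
    by apply: row3D; rewrite /= ?mulr1 ?mulr0 ?add0r.
  by do 2![apply: continuous_pair => ?; last exact: cvg_cst]; exact: cvg_id.
- rewrite Rintegral_cube1// -[RHS]J0; apply: eq_Rintegral => c _.
  rewrite -[RHS]J0; apply: eq_Rintegral => a _.
  apply: (row30 (fun b => (a, b, c))) => [s h|].
    by apply: row3D; rewrite /= ?mulr1 ?mulr0 ?add0r.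
  apply: continuous_pair => ?; last exact: cvg_cst.
  by apply: continuous_pair => ?; [exact: cvg_cst|exact: cvg_id].
- rewrite Rintegral_cube2//.
  transitivity (\int[@leb2 R]_(ab in I01 `*` I01) (0 : R)).
    apply: eq_Rintegral => ab _.
    apply: (row30 (fun c => (ab, c))) => [s h|].
      by case: ab => a b; apply: row3D; rewrite /= ?mulr1 ?mulr0 ?add0r.
    by apply: continuous_pair => ?; [exact: cvg_cst|exact: cvg_id].
  by rewrite Rintegral_cst ?mul0r//; exact: measurableX.
Qed.

End cube.
Arguments measurable_cube : clear implicits.

(** * The one-dimensional kernel *)

Section trig.
Context (R : realType).
Local Notation mu := (@lebesgue_measure R).
Local Notation I01 := (`[0%R, 1%R]%classic : set R).

(** Polynomials in cos(pi x) and sin(pi x), which change sign under x -> x + 1. Functions of this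
    class therefore have period 2, and period 1 has to be proved separately, from even total
    degree. *)
Inductive trig : (R -> R) -> Prop :=
| trig_cst c : trig (fun _ => c)
| trig_cos : trig (fun x => cos (pi * x))
| trig_sin : trig (fun x => sin (pi * x))
| trig_add f g : trig f -> trig g -> trig (fun x => f x + g x)
| trig_mul f g : trig f -> trig g -> trig (fun x => f x * g x).

Lemma trig_exp f n : trig f -> trig (fun x => f x ^+ n).
Proof.
move=> tf; elim: n => [|n IH].
  by under eq_fun do rewrite expr0; exact: trig_cst.
by under eq_fun do rewrite exprS; exact: trig_mul.
Qed.

Global Instance is_derive_cospi (x : R) : is_derive x 1 (fun x => cos (pi * x)) (- (pi * sin (pi * x))).
Proof.
by apply: is_derive_eq; rewrite /GRing.scale/=; ring.
Qed.

Global Instance is_derive_sinpi (x : R) : is_derive x 1 (fun x => sin (pi * x)) (pi * cos (pi * x)).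
Proof.
by apply: is_derive_eq; rewrite /GRing.scale/=; ring.
Qed.

Lemma trig_is_derive f : trig f -> exists2 f', trig f' & forall x : R, is_derive x 1 f (f' x).
Proof.
elim=> [c|||{}f g tf [f' tf' df] tg [g' tg' dg]|{}f g tf [f' tf' df] tg [g' tg' dg]].
- by exists (fun=> 0); [exact: trig_cst|move=> x; exact: is_derive_cst].
- exists (fun x => - pi * sin (pi * x)); first exact: trig_mul (trig_cst _) trig_sin.
  by move=> x; rewrite mulNr; exact: is_derive_cospi.
- exists (fun x => pi * cos (pi * x)); first exact: trig_mul (trig_cst _) trig_cos.
  exact: is_derive_sinpi.
- by exists (fun x => f' x + g' x); [exact: trig_add|move=> x; exact: is_deriveD].
- exists (fun x => f x * g' x + g x * f' x).
    by apply: trig_add; exact: trig_mul.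
  by move=> x; exact: is_deriveM.
Qed.

Lemma trig_derivable f x : trig f -> derivable f (x : R) 1.
Proof. by move=> /trig_is_derive[f' _ df]; have [] := df x. Qed.

Lemma trig_derive1 f : trig f -> trig (derive1 f).
Proof.
move=> /trig_is_derive[f' tf' df]; suff -> : derive1 f = f' by [].
by apply/funext => x; rewrite derive1E; exact: derive_val.
Qed.

Lemma trig_derive1n f m : trig f -> trig (derive1n m f).
Proof. by move=> tf; elim: m => // m IH; rewrite derive1nS; exact: trig_derive1. Qed.

Lemma trig_continuous f : trig f -> continuous f.
Proof.
move=> tf x; apply/differentiable_continuous/derivable1_diffP.
exact: trig_derivable.
Qed.

Lemma derive1_shift (f : R -> R) y x : trig f ->
  derive1 (fun x => f (x - y)) x = derive1 f (x - y).
Proof.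
move=> tf; have [f' _ df] := trig_is_derive tf.
rewrite [RHS]derive1E (@derive_val _ _ _ _ _ _ _ (df (x - y))).
rewrite derive1E; apply: derive_val.
have h : is_derive x 1 (fun x => x - y) 1 by apply: is_derive_eq; rewrite subr0.
by have := @is_derive1_comp _ f (fun x => x - y) x _ _ (df (x - y)) h; rewrite mulr1.
Qed.

Lemma derive1n_shift (f : R -> R) y m x : trig f ->
  derive1n m (fun x => f (x - y)) x = derive1n m f (x - y).
Proof.
move=> tf; elim: m x => // m IH x; rewrite !derive1nS.
rewrite -derive1_shift; last exact: trig_derive1n.
by congr (derive1 _ x); apply/funext.
Qed.

Lemma derive1n_sum (I : Type) (r : seq I) (f : I -> R -> R) (b : I -> R) m x :
  (forall i, trig (f i)) ->
  derive1n m (fun x => \sum_(i <- r) f i x * b i) x = \sum_(i <- r) derive1n m (f i) x * b i.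
Proof.
move=> tf; elim: m x => // m IH x; rewrite derive1nS.
have -> : derive1n m (fun x => \sum_(i <- r) f i x * b i) =
          (fun x => \sum_(i <- r) derive1n m (f i) x * b i) by apply/funext.
rewrite derive1E; apply: derive_val.
elim: r {IH} => [|i r IH].
  under eq_fun do rewrite big_nil; rewrite big_nil; exact: is_derive_cst.
under eq_fun do rewrite big_cons; rewrite big_cons.
apply: is_deriveD.
have -> : (fun x => derive1n m (f i) x * b i) = (fun x => b i *: derive1n m (f i) x).
  by apply/funext => y; rewrite /GRing.scale/= mulrC.
rewrite mulrC; apply: is_deriveZ.
apply: DeriveDef; first exact/trig_derivable/trig_derive1n.
by rewrite derive1nS derive1E.
Qed.

Lemma derive1_periodic (f : R -> R) a : trig f -> (forall x, f (x + a) = f x) ->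
  forall x, derive1 f (x + a) = derive1 f x.
Proof.
move=> tf pf x; have := @derive1_shift f (- a) x tf.
rewrite opprK => <-; congr (derive1 _ x); apply/funext => y.
by rewrite pf.
Qed.

Lemma derive1n_periodic (f : R -> R) a m : trig f -> (forall x, f (x + a) = f x) ->
  forall x, derive1n m f (x + a) = derive1n m f x.
Proof.
move=> tf pf; elim: m => // m IH; rewrite derive1nS.
by apply: derive1_periodic => //; exact: trig_derive1n.
Qed.

Lemma periodic_int (f : R -> R) : (forall x, f (x + 1) = f x) ->
  forall (k : int) x, f (x + k%:~R) = f x.
Proof.
move=> pf; have pn (n : nat) x : f (x + n%:R) = f x.
  by elim: n => [|n IH]; rewrite ?addr0// -natr1 addrA pf.
by case=> n x; rewrite ?NegzE ?mulrNz -?pmulrn// -[LHS](pn n.+1) subrK.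
Qed.

End trig.

(** * Wallis integrals and moments of powers of the cosine *)

Section kernel.
Context (R : realType).
Local Notation mu := (@lebesgue_measure R).
Local Notation I01 := (`[0%R, 1%R]%classic : set R).

(* Wallis' integrals: wallis n is the mean of cos^(2n). *)
Fixpoint wallis (n : nat) : R :=
  if n is m.+1 then m.*2.+1%:R / m.*2.+2%:R * wallis m else 1.

Lemma wallis_gt0 n : 0 < wallis n.
Proof. by elim: n => //= n IH; rewrite mulr_gt0// divr_gt0 ?ltr0n. Qed.

Lemma continuous_integrable1 (f : R -> R) : continuous f -> mu.-integrable I01 (EFin \o f).
Proof.
move=> cf; apply: continuous_compact_integrable; first exact: segment_compact.
exact: continuous_subspaceT.
Qed.

Definition cospow (i j : nat) (u : R) := cos (pi * u) ^+ i * sin (pi * u) ^+ j.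

Lemma cospow_trig i j : trig (cospow i j).
Proof. by apply: trig_mul; apply: trig_exp; constructor. Qed.

Lemma cospow_shift_continuous x i j : continuous (fun y => cospow i j (x - y)).
Proof.
move=> y; apply: (@continuous_comp _ _ _ (fun y => x - y) (cospow i j)).
  by apply: cvgB; [exact: cvg_cst|exact: cvg_id].
by apply: trig_continuous; exact: cospow_trig.
Qed.

Definition cospow_int (i j : nat) (x : R) : R := \int[mu]_(y in I01) cospow i j (x - y).

Lemma is_derive_cospow i j (u : R) :
  is_derive u 1 (cospow i.+1 j.+1)
    (pi * (j.+1%:R * cospow i.+2 j u - i.+1%:R * cospow i j.+2 u)).
Proof.
have -> : cospow i.+1 j.+1 =
    ((fun u => cos (pi * u)) ^+ i.+1) * ((fun u => sin (pi * u)) ^+ j.+1).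
  by apply/funext => v; rewrite /cospow !exprfctE.
by apply: is_derive_eq; rewrite /cospow !exprfctE /GRing.scale/= !exprS; ring.
Qed.

Lemma is_derive_cospow0 i (u : R) :
  is_derive u 1 (cospow i.+1 0) (- pi * (i.+1%:R * cospow i 1 u)).
Proof.
have -> : cospow i.+1 0 = (fun u => cos (pi * u)) ^+ i.+1.
  by apply/funext => v; rewrite /cospow !exprfctE expr0 mulr1.
by apply: is_derive_eq; rewrite /cospow /GRing.scale/=; ring.
Qed.

Lemma cospowS1 i j (u : R) : cospow i.+2 j u = cospow i j u - cospow i j.+2 u.
Proof.
rewrite /cospow !exprS !mulrA; have := cos2Dsin2 (pi * u); rewrite !expr2 => h.
have -> : cos (pi * u) * cos (pi * u) = 1 - sin (pi * u) * sin (pi * u) by rewrite -h; ring.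
by ring.
Qed.

(** Integration by parts: the y-derivative of cos^(2i+1) sin^(2j+1) at x - y has integral zero over
    a period. *)
Lemma cospow_int_rec i j x :
  i.*2.+1%:R * cospow_int i.*2 j.*2.+2 x = j.*2.+1%:R * cospow_int i.*2.+2 j.*2 x.
Proof.
have D (y : R) : is_derive y 1 (fun y => cospow i.*2.+1 j.*2.+1 (x - y))
    (pi * (i.*2.+1%:R * cospow i.*2 j.*2.+2 (x - y) - j.*2.+1%:R * cospow i.*2.+2 j.*2 (x - y))).
  have h : is_derive y 1 (fun y => x - y) (-1) by apply: is_derive_eq; rewrite add0r mul1r.
  apply: is_derive_eq (@is_derive1_comp _ (cospow i.*2.+1 j.*2.+1) _ y _ _ (is_derive_cospow _ _ _) h) _.
  by ring.
have /(Rintegral_is_derive D) : continuous (fun y => pi * (i.*2.+1%:R * cospow i.*2 j.*2.+2 (x - y) - j.*2.+1%:R * cospow i.*2.+2 j.*2 (x - y)) : R).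
  apply: continuousM_fun; first exact: continuous_cst_fun.
  by apply: continuousB_fun; apply: continuousM_fun;
    do ?[exact: continuous_cst_fun|exact: cospow_shift_continuous].
have oddN (a : R) k : (- a) ^+ k.*2.+1 = - a ^+ k.*2.+1.
  by rewrite !exprS -mul2n !exprM sqrrN mulNr.
(* Both factors have an odd power and change sign under a unit shift, so the product does not. *)
have -> : cospow i.*2.+1 j.*2.+1 (x - 1) = cospow i.*2.+1 j.*2.+1 (x - 0).
  rewrite /cospow subr0 mulrBr mulr1 cosB sinB cospi sinpi !mulr0 addr0 subr0 !mulrN1.
  by rewrite !oddN mulrNN.
rewrite subrr => H.
have p0 : pi != 0 :> R by rewrite gt_eqF// pi_gt0.
have ic a k l : mu.-integrable I01 (EFin \o (fun y => a * cospow k l (x - y))).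
  apply: continuous_integrable1; apply: continuousM_fun; first exact: continuous_cst_fun.
  exact: cospow_shift_continuous.
have ic1 k l : mu.-integrable I01 (EFin \o (fun y => cospow k l (x - y))).
  by apply: continuous_integrable1; exact: cospow_shift_continuous.
apply/eqP; rewrite -subr_eq0; apply/eqP/(mulfI p0); rewrite mulr0 -[RHS]H.
rewrite [RHS]RintegralZl//; last first.
  apply: continuous_integrable1.
  by apply: continuousB_fun; apply: continuousM_fun;
    do ?[exact: continuous_cst_fun|exact: cospow_shift_continuous].
congr (_ * _).
rewrite [RHS]RintegralB//; try exact: ic.
by congr (_ - _); rewrite [RHS]RintegralZl//; exact: ic1.
Qed.

Lemma cospow_intS i j x :
  cospow_int i.+2 j x = cospow_int i j x - cospow_int i j.+2 x.
Proof.
rewrite /cospow_int -RintegralB//;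
  try by apply: continuous_integrable1; exact: cospow_shift_continuous.
by apply: eq_Rintegral => y _; rewrite cospowS1.
Qed.

Lemma cospow_int_wallis n x : cospow_int n.*2 0 x = wallis n.
Proof.
elim: n => [|n IH].
  rewrite /cospow_int (@eq_Rintegral _ _ _ _ _ (cst 1)).
    rewrite (@Rintegral_is_derive _ id) ?subr0//.
    exact: continuous_cst_fun.
  by move=> y _; rewrite /cospow mulr1.
have := cospow_int_rec n 0 x.
rewrite double0 doubleS /= -IH mul1r => H.
have E : n.*2.+2%:R * cospow_int n.*2.+2 0 x = n.*2.+1%:R * cospow_int n.*2 0 x :> R.
  have S : n.*2.+1%:R * cospow_int n.*2.+2 0 x =
      n.*2.+1%:R * (cospow_int n.*2 0 x - cospow_int n.*2 2 x) by rewrite -cospow_intS.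
  rewrite -(natr1 n.*2.+1); move: H S; move: (n.*2.+1%:R : R) => m; lra.
rewrite mulrAC -E mulrAC divff ?mul1r// pnatr_eq0.
Qed.

Lemma cospow_int_le n j x : 0 <= cospow_int n.*2 j.*2 x.
Proof.
apply: Rintegral_ge0 => y _; rewrite /cospow -!mul2n !exprM.
by rewrite mulr_ge0// exprn_ge0// sqr_ge0.
Qed.

(** The recursion gives (2q + 2j + 2) a = (2j + 1) b for the two moments a and b, and q + 2 is at
    most twice 2q + 2j + 2. Each factor sin^2 thus gains 1/n: the mass lies within distance 1/sqrt n
    of the integers. *)
Lemma cospow_int_moment q j x :
  q.+2%:R * cospow_int q.*2 j.*2.+2 x <= (2 * j.*2.+1)%:R * cospow_int q.*2 j.*2 x.
Proof.
have := cospow_int_rec q j x; rewrite cospow_intS => H.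
have h1 : 0 <= cospow_int q.*2 j.*2.+2 x by rewrite -doubleS cospow_int_le.
have h2 := cospow_int_le q j x.
set a := cospow_int _ _ _ in H h1 *; set b := cospow_int _ _ _ in H h2 *.
have qE : q.*2.+1%:R = 2 * q%:R + 1 :> R by rewrite -natr1 -mul2n natrM.
have q2E : q.+2%:R = q%:R + 2 :> R by rewrite -addn2 natrD.
have jE : j.*2.+1%:R = 2 * j%:R + 1 :> R by rewrite -natr1 -mul2n natrM.
rewrite natrM; move: H; rewrite qE q2E jE => H.
have j0 : 0 <= j%:R :> R by [].
have q0 : 0 <= q%:R :> R by [].
nra.
Qed.

End kernel.

(** * Pointwise bounds for the kernel and its first three derivatives *)

Section kernel_bound.
Context (R : realType).
Local Notation mu := (@lebesgue_measure R).
Local Notation I01 := (`[0%R, 1%R]%classic : set R).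

(* De la Vallee-Poussin kernel with n = q + 2. *)
Definition kern (q : nat) (u : R) := cospow q.*2.+4 0 u * (wallis R q.+2)^-1.

Lemma kern_trig q : trig (kern q).
Proof. by apply: trig_mul; [exact: cospow_trig|exact: trig_cst]. Qed.

(* Inverse width of the kernel. *)
Definition kscale (q : nat) : R := Num.sqrt q.+2%:R.

Lemma sqr_kscale q : kscale q ^+ 2 = q.+2%:R.
Proof. by rewrite sqr_sqrtr. Qed.

Lemma kscale_ge1 q : 1 <= kscale q.
Proof. by rewrite -(@sqrtr1 R) ler_sqrt// ler1n. Qed.

(** One plus the squared periodic distance to 0 in units of the kernel width. It stands in for a
    support condition, which a trigonometric polynomial cannot satisfy. *)
Definition kweight (q : nat) (u : R) := 1 + q.+2%:R * sin (pi * u) ^+ 2.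

Lemma kern_derive1 q : derive1 (kern q) =
  (fun u => - pi * (wallis R q.+2)^-1 * q.*2.+4%:R * cospow q.*2.+3 1 u).
Proof.
apply/funext => u; rewrite derive1E; apply: derive_val.
have -> : kern q = (wallis R q.+2)^-1 \*: cospow q.*2.+4 0.
  by apply/funext => v; rewrite /kern mulrC.
apply: is_derive_eq (is_deriveZ (wallis R q.+2)^-1 (is_derive_cospow0 q.*2.+3 u)) _.
by rewrite /GRing.scale/=; ring.
Qed.

Lemma kern_derive2 q : derive1n 2 (kern q) =
  (fun u => - pi ^+ 2 * (wallis R q.+2)^-1 * q.*2.+4%:R *
    (cospow q.*2.+4 0 u - q.*2.+3%:R * cospow q.*2.+2 2 u)).
Proof.
rewrite derive1nS derive1n1 kern_derive1.
apply/funext => u; rewrite derive1E; apply: derive_val.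
apply: is_derive_eq (is_deriveZ _ (is_derive_cospow q.*2.+2 0 u)) _.
by rewrite /GRing.scale/=; ring.
Qed.

Lemma kern_derive3 q : derive1n 3 (kern q) =
  (fun u => pi ^+ 3 * (wallis R q.+2)^-1 * q.*2.+4%:R *
    ((q.*2.+4%:R + 2 * q.*2.+3%:R) * cospow q.*2.+3 1 u
      - q.*2.+3%:R * q.*2.+2%:R * cospow q.*2.+1 3 u)).
Proof.
rewrite derive1nS kern_derive2.
apply/funext => u; rewrite derive1E; apply: derive_val.
apply: is_derive_eq (is_deriveZ _ (is_deriveB (is_derive_cospow0 q.*2.+3 u)
  (is_deriveZ _ (is_derive_cospow q.*2.+1 1 u)))) _.
by rewrite /GRing.scale/=; ring.
Qed.

(** The exponent 2q + 4 leaves a factor cos^(2q) after three derivatives. In the rescaled variable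
    sg = nu |sin(pi u)| what remains is nu^m times a polynomial of degree m in sg, which two powers
    of the weight 1 + sg^2 absorb. *)
Lemma kern_bound q m u : (m <= 3)%N ->
  `|derive1n m (kern q) u| <=
  20 * pi ^+ 3 * kscale q ^+ m * (cospow q.*2 0 u * kweight q u ^+ 2 / wallis R q.+2).
Proof.
move=> m3; have w0 := wallis_gt0 R q.+2; set P := (wallis R q.+2)^-1.
have P0 : 0 < P by rewrite invr_gt0.
set nu := kscale q; have nu1 : 1 <= nu := kscale_ge1 q.
set c := cos (pi * u); set s := sin (pi * u).
have c1 : `|c| <= 1 by rewrite ler_norml cos_geN1 cos_le1.
set E := cospow q.*2 0 u.
have E0 : 0 <= E by rewrite /E /cospow expr0 mulr1 -mul2n exprM exprn_ge0// sqr_ge0.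
have EN : E = `|c| ^+ q.*2.
  by rewrite /E /cospow expr0 mulr1 -/c -mul2n !exprM real_normK ?num_real.
have cE i j : `|cospow (q.*2 + i) j u| <= E * `|s| ^+ j.
  rewrite EN /cospow exprD !normrM !normrX -/c -/s.
  by rewrite ler_wpM2r ?exprn_ge0// ler_piMr ?exprn_ge0// exprn_ile1.
have cE0 : `|cospow q.*2.+4 0 u| <= E.
  by have := cE 4 0; rewrite expr0 mulr1 addn4.
have cE1 : `|cospow q.*2.+3 1 u| <= E * `|s|.
  by have := cE 3 1; rewrite expr1 addn3.
have cE2 : `|cospow q.*2.+2 2 u| <= E * `|s| ^+ 2.
  by have := cE 2 2; rewrite addn2.
have cE3 : `|cospow q.*2.+1 3 u| <= E * `|s| ^+ 3.
  by have := cE 1 3; rewrite addn1.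
set sg := nu * `|s|.
have sg0 : 0 <= sg by rewrite mulr_ge0// (le_trans ler01).
have W : kweight q u = 1 + sg ^+ 2.
  by rewrite /kweight -sqr_kscale -/nu exprMn real_normK ?num_real.
(* [B] is the exponent 2n = 2 nu^2 of the cosine, kept opaque so that the arithmetic below treats it
   as a variable. *)
have [B [B0 BE]] : exists B, 0 <= B /\ B = 2 * nu ^+ 2.
  by exists (2 * nu ^+ 2); rewrite mulr_ge0// sqr_ge0.
have N4 : q.*2.+4%:R = B :> R.
  by rewrite BE sqr_kscale -natrM mul2n doubleS doubleS.
have N3 : q.*2.+3%:R = B - 1 :> R by rewrite -N4 -(natr1 q.*2.+3); ring.
have N2 : q.*2.+2%:R = B - 2 :> R by rewrite -N4 -(natr1 q.*2.+3) -(natr1 q.*2.+2); ring.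
have nu2 : 1 <= nu ^+ 2 by rewrite exprn_ege1.
have pi1 : 1 <= pi :> R by rewrite (le_trans _ (pi_ge2 R))// ler1n.
have pi0 : 0 < pi :> R := pi_gt0 R.
rewrite W.
(* The witnesses 1, 2 sg, 2 + 4 sg^2 and 12 sg + 8 sg^3 are read off from the formulas for the
   derivatives, with 2n - 1 and 2n - 2 bounded by 2n in the leading terms. *)
suff [K [K20 HK]] : exists K, K <= 20 * (1 + sg ^+ 2) ^+ 2 /\
    `|derive1n m (kern q) u| <= pi ^+ m * (P * nu ^+ m * E) * K.
  have D0 : 0 <= P * nu ^+ m * E.
    by apply: mulr_ge0 E0; apply: mulr_ge0; [exact: ltW|rewrite exprn_ge0// (le_trans ler01)].
  have pim : pi ^+ m <= pi ^+ 3 :> R by rewrite ler_weXn2l.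
  apply: (le_trans HK).
  have -> : 20 * pi ^+ 3 * nu ^+ m * (E * (1 + sg ^+ 2) ^+ 2 * P) =
    pi ^+ 3 * (P * nu ^+ m * E) * (20 * (1 + sg ^+ 2) ^+ 2) by ring.
  apply: (@le_trans _ _ (pi ^+ m * (P * nu ^+ m * E) * (20 * (1 + sg ^+ 2) ^+ 2))).
    by apply: ler_wpM2l K20; apply: mulr_ge0 D0; rewrite exprn_ge0// ltW.
  apply: ler_wpM2r; first by rewrite mulr_ge0// sqr_ge0.
  exact: ler_wpM2r.
case: m m3 => [|[|[|[|//]]]] _.
- exists 1; split; first by nra.
  rewrite derive1n0 /kern normrM (ger0_norm (ltW P0)) -/P; nra.
- exists (2 * sg); split; first by nra.
  rewrite derive1n1 kern_derive1 -/P N4.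
  move: (cospow _ 1 u) cE1 => a1 cE1; rewrite !normrM normrN (ger0_norm (ltW P0)) (ger0_norm (ltW pi0)) (ger0_norm B0).
  have -> : pi ^+ 1 * (P * nu ^+ 1 * E) * (2 * sg) = pi * P * B * (E * `|s|).
    by rewrite /sg BE; ring.
  by apply: ler_wpM2l cE1; rewrite !mulr_ge0// ltW.
- exists (2 + 4 * sg ^+ 2); split; first by nra.
  rewrite kern_derive2 -/P N4 N3.
  move: (cospow _ 0 u) (cospow _ 2 u) cE0 cE2 => a0 a2 cE0 cE2; rewrite !normrM normrN normrX (ger0_norm (ltW P0)) (ger0_norm (ltW pi0)) (ger0_norm B0).
  have -> : pi ^+ 2 * (P * nu ^+ 2 * E) * (2 + 4 * sg ^+ 2) =
      pi ^+ 2 * P * B * (E + 2 * nu ^+ 2 * (E * `|s| ^+ 2)).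
    by rewrite /sg BE; ring.
  apply: ler_wpM2l; first by rewrite !mulr_ge0// ?exprn_ge0// ltW.
  rewrite BE (le_trans (ler_normB _ _))// lerD// normrM ger0_norm; last by move: nu2; clear; nra.
  have : 0 <= E * `|s| ^+ 2 by rewrite mulr_ge0// sqr_ge0.
  by move: cE2; move: (`|a2|) (E * _) => a b; nra.
- exists (12 * sg + 8 * sg ^+ 3); split.
    have := sqr_ge0 (sg - 1); have := sqr_ge0 (sg ^+ 2 - sg); nra.
  rewrite kern_derive3 -/P N4 N3 N2.
  move: (cospow _ 1 u) (cospow _ 3 u) cE1 cE3 => a1 a3 cE1 cE3; rewrite 3!normrM normrX (ger0_norm (ltW P0)) (ger0_norm (ltW pi0)) (ger0_norm B0).
  have -> : pi ^+ 3 * (P * nu ^+ 3 * E) * (12 * sg + 8 * sg ^+ 3) =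
      pi ^+ 3 * P * B * (6 * nu ^+ 2 * (E * `|s|) + 4 * nu ^+ 4 * (E * `|s| ^+ 3)).
    by rewrite /sg BE; ring.
  apply: ler_wpM2l; first by rewrite !mulr_ge0// ?exprn_ge0// ltW.
  rewrite BE (le_trans (ler_normB _ _))// lerD//.
    rewrite normrM ger0_norm; last by move: nu2; clear; nra.
    have : 0 <= E * `|s| by rewrite mulr_ge0.
    by move: cE1; move: (`|a1|) (E * _) => a b; nra.
  have -> : nu ^+ 4 = nu ^+ 2 * nu ^+ 2 by ring.
  rewrite normrM ger0_norm; last by move: nu2; clear; nra.
  have : 0 <= E * `|s| ^+ 3 by rewrite mulr_ge0// exprn_ge0.
  move: cE3 nu2; move: (`|a3|) (E * _) (nu ^+ 2) => a b n H1 H2 H3.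
  apply: (@le_trans _ _ ((2 * n - 1) * (2 * n - 2) * b)).
    by rewrite ler_wpM2l//; nra.
  by rewrite ler_wpM2r//; nra.
Qed.

End kernel_bound.

(** * Weighted integrals of the kernel and separation of variables *)

Section kernel_moment.
Context (R : realType).
Local Notation mu := (@lebesgue_measure R).
Local Notation I01 := (`[0%R, 1%R]%classic : set R).

(** Expanding the cube of the weight gives moments of order 0, 2, 4, 6, which relative to the zeroth
    contribute at most 1 + 3 * 2 + 3 * 12 + 120 = 163. The ratio of [wallis R q.+2] to [wallis R q]
    is at least 3/8, and 163 * 8/3 < 435. *)
Lemma kweight_moment q (x : R) :
  \int[mu]_(y in I01) (cospow q.*2 0 (x - y) * kweight q (x - y) ^+ 3)
  <= 435 * wallis R q.+2.
Proof.
have E : forall y, cospow q.*2 0 (x - y) * kweight q (x - y) ^+ 3 =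
   (cospow q.*2 0 (x - y) + 3 * q.+2%:R * cospow q.*2 2 (x - y)) +
   (3 * q.+2%:R ^+ 2 * cospow q.*2 4 (x - y) + q.+2%:R ^+ 3 * cospow q.*2 6 (x - y)).
  by move=> y; rewrite /cospow /kweight; ring.
have ic i j : mu.-integrable I01 (EFin \o (fun y => cospow i j (x - y))).
  by apply: continuous_integrable1; exact: cospow_shift_continuous.
have icc a i j : mu.-integrable I01 (EFin \o (fun y => a * cospow i j (x - y))).
  apply: continuous_integrable1; apply: continuousM_fun; first exact: continuous_cst_fun.
  exact: cospow_shift_continuous.
under eq_Rintegral => y _ do rewrite E.
rewrite RintegralD//; last 2 first.
- by apply: continuous_integrable1; apply: continuousD_fun;
    do ?[apply: continuousM_fun; first exact: continuous_cst_fun]; exact: cospow_shift_continuous.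
- by apply: continuous_integrable1; apply: continuousD_fun;
    do ?[apply: continuousM_fun; first exact: continuous_cst_fun]; exact: cospow_shift_continuous.
rewrite !RintegralD// !RintegralZl//.
have := cospow_int_moment q 0 x; have := cospow_int_moment q 1 x; have := cospow_int_moment q 2 x.
have := cospow_int_wallis q x.
rewrite /cospow_int !doubleS double0.
move: (Rintegral _ _ _) (Rintegral _ _ _) (Rintegral _ _ _) (Rintegral _ _ _) => a b c d.
move=> dE; have w0 := wallis_gt0 R q.
have d0 : 0 < d by rewrite dE.
have -> : wallis R q.+2 = q.*2.+3%:R / q.*2.+4%:R * (q.*2.+1%:R / q.*2.+2%:R * d).
  by rewrite dE /=.
have n0 : 0 <= q.+2%:R :> R by [].
move: (q.+2%:R : R) n0 => n n0 h3 h2 h1.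
have {}h1 : n * a <= 2 * d by exact: h1.
have {}h2 : n * b <= 6 * a by exact: h2.
have {}h3 : n * c <= 10 * b by exact: h3.
have h2n : n * (n * b) <= n * (6 * a) by exact: ler_wpM2l.
have h3n : n * (n * (n * c)) <= n * (n * (10 * b)) by do 2!apply: ler_wpM2l => //.
(* The two ratios in the Wallis recursion are smallest at q = 0, where they equal 1/2 and 3/4. *)
have r1 : 1 / 2 <= q.*2.+1%:R / q.*2.+2%:R :> R.
  rewrite ler_pdivrMr ?ltr0n// mulrAC ler_pdivlMr ?ltr0n// mul1r -natrM ler_nat.
  by rewrite -!mul2n; lia.
have r2 : 3 / 4 <= q.*2.+3%:R / q.*2.+4%:R :> R.
  rewrite ler_pdivrMr ?ltr0n// mulrAC ler_pdivlMr ?ltr0n// -!natrM ler_nat.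
  by rewrite -!mul2n; lia.
have r3 : 3 / 8 * d <= q.*2.+3%:R / q.*2.+4%:R * (q.*2.+1%:R / q.*2.+2%:R * d).
  rewrite mulrA ler_pM2r//.
  by apply: le_trans (ler_pM _ _ r2 r1) => //; lra.
move: r3; move: (_ / _ * (_ / _ * d)) => X r3; clear r1 r2; nra.
Qed.

Lemma kern_shift_continuous q m (x : R) : continuous (fun y => derive1n m (kern q) (x - y) : R).
Proof.
move=> y; apply: (@continuous_comp _ _ _ (fun y => x - y) (derive1n m (kern q))).
  by apply: cvgB; [exact: cvg_cst|exact: cvg_id].
by apply: trig_continuous; apply: trig_derive1n; exact: kern_trig.
Qed.

Lemma kweight_trig q : trig (@kweight R q).
Proof.
apply: trig_add; first exact: trig_cst.
by apply: trig_mul; [exact: trig_cst|apply: trig_exp; exact: trig_sin].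
Qed.

Lemma trig_shift_continuous (f : R -> R) x : trig f -> continuous (fun y => f (x - y)).
Proof.
move=> tf y; apply: (@continuous_comp _ _ _ (fun y => x - y) f).
  by apply: cvgB; [exact: cvg_cst|exact: cvg_id].
exact: trig_continuous.
Qed.

(** The product of the constants 20 pi^3 of [kern_bound] and 435 of [kweight_moment]. *)
Definition kern_const : R := 20 * pi ^+ 3 * 435.

Lemma kern_const_gt0 : 0 < kern_const.
Proof. by rewrite /kern_const mulr_gt0 ?mulr_gt0 ?exprn_gt0 ?pi_gt0 ?ltr0n. Qed.

(** Of the three powers of the weight in [kweight_moment], two pay for the derivatives of the
    kernel; the third is left for the growth of the function being convolved. *)
Lemma kern_weighted_int q m (x : R) : (m <= 3)%N ->
  \int[mu]_(y in I01) (`|derive1n m (kern q) (x - y)| * kweight q (x - y))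
  <= kern_const * kscale R q ^+ m.
Proof.
move=> m3; have w0 := wallis_gt0 R q.+2.
have W0 u : 0 <= @kweight R q u by rewrite addr_ge0// mulr_ge0// sqr_ge0.
have Wc := @trig_shift_continuous _ x (kweight_trig q).
have cc : continuous (fun y => cospow q.*2 0 (x - y) * kweight q (x - y) ^+ 3).
  apply: (@trig_shift_continuous (fun u => cospow q.*2 0 u * kweight q u ^+ 3)).
  by apply: trig_mul; [exact: cospow_trig|apply: trig_exp; exact: kweight_trig].
set a := 20 * pi ^+ 3 * kscale R q ^+ m / wallis R q.+2.
have a0 : 0 <= a.
  rewrite /a divr_ge0 ?(ltW w0)// mulr_ge0 ?exprn_ge0 ?sqrtr_ge0//.
  by rewrite mulr_ge0// exprn_ge0// pi_ge0.
apply: (@le_trans _ _ (\int[mu]_(y in I01)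
    (a * (cospow q.*2 0 (x - y) * kweight q (x - y) ^+ 3)))).
  apply: le_Rintegral => //.
  - apply: continuous_integrable1; apply: continuousM_fun => //.
    by apply: continuous_norm_fun; exact: kern_shift_continuous.
  - by apply: continuous_integrable1; apply: continuousM_fun => //; exact: continuous_cst_fun.
  - move=> y _; have := kern_bound q (x - y) m3.
    move=> /(ler_wpM2r (W0 (x - y)))/le_trans; apply.
    by rewrite le_eqVlt; apply/orP; left; apply/eqP; rewrite /a; ring.
rewrite RintegralZl//; last exact: continuous_integrable1.
apply: (le_trans (ler_wpM2l a0 (kweight_moment q x))).
rewrite le_eqVlt; apply/orP; left; apply/eqP; rewrite /a /kern_const.
by field; rewrite gt_eqF.
Qed.

Lemma kern_int q (x : R) : \int[mu]_(y in I01) kern q (x - y) = 1.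
Proof.
rewrite /kern RintegralZr//.
  have := cospow_int_wallis q.+2 x; rewrite /cospow_int !doubleS => ->.
  by rewrite divff// gt_eqF// wallis_gt0.
by apply: continuous_integrable1; exact: cospow_shift_continuous.
Qed.

Lemma cospow_periodic i j (u : R) : ~~ odd (i + j) -> cospow i j (u + 1) = cospow i j u.
Proof.
move=> ij; rewrite /cospow mulrDr mulr1 (cosD (pi * u)) (sinD (pi * u) pi) cospi sinpi !mulr0 addr0 subr0 !mulrN1.
rewrite exprNn [X in _ * X]exprNn mulrACA -exprD -signr_odd (negbTE ij) expr0 mul1r//.
Qed.

(* The binomial expansion of the power of cos(pi(x - y)) separates variables. *)
Definition kalpha q (r : 'I_q.*2.+4.+1) (x : R) : R :=
  cospow (q.*2.+4 - r) r x * ('C(q.*2.+4, r)%:R / wallis R q.+2).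
Definition kbeta q (r : 'I_q.*2.+4.+1) (y : R) : R := cospow (q.*2.+4 - r) r y.

Lemma kalpha_trig q r : trig (@kalpha q r).
Proof. by apply: trig_mul; [exact: cospow_trig|exact: trig_cst]. Qed.

Lemma kbeta_trig q r : trig (@kbeta q r).
Proof. exact: cospow_trig. Qed.

Lemma kbeta_periodic q r x : @kbeta q r (x + 1) = kbeta r x.
Proof.
by apply: cospow_periodic; rewrite subnK ?leq_ord// !oddS odd_double.
Qed.

Lemma kalpha_periodic q r x : @kalpha q r (x + 1) = kalpha r x.
Proof. by rewrite /kalpha; congr (_ * _); exact: kbeta_periodic. Qed.

Lemma kern_periodic q (x : R) : kern q (x + 1) = kern q x.
Proof. by rewrite /kern cospow_periodic// addn0 !oddS odd_double. Qed.

Lemma kern_sep q m x y :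
  derive1n m (kern q) (x - y) = \sum_r derive1n m (@kalpha q r) x * kbeta r y.
Proof.
rewrite -derive1n_shift; last exact: kern_trig.
rewrite -derive1n_sum; last exact: kalpha_trig.
congr (derive1n m _ x); apply/funext => {}x.
rewrite /kern /cospow expr0 mulr1 mulrBr cosB exprDn mulr_suml.
apply: eq_bigr => r _; rewrite /kalpha /kbeta /cospow !exprMn -mulr_natr; ring.
Qed.

End kernel_moment.

(** * Convolution with the three-dimensional kernel *)

Section smooth_class.
Context (R : realType).
Local Notation spacetime := (spacetime R).

(* Polynomials in trigonometric functions of the space coordinates and in
   functions of time taken from a class Q: a class stable under space
   derivatives, and under all derivatives when Q is stable under d/dt. *)
Inductive tpoly (Q : (R -> R) -> Prop) : (spacetime -> R) -> Prop :=
| tpoly_cst c : tpoly Q (fun _ => c)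
| tpoly_space i a : trig a -> tpoly Q (fun z => a (z.2 0 i))
| tpoly_time g : Q g -> tpoly Q (fun z => g z.1)
| tpoly_add f g : tpoly Q f -> tpoly Q g -> tpoly Q (fun z => f z + g z)
| tpoly_mul f g : tpoly Q f -> tpoly Q g -> tpoly Q (fun z => f z * g z).

Lemma tpoly_sum Q (I : Type) (r : seq I) (F : I -> spacetime -> R) :
  (forall i, tpoly Q (F i)) -> tpoly Q (fun z => \sum_(i <- r) F i z).
Proof.
move=> SF; elim: r => [|i r IH].
  by under eq_fun do rewrite big_nil; exact: tpoly_cst.
by under eq_fun do rewrite big_cons; exact: tpoly_add.
Qed.

Lemma tpoly_prod Q (I : Type) (r : seq I) (F : I -> spacetime -> R) :
  (forall i, tpoly Q (F i)) -> tpoly Q (fun z => \prod_(i <- r) F i z).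
Proof.
move=> SF; elim: r => [|i r IH].
  by under eq_fun do rewrite big_nil; exact: tpoly_cst.
by under eq_fun do rewrite big_cons; exact: tpoly_mul.
Qed.

Lemma tpoly_sub Q f g : tpoly Q f -> tpoly Q g -> tpoly Q (fun z => f z - g z).
Proof.
move=> Sf Sg; under eq_fun do rewrite -mulN1r.
by apply: tpoly_add => //; apply: tpoly_mul => //; exact: tpoly_cst.
Qed.

Lemma coord_space_continuous i : continuous (fun z : spacetime => z.2 0 i).
Proof.
move=> z; apply: (@continuous_comp _ _ _ snd (fun x : 'rV[R]_3 => x 0 i)).
  exact: cvg_snd.
exact: coord_continuous.
Qed.

Lemma tpoly_continuous Q f : (forall g, Q g -> continuous g) -> tpoly Q f -> continuous f.
Proof.
move=> cQ; elim=> [c|i a ta|g Qg|{}f g Sf cf Sg cg|{}f g Sf cf Sg cg].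
- exact: continuous_cst_fun.
- move=> z; apply: (@continuous_comp _ _ _ (fun z : spacetime => z.2 0 i) a).
    exact: coord_space_continuous.
  exact: trig_continuous.
- move=> z; apply: (@continuous_comp _ _ _ fst g); first exact: cvg_fst.
  exact: cQ.
- exact: continuousD_fun.
- exact: continuousM_fun.
Qed.

Lemma is_derive_scale (a : R -> R) (x c a' : R) :
  is_derive x 1 a a' -> is_derive x c a (c * a').
Proof.
move=> [da <-]; have dfa := (derivable1_diffP _ _).1 da.
split; first exact: diff_derivable.
by rewrite !deriveE// -[in LHS](mulr1 c) -[c * 1]/(c *: (1 : R)) linearZ.
Qed.

Lemma is_derive_linear_comp (V : normedModType R) (L : V -> R) (a : R -> R) (z h : V) l :
  (forall s, L (s *: h + z) = s * L h + L z) ->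
  is_derive (L z) (L h) a l -> is_derive z h (fun z => a (L z)) l.
Proof.
move=> HL [da <-].
have E : (fun s : R => s^-1 *: (a (L (s *: h + z)) - a (L z))) =
         (fun s : R => s^-1 *: (a (s *: L h + L z) - a (L z))).
  by apply/funext => s; rewrite HL.
by split; rewrite ?/derivable ?/derive E.
Qed.

(** The two alternatives match two uses: space directions, for fields that are merely continuous in
    time, and all directions, for mollified test functions with smooth time coefficients. *)
Lemma tpoly_is_derive Q (h : spacetime) f :
  h.1 = 0 \/ (forall g : R -> R, Q g -> (forall t : R, derivable g t 1) /\ Q (derive1 (g : R -> R))) ->
  tpoly Q f -> exists2 f', tpoly Q f' & forall z, is_derive z h f (f' z).
Proof.
move=> hQ; elim=> [c|i a ta|g Qg|{}f g Sf [f' Sf' df] Sg [g' Sg' dg]|{}f g Sf [f' Sf' df] Sg [g' Sg' dg]].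
- by exists (fun=> 0); [exact: tpoly_cst|move=> z; exact: is_derive_cst].
- exists (fun z : spacetime => h.2 0 i * derive1 a (z.2 0 i)).
    by apply: tpoly_mul; [exact: tpoly_cst|apply: tpoly_space; exact: trig_derive1].
  move=> z; apply: (@is_derive_linear_comp _ (fun z : spacetime => z.2 0 i)).
    by move=> s; rewrite /= !mxE.
  apply: is_derive_scale; apply: DeriveDef; first exact: trig_derivable.
  by rewrite derive1E.
- case: hQ => [h0|/(_ _ Qg)[dg Qg']].
    exists (fun=> 0); first exact: tpoly_cst.
    move=> z; apply: (@is_derive_linear_comp _ (fun z : spacetime => z.1)) => //.
    by rewrite h0; exact: is_derive0.
  exists (fun z : spacetime => h.1 * derive1 g z.1).
    by apply: tpoly_mul; [exact: tpoly_cst|exact: tpoly_time].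
  move=> z; apply: (@is_derive_linear_comp _ (fun z : spacetime => z.1)) => //.
  by apply: is_derive_scale; apply: DeriveDef; rewrite ?derive1E.
- by exists (fun z : spacetime => f' z + g' z); [exact: tpoly_add|move=> z; exact: is_deriveD].
- exists (fun z : spacetime => f z * g' z + g z * f' z); first by apply: tpoly_add; exact: tpoly_mul.
  by move=> z; exact: is_deriveM.
Qed.

Lemma tpoly_derivable Q (h : spacetime) f z :
  h.1 = 0 \/ (forall g : R -> R, Q g -> (forall t : R, derivable g t 1) /\ Q (derive1 (g : R -> R))) ->
  tpoly Q f -> derivable f z h.
Proof. by move=> hQ /(tpoly_is_derive hQ)[f' _ /(_ z)[]]. Qed.

Lemma tpoly_iter_derive Q (s : seq spacetime) f :
  (forall h, h \in s -> h.1 = 0) \/ (forall g : R -> R, Q g -> (forall t : R, derivable g t 1) /\ Q (derive1 (g : R -> R))) ->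
  tpoly Q f -> tpoly Q (iter_derive s f).
Proof.
elim: s => [//|h s IH] hQ Sf /=.
have {}IH : tpoly Q (iter_derive s f).
  by apply: IH => //; case: hQ => [H|]; [left => k ks; apply: H; rewrite inE ks orbT|right].
have [|f' Sf' df] := @tpoly_is_derive Q h _ _ IH.
  by case: hQ => [H|]; [left; apply: H; rewrite mem_head|right].
suff -> : 'D_h (iter_derive s f) = f' by [].
by apply/funext => z; exact: derive_val.
Qed.

End smooth_class.

(** * The convolution as a finite sum of separated terms *)

Section operator.
Context (R : realType) (q : nat).
Local Notation spacetime := (spacetime R).
Local Notation mu := (@lebesgue_measure R).
Local Notation I01 := (`[0%R, 1%R]%classic : set R).
Local Notation idx := {ffun 'I_3 -> 'I_q.*2.+4.+1}.
Implicit Types (m : 'I_3 -> nat) (f g : spacetime -> R) (r : idx).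

Definition Afac m r (x : 'rV[R]_3) : R := \prod_i derive1n (m i) (kalpha (r i)) (x 0 i).
Definition Bfac r (y : 'rV[R]_3) : R := \prod_i kbeta (r i) (y 0 i).
Definition kcoef r f (t : R) : R :=
  \int[@leb3 R]_(y in cube R) (Bfac r (row3 y) * f (t, row3 y)).
(* (d^m K) * f, where d^m is the derivative with multi-index m. *)
Definition kconv m f (z : spacetime) : R := \sum_r Afac m r z.2 * kcoef r f z.1.
Definition kern3 m (u : 'rV[R]_3) : R := \prod_i derive1n (m i) (kern q) (u 0 i).
Definition multi_incr m (j : 'I_3) : 'I_3 -> nat := fun i => (m i + (i == j))%N.

Lemma kern3_sep m x y : kern3 m (x - y) = \sum_r Afac m r x * Bfac r y.
Proof.
rewrite /kern3; under eq_bigr do rewrite !mxE kern_sep.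
rewrite bigA_distr_bigA; apply: eq_bigr => r _.
by rewrite big_split.
Qed.

Lemma tpoly_Afac Q m r : tpoly Q (fun z : spacetime => Afac m r z.2).
Proof.
apply: tpoly_prod => i; apply: (@tpoly_space _ Q i (derive1n (m i) (kalpha (r i)))).
by apply: trig_derive1n; exact: kalpha_trig.
Qed.

Lemma tpoly_Bfac Q r : tpoly Q (fun z : spacetime => Bfac r z.2).
Proof.
apply: tpoly_prod => i; apply: (@tpoly_space _ Q i (kbeta (r i))).
exact: kbeta_trig.
Qed.

Lemma tpoly_kconv (Q : (R -> R) -> Prop) m f : (forall r, Q (kcoef r f)) -> tpoly Q (kconv m f).
Proof.
move=> Qf; apply: tpoly_sum => r; apply: tpoly_mul; first exact: tpoly_Afac.
exact: (@tpoly_time _ Q (kcoef r f)).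
Qed.

Lemma slice_continuous f t : continuous f -> continuous (fun y : R * R * R => f (t, row3 y)).
Proof.
move=> cf y; apply: (@continuous_comp _ _ _ (fun y => (t, row3 y)) f); last exact: cf.
by apply: continuous_pair => ?; [exact: cvg_cst|exact: row3_continuous].
Qed.

Lemma Bfac_continuous r : continuous (fun y : R * R * R => Bfac r (row3 y)).
Proof.
have /(@tpoly_continuous _ (fun=> False))/(@slice_continuous _ 0) := tpoly_Bfac (fun=> False) r.
by apply.
Qed.

Lemma coef_integrable r f t : continuous f ->
  (@leb3 R).-integrable (cube R) (EFin \o (fun y => Bfac r (row3 y) * f (t, row3 y))).
Proof.
move=> cf; apply: continuous_integrable3; apply: continuousM_fun.
  exact: Bfac_continuous.
exact: slice_continuous.
Qed.

Lemma Rintegral_sum d (T : measurableType d) (nu : {measure set T -> \bar R})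
    (D : set T) (I : Type) (s : seq I) (F : I -> T -> R) :
  measurable D -> (forall i, nu.-integrable D (EFin \o F i)) ->
  \int[nu]_(x in D) (\sum_(i <- s) F i x) = \sum_(i <- s) \int[nu]_(x in D) F i x.
Proof.
move=> mD iF; elim: s => [|i s IH].
  under eq_Rintegral do rewrite big_nil.
  by rewrite Rintegral_cst ?mul0r// big_nil.
under eq_Rintegral do rewrite big_cons.
rewrite RintegralD//; last first.
  have -> : EFin \o (fun x => \sum_(i <- s) F i x) = (fun x => \sum_(i <- s) (F i x)%:E)%E.
    by apply/funext => x /=; rewrite sumEFin.
  by apply: (@integrable_sum _ _ _ _ _ mD _ s xpredT (fun i x => (F i x)%:E)) => i0 _; exact: iF.
by rewrite IH big_cons.
Qed.

(** The separated sum gives regularity and duality; this integral form gives the size estimates. *)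
Lemma kconv_int m f t x : continuous f ->
  kconv m f (t, x) = \int[@leb3 R]_(y in cube R) (kern3 m (x - row3 y) * f (t, row3 y)).
Proof.
move=> cf; rewrite /kconv /=.
under [RHS]eq_Rintegral do rewrite kern3_sep mulr_suml.
rewrite Rintegral_sum; [|exact: measurable_cube|]; last first.
  move=> r; have := integrableZl (measurable_cube R) (Afac m r x) (coef_integrable r t cf).
  by apply: eq_integrable => [|y _]; [exact: measurable_cube|rewrite /= -EFinM mulrA].
apply: eq_bigr => r _; rewrite /kcoef -RintegralZl; [|exact: measurable_cube|exact: coef_integrable].
by apply: eq_Rintegral => y _; rewrite mulrA.
Qed.

Lemma coef_linear r f g (a b : R) t : continuous f -> continuous g ->
  kcoef r (fun z => a * f z + b * g z) t = a * kcoef r f t + b * kcoef r g t.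
Proof.
move=> cf cg; have mc := measurable_cube R.
rewrite /kcoef -!RintegralZl//; try exact: coef_integrable.
rewrite -RintegralD//.
- by apply: eq_Rintegral => y _; ring.
- have := integrableZl mc a (coef_integrable r t cf).
  by apply: eq_integrable.
- have := integrableZl mc b (coef_integrable r t cg).
  by apply: eq_integrable.
Qed.

Lemma kconv_linear m f g (a b : R) z : continuous f -> continuous g ->
  kconv m (fun z => a * f z + b * g z) z = a * kconv m f z + b * kconv m g z.
Proof.
move=> cf cg; rewrite /kconv !mulr_sumr -big_split; apply: eq_bigr => r _ /=.
by rewrite coef_linear//; ring.
Qed.

Lemma kconvB m f g z : continuous f -> continuous g ->
  kconv m (fun z => f z - g z) z = kconv m f z - kconv m g z.
Proof.
move=> cf cg; have := @kconv_linear m f g 1 (-1) z cf cg; rewrite mul1r mulN1r => <-.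
by congr (kconv m _ z); apply/funext => w; rewrite mul1r mulN1r.
Qed.

Lemma is_derive_prod3 (a a' : 'I_3 -> R -> R) (z : spacetime) j :
  (forall i (x : R), is_derive x 1 (a i) (a' i x)) ->
  is_derive z (e_x R j) (fun z : spacetime => \prod_i a i (z.2 0 i))
    (\prod_i (if i == j then a' i else a i) (z.2 0 i)).
Proof.
move=> da.
have dc i : is_derive z (e_x R j) (fun z : spacetime => a i (z.2 0 i))
    ((i == j)%:R * a' i (z.2 0 i)).
  apply: (@is_derive_linear_comp _ _ (fun z : spacetime => z.2 0 i)).
    by move=> s; rewrite /= !mxE.
  have -> : (e_x R j).2 0 i = (i == j)%:R by rewrite mxE eqxx.
  exact: is_derive_scale.
have -> : (fun z : spacetime => \prod_i a i (z.2 0 i)) =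
  (fun z => a ord0 (z.2 0 ord0) * (a (lift ord0 ord0) (z.2 0 (lift ord0 ord0)) *
     a (lift ord0 (lift ord0 ord0)) (z.2 0 (lift ord0 (lift ord0 ord0))))).
  by apply/funext => w; rewrite !big_ord_recl big_ord0 mulr1.
apply: is_derive_eq (is_deriveM (dc _) (is_deriveM (dc _) (dc _))) _.
rewrite !big_ord_recl big_ord0 mulr1 /GRing.scale/=.
rewrite -!val_eqE /=.
case: j {dc} => -[|[|[|//]]] Hj /=; rewrite ?mul0r ?mul1r ?mulr0 ?addr0 ?add0r ?mulrfctE; ring.
Qed.

Lemma is_derive_Afac m r z j :
  is_derive z (e_x R j) (fun z : spacetime => Afac m r z.2) (Afac (multi_incr m j) r z.2).
Proof.
have := @is_derive_prod3 (fun i => derive1n (m i) (kalpha (r i)))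
  (fun i => derive1n (m i).+1 (kalpha (r i))) z j.
have H i (x : R) : is_derive x 1 (derive1n (m i) (kalpha (r i))) (derive1n (m i).+1 (kalpha (r i)) x).
  apply: DeriveDef; first by apply/trig_derivable/trig_derive1n/kalpha_trig.
  by rewrite derive1nS derive1E.
move=> /(_ H) /is_derive_eq; apply; apply: eq_bigr => i _.
by rewrite /multi_incr; case: ifP => _; rewrite ?addn1 ?addn0.
Qed.

Lemma is_derive_kconv m f z j :
  is_derive z (e_x R j) (kconv m f) (kconv (multi_incr m j) f z).
Proof.
rewrite /kconv; elim: (index_enum _) => [|r s IH].
  under eq_fun do rewrite big_nil; rewrite big_nil; exact: is_derive_cst.
under eq_fun do rewrite big_cons; rewrite big_cons.
apply: is_deriveD.
have h : is_derive z (e_x R j) (fun z : spacetime => kcoef r f z.1) 0.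
  apply: (@is_derive_linear_comp _ _ (fun z : spacetime => z.1)) => //.
  exact: is_derive0.
apply: is_derive_eq (is_deriveM (is_derive_Afac m r z j) h) _.
by rewrite scaler0 add0r /GRing.scale/= mulrC.
Qed.

Lemma Afac_periodic m r x (k : 'rV[int]_3) : Afac m r (x + map_mx intr k) = Afac m r x.
Proof.
apply: eq_bigr => i _; rewrite !mxE periodic_int// => u.
by apply: derive1n_periodic; [exact: kalpha_trig|exact: kalpha_periodic].
Qed.

Lemma kconv_periodic m f : Defs.periodic (kconv m f).
Proof. by move=> z k; rewrite /kconv /=; apply: eq_bigr => r _; rewrite Afac_periodic. Qed.

Lemma kern3_periodic m x (k : 'rV[int]_3) : kern3 m (x + map_mx intr k) = kern3 m x.
Proof.
apply: eq_bigr => i _; rewrite !mxE periodic_int// => u.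
by apply: derive1n_periodic; [exact: kern_trig|exact: kern_periodic].
Qed.

End operator.

(** * Integration by parts and weighted bounds for the convolution *)

Section operator_bounds.
Context (R : realType) (q : nat).
Local Notation spacetime := (spacetime R).
Local Notation mu := (@lebesgue_measure R).
Local Notation I01 := (`[0%R, 1%R]%classic : set R).
Local Notation kconv := (@kconv R q).
Local Notation kern3 := (@kern3 R q).
Implicit Types (m : 'I_3 -> nat) (f g : spacetime -> R).

Lemma is_derive_kern3 m x w j :
  is_derive w (e_x R j) (fun w : spacetime => kern3 m (x - w.2)) (- kern3 (multi_incr m j) (x - w.2)).
Proof.
have := @is_derive_prod3 R (fun i u => derive1n (m i) (kern q) (x 0 i - u))
  (fun i u => - derive1n (m i).+1 (kern q) (x 0 i - u)) w j.
have H i (u : R) : is_derive u 1 (fun u => derive1n (m i) (kern q) (x 0 i - u))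
    (- derive1n (m i).+1 (kern q) (x 0 i - u)).
  have h : is_derive u 1 (fun u => x 0 i - u) (-1) by apply: is_derive_eq; rewrite add0r mul1r.
  have k : is_derive (x 0 i - u) 1 (derive1n (m i) (kern q)) (derive1n (m i).+1 (kern q) (x 0 i - u)).
    apply: DeriveDef; first by apply/trig_derivable/trig_derive1n/kern_trig.
    by rewrite derive1nS derive1E.
  by have := @is_derive1_comp _ (derive1n (m i) (kern q)) _ u _ _ k h; rewrite mulrN1.
move=> /(_ H).
have -> : (fun z : spacetime => \prod_i derive1n (m i) (kern q) (x 0 i - z.2 0 i)) =
    (fun w : spacetime => kern3 m (x - w.2)).
  by apply/funext => z; apply: eq_bigr => i _; rewrite !mxE.
move=> /is_derive_eq; apply.
rewrite /kern3 (bigD1 j)//= [in RHS](bigD1 j)//= /multi_incr eqxx addn1 mulNr !mxE; congr (- (_ * _)).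
by apply: eq_bigr => i /negbTE ->; rewrite addn0 !mxE.
Qed.

Lemma kern3_continuous m x : continuous (fun w : spacetime => kern3 m (x - w.2)).
Proof.
apply: continuous_prod_fun => i z.
apply: (@continuous_comp _ _ _ (fun w : spacetime => (x - w.2) 0 i) (derive1n (m i) (kern q))).
  have -> : (fun w : spacetime => (x - w.2) 0 i) = (fun w => x 0 i - w.2 0 i).
    by apply/funext => w; rewrite !mxE.
  by apply: continuousB_fun => //; [exact: continuous_cst_fun|exact: coord_space_continuous].
by apply: trig_continuous; apply: trig_derive1n; exact: kern_trig.
Qed.

(** K(x - y) f(y) is periodic in y, so its y-derivative integrates to zero. The minus sign from
    differentiating x - y and the one from integration by parts cancel. *)
Lemma kconv_derive m f z j : Defs.periodic f -> continuous f ->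
  (forall z, derivable f z (e_x R j)) -> continuous ('D_(e_x R j) f) ->
  kconv m ('D_(e_x R j) f) z = kconv (multi_incr m j) f z.
Proof.
case: z => t x pf cf df cdf.
pose g (w : spacetime) := kern3 m (x - w.2) * f w.
have dg w : is_derive w (e_x R j) g
    (kern3 m (x - w.2) * 'D_(e_x R j) f w - kern3 (multi_incr m j) (x - w.2) * f w).
  apply: is_derive_eq (is_deriveM (is_derive_kern3 m x w j) (derivableP (df w))) _.
  by rewrite /GRing.scale/=; ring.
have Dg : 'D_(e_x R j) g = fun w => kern3 m (x - w.2) * 'D_(e_x R j) f w - kern3 (multi_incr m j) (x - w.2) * f w.
  by apply/funext => w; exact: derive_val.
have pg : Defs.periodic g.
  move=> w k; rewrite /g /= pf -(@kern3_periodic R q m (x - w.2) (- k)); congr (kern3 m _ * _).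
  by apply/rowP => i; rewrite !mxE intrN; ring.
have cK1 : continuous (fun w : spacetime => kern3 m (x - w.2) * 'D_(e_x R j) f w).
  by apply: continuousM_fun => //; exact: kern3_continuous.
have cK2 : continuous (fun w : spacetime => kern3 (multi_incr m j) (x - w.2) * f w).
  by apply: continuousM_fun => //; exact: kern3_continuous.
have cDg : continuous ('D_(e_x R j) g) by rewrite Dg; exact: continuousB_fun.
have := @Rintegral_cube_derive R g t j pg (fun w => @ex_derive _ _ _ _ _ _ _ (dg w)) cDg.
under eq_Rintegral => y _ do rewrite (@derive_val _ _ _ _ _ _ _ (dg _)) /=.
have i1 := continuous_integrable3 (@slice_continuous R _ t cK1).
have i2 := continuous_integrable3 (@slice_continuous R _ t cK2).
rewrite (RintegralB (measurable_cube R) i1 i2) /=.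
by rewrite !kconv_int// => /eqP; rewrite subr_eq0 => /eqP.
Qed.

Lemma Rintegral_cube_prod (g : 'I_3 -> R -> R) : (forall i, continuous (g i)) ->
  \int[@leb3 R]_(y in cube R) (\prod_i g i (row3 y 0 i)) = \prod_i \int[mu]_(s in I01) g i s.
Proof.
move=> cg; rewrite !big_ord_recl big_ord0 mulr1.
under eq_Rintegral do rewrite !big_ord_recl big_ord0 mulr1 !mxE /=.
set g0 := g _; set g1 := g _; set g2 := g _.
have cg0 : continuous g0 by exact: cg.
have cg1 : continuous g1 by exact: cg.
have cg2 : continuous g2 by exact: cg.
have c1 : continuous (fun y : R * R * R => y.1.1).
  by move=> y; apply: (@continuous_comp _ _ _ fst fst); exact: cvg_fst.
have c2 : continuous (fun y : R * R * R => y.1.2).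
  by move=> y; apply: (@continuous_comp _ _ _ fst snd); [exact: cvg_fst|exact: cvg_snd].
have c3 : continuous (fun y : R * R * R => y.2) by move=> y; exact: cvg_snd.
have cc (h : R -> R) (k : R * R * R -> R) : continuous h -> continuous k -> continuous (fun y => h (k y)).
  by move=> ch ck y; apply: (@continuous_comp _ _ _ k h); [exact: ck|exact: ch].
rewrite Rintegral_cube0; last by do ?[apply: continuousM_fun]; exact: cc.
under eq_Rintegral => c _.
  under eq_Rintegral => b _.
    rewrite /= RintegralZr//; last exact: continuous_integrable1.
  over.
  rewrite RintegralZl//; last first.
    apply: continuous_integrable1; apply: continuousM_fun => //; exact: continuous_cst_fun.
  rewrite RintegralZr//; last exact: continuous_integrable1.
  over.
rewrite /= RintegralZl//; last first.
  apply: continuous_integrable1; apply: continuousM_fun => //; exact: continuous_cst_fun.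
by rewrite RintegralZl//; exact: continuous_integrable1.
Qed.

(** Kernel and weight are both products over the coordinates, so the integral factors into three
    one-dimensional ones, each covered by [kern_weighted_int]. Allowing f to grow like the weight is
    what makes the oscillation estimates possible. *)
Lemma kconv_bound m f t (x : 'rV[R]_3) M : continuous f -> 0 <= M -> (forall i, m i <= 3)%N ->
  (forall y : 'rV[R]_3, `|f (t, y)| <= M * \prod_i kweight q (x 0 i - y 0 i)) ->
  `|kconv m f (t, x)| <= M * (kern_const R ^+ 3 * kscale R q ^+ (\sum_i m i)).
Proof.
move=> cf M0 m3 fM.
have cW i : continuous (fun s : R => `|derive1n (m i) (kern q) (x 0 i - s)| * kweight q (x 0 i - s)).
  apply: continuousM_fun; last by apply: trig_shift_continuous; exact: kweight_trig.
  by apply: continuous_norm_fun; exact: kern_shift_continuous.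
have cP : continuous (fun y : R * R * R => \prod_i
    (`|derive1n (m i) (kern q) (x 0 i - row3 y 0 i)| * kweight q (x 0 i - row3 y 0 i))).
  apply: continuous_prod_fun => i y.
  apply: (@continuous_comp _ _ _ (fun y : R * R * R => row3 y 0 i) (fun s : R => `|derive1n (m i) (kern q) (x 0 i - s)| * kweight q (x 0 i - s))); last exact: cW.
  apply: (@continuous_comp _ _ _ (@row3 R) (fun v : 'rV[R]_3 => v 0 i)).
    exact: row3_continuous.
  exact: coord_continuous.
have cKf : continuous (fun y : R * R * R => kern3 m (x - row3 y) * f (t, row3 y)).
  apply: (@slice_continuous R (fun w => kern3 m (x - w.2) * f w)).
  by apply: continuousM_fun => //; exact: kern3_continuous.
rewrite kconv_int//.
apply: (le_trans (le_normr_Rintegral (measurable_cube R) (continuous_integrable3 cKf))).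
apply: (@le_trans _ _ (\int[@leb3 R]_(y in cube R) (M * \prod_i
    (`|derive1n (m i) (kern q) (x 0 i - row3 y 0 i)| * kweight q (x 0 i - row3 y 0 i))))).
  apply: le_Rintegral; [exact: measurable_cube| | |].
  - by apply: continuous_integrable3; exact: continuous_norm_fun.
  - apply: continuous_integrable3; apply: continuousM_fun => //; exact: continuous_cst_fun.
  - move=> y _; rewrite normrM big_split /= mulrCA.
    have -> : `|kern3 m (x - row3 y)| = \prod_i `|derive1n (m i) (kern q) (x 0 i - row3 y 0 i)|.
      by rewrite /kern3 normr_prod; apply: eq_bigr => i _; rewrite !mxE.
    by apply: ler_wpM2l; [exact: prodr_ge0|exact: fM].
rewrite RintegralZl; [|exact: measurable_cube|exact: continuous_integrable3].
rewrite ler_wpM2l// (@Rintegral_cube_prod (fun i s => `|derive1n (m i) (kern q) (x 0 i - s)| * kweight q (x 0 i - s)))//.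
apply: (@le_trans _ _ (\prod_(i < 3) (kern_const R * kscale R q ^+ m i))).
  apply: ler_prod => i _; rewrite kern_weighted_int// andbT.
  apply: Rintegral_ge0 => s _; rewrite mulr_ge0//.
  by rewrite /kweight addr_ge0// mulr_ge0// sqr_ge0.
by rewrite big_split /= prodr_const card_ord -expr_sum.
Qed.

Lemma kconv_cst (c : R) z : kconv (fun=> 0%N) (fun=> c) z = c.
Proof.
case: z => t x; rewrite kconv_int; last exact: continuous_cst_fun.
have cK : continuous (fun y : R * R * R => kern3 (fun=> 0%N) (x - row3 y)).
  exact: (@slice_continuous R (fun w => kern3 (fun=> 0%N) (x - w.2)) 0 (@kern3_continuous (fun=> 0%N) x)).
rewrite RintegralZr; [|exact: measurable_cube|exact: continuous_integrable3].
rewrite -[RHS]mul1r; congr (_ * _).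
transitivity (\int[@leb3 R]_(y in cube R) (\prod_i kern q (x 0 i - row3 y 0 i))).
  by apply: eq_Rintegral => y _; apply: eq_bigr => i _; rewrite !mxE.
rewrite (@Rintegral_cube_prod (fun i s => kern q (x 0 i - s))); last first.
  by move=> i; exact: (@kern_shift_continuous R q 0).
by rewrite big1// => i _; exact: kern_int.
Qed.

End operator_bounds.

(** * Dependence of the coefficients on time *)

Section time.
Context (R : realType) (q : nat).
Local Notation spacetime := (spacetime R).
Implicit Types (f g : spacetime -> R).

Lemma slab_bounded (g : R * (R * R * R) -> R) (a b : R) : continuous g ->
  exists M : R, 0 < M /\ forall t y, a <= t <= b -> cube R y -> `|g (t, y)| <= M.
Proof.
move=> cg; have [|M [M0 HM]] := @continuous_compact_bounded R _ (`[a, b] `*` cube R) g _ cg.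
  by apply: compact_setX; [exact: segment_compact|exact: compact_cube].
by exists M; split => // t y tab yc; apply: HM; split.
Qed.

Lemma coef_integrand_continuous (r : {ffun 'I_3 -> 'I_q.*2.+4.+1}) f : continuous f ->
  continuous (fun p : R * (R * R * R) => Bfac r (row3 p.2) * f (of_coords p)).
Proof.
move=> cf; apply: continuousM_fun.
  move=> p; apply: (@continuous_comp _ _ _ snd (fun y => Bfac r (row3 y))); first exact: cvg_snd.
  exact: Bfac_continuous.
by move=> p; apply: (@continuous_comp _ _ _ (@of_coords R) f); [exact: of_coords_continuous|exact: cf].
Qed.

Lemma coef_continuous (r : {ffun 'I_3 -> 'I_q.*2.+4.+1}) f : continuous f -> continuous (kcoef r f).
Proof.
move=> cf t.
have cF := @coef_integrand_continuous r _ cf.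
(* Only times near t matter; over the compact slab around t the integrand is bounded, and a constant
   serves as the dominating function. *)
have [M [M0 HM]] := slab_bounded (t - 1) (t + 1) cF.
have tI : t \in (`]t - 1, t + 1[%classic : set R).
  by rewrite inE /= in_itv /= ltrBlDr ltrDl ltr01.
have h1 (s : R) : `]t - 1, t + 1[%classic s ->
    (@leb3 R).-integrable (cube R) (EFin \o (fun y => Bfac r (row3 y) * f (s, row3 y))).
  by move=> _; exact: coef_integrable.
have h2 : (\forall y \ae (@leb3 R), cube R y -> {in `]t - 1, t + 1[%classic,
    continuous (fun s => Bfac r (row3 y) * f (s, row3 y))}).
  by apply: aeW => y _ s _; exact: (continuous_pair1 (y := y) cF).
have h3 : (@leb3 R).-integrable (cube R) (EFin \o (fun=> M)).
  by apply: continuous_integrable3; exact: continuous_cst_fun.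
have h4 (s : R) : `]t - 1, t + 1[%classic s ->
    \forall y \ae (@leb3 R), cube R y -> `|Bfac r (row3 y) * f (s, row3 y)| <= M.
  rewrite /= in_itv/= => /andP[s1 s2]; apply: aeW => y yc.
  by apply: (HM s y) => //; rewrite !ltW.
exact: (continuity_under_integral (measurable_cube R) h1 h2 h3 h4 tI).
Qed.

Lemma coef_is_derive (r : {ffun 'I_3 -> 'I_q.*2.+4.+1}) f (t : R) : continuous f ->
  (forall z, derivable f z (e_t R)) -> continuous ('D_(e_t R) f) ->
  is_derive t 1 (kcoef r f) (kcoef r ('D_(e_t R) f) t).
Proof.
move=> cf df cdf.
have cF := @coef_integrand_continuous r _ cf.
have cdF := @coef_integrand_continuous r _ cdf.
have [M [M0 HM]] := slab_bounded (t - 1) (t + 1) cdF.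
have tI : (`]t - 1, t + 1[%classic : set R) t.
  by rewrite /= in_itv /= ltrBlDr ltrDl ltr01.
have dF (s : R) (y : R * R * R) : is_derive s 1 (fun s => Bfac r (row3 y) * f (s, row3 y))
    (Bfac r (row3 y) * 'D_(e_t R) f (s, row3 y)).
  apply: is_deriveZ.
  apply: (@is_derive_line _ _ _ f (fun s => (s, row3 y)) s (e_t R)) => // h.
  by congr pair; rewrite /= ?scaler0 ?add0r// /GRing.scale/= mulr1.
have d1 (s : R) (y : R * R * R) :
   partial1of2 (fun s y => Bfac r (row3 y) * f (s, row3 y)) s y = Bfac r (row3 y) * 'D_(e_t R) f (s, row3 y).
  by rewrite partial1of2E; exact: derive_val.
have h1 (s : R) : `]t - 1, t + 1[%classic s ->
    (@leb3 R).-integrable (cube R) (EFin \o (fun y => Bfac r (row3 y) * f (s, row3 y))).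
  by move=> _; exact: coef_integrable.
have h2 (s : R) (y : R * R * R) : `]t - 1, t + 1[%classic s -> cube R y ->
    derivable (fun s => Bfac r (row3 y) * f (s, row3 y)) s 1.
  by move=> _ _; have [] := dF s y.
have h3 : (@leb3 R).-integrable (cube R) (EFin \o (fun=> M)).
  by apply: continuous_integrable3; exact: continuous_cst_fun.
have h4 (s : R) (y : R * R * R) : `]t - 1, t + 1[%classic s -> cube R y ->
    `|partial1of2 (fun s y => Bfac r (row3 y) * f (s, row3 y)) s y| <= M.
  rewrite /= in_itv/= => /andP[s1 s2] yc; rewrite d1.
  by apply: (HM s y) => //; rewrite !ltW.
apply: DeriveDef.
  exact: (derivable_under_integral (measurable_cube R) tI h1 h2 (fun=> ltW M0) h3 h4).
rewrite -derive1E.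
rewrite (differentiation_under_integral (measurable_cube R) tI h1 h2 (fun=> ltW M0) h3 h4).
by apply: eq_Rintegral => y _; exact: d1.
Qed.
End time.

(** * Symmetry of the convolution in the weak formulation *)

Section integrability.
Context d (T : measurableType d) (R : realType) (nu : {measure set T -> \bar R}).
Variables (D : set T).
Hypothesis mD : measurable D.

(** If the extended integral is finite then so are those of the positive and negative parts, and f
    is integrable. Otherwise it is infinite and [fine] returns 0. *)
Lemma Rintegral_nonintegrable (f : T -> R) : measurable_fun D f ->
  ~ nu.-integrable D (EFin \o f) -> \int[nu]_(x in D) f x = 0.
Proof.
move=> mf nf; rewrite /Rintegral.
have mf' : measurable_fun D (EFin \o f) by exact/measurable_EFinP.
case: (boolP ((\int[nu]_(x in D) (f x)%:E)%E \is a fin_num)) => [fn|]; last first.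
  by case: (integral _ _ _).
exfalso; apply: nf; move: fn; rewrite integralE fin_numB => /andP[fp fm].
apply/integrableP; split => //.
under eq_integral => x _ do rewrite -/((abse \o (EFin \o f)) x) fune_abse.
rewrite ge0_integralD//; [|exact: measurable_funepos|exact: measurable_funeneg].
by apply: lte_add_pinfty; rewrite ltey_eq ?fp ?fm.
Qed.

(* No integrability is needed: if f is not integrable both sides are 0. *)
Lemma RintegralZl_measurable (f : T -> R) (c : R) : measurable_fun D f ->
  \int[nu]_(x in D) (c * f x) = c * \int[nu]_(x in D) f x.
Proof.
move=> mf; have [->|c0] := eqVneq c 0.
  by rewrite mul0r; under eq_Rintegral do rewrite mul0r; rewrite Rintegral_cst ?mul0r.
have [fi|nf] := pselect (nu.-integrable D (EFin \o f)); first exact: RintegralZl.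
rewrite (Rintegral_nonintegrable mf nf) mulr0 Rintegral_nonintegrable//.
  by apply: measurable_funM => //; exact: measurable_cst.
move=> /(integrableZl mD c^-1) H; apply: nf; apply: eq_integrable H => // x _.
by rewrite /= -EFinM mulKf.
Qed.

End integrability.

Lemma integrable_fst (R : realType) d1 d2 (T1 : measurableType d1) (T2 : measurableType d2)
   (m1 : {sigma_finite_measure set T1 -> \bar R}) (m2 : {sigma_finite_measure set T2 -> \bar R})
   (D1 : set T1) (D2 : set T2) (g : T1 -> R) :
  measurable D1 -> measurable D2 -> (m2 D2 < +oo)%E -> m1.-integrable D1 (EFin \o g) ->
  (m1 \x m2)%E.-integrable (D1 `*` D2) (fun z => (g z.1)%:E).
Proof.
move=> mD1 mD2 D2oo ig; have /integrableP[mg goo] := ig.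
apply/(integrable_mkcond _ (measurableX mD1 mD2)).
have mG : measurable_fun setT ((fun z : T1 * T2 => (g z.1)%:E) \_ (D1 `*` D2)).
  apply/(measurable_restrictT _ (measurableX mD1 mD2)).
  apply: (measurable_comp mD1 _ mg); last exact: measurable_funTS.
  by move=> _ [z [z1 _] <-].
apply/(integrable12ltyP _ _ mG).
have E x : (\int[m2]_y `|((fun z : T1 * T2 => (g z.1)%:E) \_ (D1 `*` D2)) (x, y)| =
   m2 D2 * (((fun x => `|(g x)%:E|) \_ D1) x))%E.
  have -> : (fun y => `|((fun z : T1 * T2 => (g z.1)%:E) \_ (D1 `*` D2)) (x, y)|%E) =
     ((cst (((fun x => `|(g x)%:E|) \_ D1) x)%E) \_ D2).
    apply/funext => y; rewrite !patchE in_setX /=.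
    by case: (x \in D1); case: (y \in D2); rewrite ?abse0.
  rewrite -integral_mkcond integral_cst// muleC//.
under eq_integral do rewrite E.
rewrite ge0_integralZl//; last 2 first.
- by apply/(measurable_restrictT _ mD1); exact: measurableT_comp.
- by move=> x _; rewrite patchE; case: ifP.
rewrite -integral_mkcond lte_mul_pinfty// ge0_fin_numE//.
Qed.

(** * Local integrability and pairing with compactly supported functions *)

Section loc_integrable.
Context (R : realType).
Local Notation spacetime := (spacetime R).
Local Notation mu := (@lebesgue_measure R).
Implicit Types (f g psi : spacetime -> R).

Lemma measurable_slab (M : R) : measurable
  (`[- M, M]%classic `*` cube R : set (measurableTypeR R * (measurableTypeR R * measurableTypeR R * measurableTypeR R))).
Proof. by apply: measurableX => //; exact: measurable_cube. Qed.

Lemma measurable_strip : measurable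
  (setT `*` cube R : set (measurableTypeR R * (measurableTypeR R * measurableTypeR R * measurableTypeR R))).
Proof. by apply: measurableX => //; exact: measurable_cube. Qed.

Definition pairable f := (leb4 R).-integrable (setT `*` cube R) (EFin \o (f \o @of_coords R)).

Lemma loc_integrable_pairable f (M : R) : loc_integrable f ->
  (forall z, M < `|z.1| -> f z = 0) -> pairable f.
Proof.
move=> lf f0; have := lf M; rewrite /pairable => /(integrable_mkcond _ (measurable_slab M)) H.
apply/(integrable_mkcond _ measurable_strip); apply: eq_integrable H => // -[t y] _.
have E (A : set R) : ((t, y) \in A `*` cube R) = (t \in A) && (y \in cube R).
  by rewrite in_setX.
rewrite !patchE !E in_setT /=; case: (y \in cube R); rewrite ?andbF// andbT.
case: ifPn => // /negP; rewrite inE /= in_itv /= => tM.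
rewrite f0//= ltNge; apply/negP; rewrite ler_norml => tM'; exact: tM.
Qed.

Lemma loc_integrableM f psi : loc_integrable f -> continuous psi ->
  loc_integrable (fun z => f z * psi z).
Proof.
move=> lf cpsi M.
have cp : continuous (psi \o @of_coords R).
  by move=> p; apply: continuous_comp; [exact: of_coords_continuous|exact: cpsi].
have := integrableMl (measurable_slab M) (lf M).
move=> /(_ (psi \o @of_coords R)) H.
apply: eq_integrable (H _ _) => //.
- exact: measurable_slab.
- by apply: measurable_funTS; exact: continuous_measurable4.
- have [|N [N0 HN]] := @continuous_compact_bounded R _ (`[- M, M] `*` cube R) _ _ cp.
    by apply: compact_setX; [exact: segment_compact|exact: compact_cube].
  exists N; split; first exact: num_real.
  by move=> x Nx y /= yA; rewrite (le_trans (HN _ yA))// ltW.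
Qed.

Lemma loc_integrable_sum (I : Type) (s : seq I) (F : I -> spacetime -> R) :
  (forall i, loc_integrable (F i)) -> loc_integrable (fun z => \sum_(i <- s) F i z).
Proof.
move=> lF M.
have := @integrable_sum _ _ _ (leb4 R) _ (measurable_slab M) _ s xpredT
  (fun i => EFin \o (F i \o @of_coords R)) (fun i _ => lF i M).
apply: eq_integrable; first exact: measurable_slab.
by move=> z _; rewrite /= sumEFin.
Qed.

End loc_integrable.
Arguments measurable_strip : clear implicits.

(** * Transposition of the convolution *)

Section duality.
Context (R : realType) (q : nat).
Local Notation spacetime := (spacetime R).
Local Notation mu := (@lebesgue_measure R).
Local Notation idx := {ffun 'I_3 -> 'I_q.*2.+4.+1}.
Local Notation kconv := (@kconv R q).
Implicit Types (f psi : spacetime -> R) (r : idx) (g : R -> R).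

Lemma Bfac_space_continuous r : continuous (fun z : spacetime => Bfac r z.2).
Proof. exact: (@tpoly_continuous _ (fun=> False) _ (fun _ H => False_rect _ H) (tpoly_Bfac _ r)). Qed.

Lemma Afac_space_continuous m r : continuous (fun z : spacetime => Afac m r z.2).
Proof. exact: (@tpoly_continuous _ (fun=> False) _ (fun _ H => False_rect _ H) (tpoly_Afac _ m r)). Qed.

Lemma coef_loc_integrable1 r f (M : R) : loc_integrable f ->
  mu.-integrable `[- M, M] (EFin \o kcoef r f).
Proof.
move=> lf; have H := loc_integrableM lf (@Bfac_space_continuous r) M.
have mM : measurable (`[- M, M]%classic : set (measurableTypeR R)) by [].
have := Rintegral_slice_integrable1 (m1 := mu) (m2 := @leb3 R) mM (measurable_cube R) H.
apply: eq_integrable => // t _ /=; congr EFin.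
by apply: eq_Rintegral => y _; rewrite /= mulrC.
Qed.

Lemma coef_loc_integrable r f : loc_integrable f -> loc_integrable (fun z => kcoef r f z.1).
Proof.
move=> lf M.
have mM : measurable (`[- M, M]%classic : set (measurableTypeR R)) by [].
exact: (integrable_fst (m1 := mu) (m2 := @leb3 R) mM (measurable_cube R) (leb3_cube R)
  (coef_loc_integrable1 r M lf)).
Qed.

Lemma kconv_loc_integrable m f : loc_integrable f -> loc_integrable (kconv m f).
Proof.
move=> lf; apply: loc_integrable_sum => r.
under eq_fun do rewrite mulrC.
by apply: loc_integrableM; [exact: coef_loc_integrable|exact: Afac_space_continuous].
Qed.

(** Sections of a product-measurable function are measurable at every time, not just almost every
    one; the slab of half-width |t| contains the time t. *)
Lemma loc_integrable_slice_measurable f t : loc_integrable f ->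
  measurable_fun (cube R : set (measurableTypeR R * measurableTypeR R * measurableTypeR R)) (fun y => f (t, row3 y)).
Proof.
move=> lf; have /integrableP[/measurable_EFinP mf _] := lf `|t|.
apply: (measurable_comp (measurable_slab `|t|) _ mf (g := pair t)).
- by move=> _ [y yc <-]; split => //=; rewrite in_itv/= lerNl -lerNl -ler_norml.
- by apply: measurable_funTS; exact: pair1_measurable.
Qed.

(** Fubini, then g t is pulled out of the inner integral. At times where the slice of f is not
    integrable this is still legitimate by [RintegralZl_measurable], so the identity of the inner
    integrals holds for every t. *)
Lemma Rintegral_coef r (g : R -> R) f : loc_integrable f ->
  pairable (fun z => g z.1 * (Bfac r z.2 * f z)) ->
  integral_RT3 (fun z => g z.1 * (Bfac r z.2 * f z)) = \int[mu]_(t in setT) (g t * kcoef r f t).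
Proof.
move=> lf ph.
have mT : measurable (setT : set (measurableTypeR R)) by [].
have := Rintegral_fubini1 (m1 := mu) (m2 := @leb3 R) mT (measurable_cube R) ph.
rewrite /integral_RT3 => ->; apply: eq_Rintegral => t _ /=.
rewrite /kcoef -RintegralZl_measurable//; first exact: measurable_cube.
apply: measurable_funM; last exact: loc_integrable_slice_measurable.
by have /integrableP[/measurable_EFinP] := continuous_integrable3 (@Bfac_continuous R q r).
Qed.

Definition tsupp (M : R) psi := forall z : spacetime, M < `|z.1| -> psi z = 0.

Lemma coef_tsupp M r psi t : tsupp M psi -> M < `|t| -> kcoef r psi t = 0.
Proof.
move=> sp tM; rewrite /kcoef; under eq_Rintegral do rewrite sp// mulr0.
by rewrite Rintegral_cst ?mul0r//; exact: measurable_cube.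
Qed.

Lemma pairableM M f psi : loc_integrable f -> continuous psi -> tsupp M psi ->
  pairable (fun z => f z * psi z).
Proof.
move=> lf cpsi sp; apply: (@loc_integrable_pairable _ _ M).
  exact: loc_integrableM.
by move=> z zM; rewrite sp// mulr0.
Qed.

Definition pairing f psi := integral_RT3 (fun z => f z * psi z).

Lemma pairing_sum (I : Type) (s : seq I) (F : I -> spacetime -> R) :
  (forall i, pairable (F i)) ->
  integral_RT3 (fun z => \sum_(i <- s) F i z) = \sum_(i <- s) integral_RT3 (F i).
Proof.
move=> pF; rewrite /integral_RT3.
exact: (@Rintegral_sum R _ _ (leb4 R) _ I s (fun i => F i \o @of_coords R) (measurable_strip R) pF).
Qed.

(** This is the symmetry of K: in the absence of derivatives the expansion of K(x - y) is diagonal,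
    a combination of the products B_r(x) B_r(y). *)
Lemma kfac0 r (x : 'rV[R]_3) :
  Afac (fun=> 0%N) r x = (\prod_i ('C(q.*2.+4, r i)%:R / wallis R q.+2)) * Bfac r x.
Proof.
rewrite /Afac /Bfac -big_split; apply: eq_bigr => i _ /=.
by rewrite /kalpha /kbeta mulrC.
Qed.

(** By [kfac0] both sides become the same combination of time integrals of the product of
    [kcoef r f] and [kcoef r psi]. Only psi has to be continuous, so the lemma applies to the
    pressure. *)
Lemma pairing_kconv M f psi : loc_integrable f -> continuous psi -> tsupp M psi ->
  pairing (kconv (fun=> 0%N) f) psi = pairing f (kconv (fun=> 0%N) psi).
Proof.
move=> lf cpsi sp.
have lpsi := continuous_loc_integrable cpsi.
pose c r : R := \prod_i ('C(q.*2.+4, r i)%:R / wallis R q.+2).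
have ccoef r : continuous (fun z : spacetime => kcoef r psi z.1).
  move=> z; apply: (@continuous_comp _ _ _ fst (kcoef r psi)); first exact: cvg_fst.
  exact: coef_continuous.
have scoef r : tsupp M (fun z : spacetime => kcoef r psi z.1).
  by move=> z; exact: coef_tsupp.
have p1 r : pairable (fun z => kcoef r f z.1 * (Bfac r z.2 * psi z)).
  apply: (@pairableM M (fun z => kcoef r f z.1)); first exact: coef_loc_integrable.
    by apply: continuousM_fun => //; exact: Bfac_space_continuous.
  by move=> z zM; rewrite sp// mulr0.
have p2 r : pairable (fun z => kcoef r psi z.1 * (Bfac r z.2 * f z)).
  have := @pairableM M f (fun z => kcoef r psi z.1 * Bfac r z.2) lf.
  have -> : (fun z => f z * (kcoef r psi z.1 * Bfac r z.2)) =
            (fun z => kcoef r psi z.1 * (Bfac r z.2 * f z)) by apply/funext => z; ring.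
  apply; first by apply: continuousM_fun => //; exact: Bfac_space_continuous.
  by move=> z zM; rewrite scoef// mul0r.
have pc (h : spacetime -> R) (a : R) : pairable h -> pairable (fun z => a * h z).
  move=> ph; have := integrableZl (measurable_strip R) a ph.
  by apply: eq_integrable => //; exact: measurable_strip.
have Zc (h : spacetime -> R) (a : R) : pairable h ->
    integral_RT3 (fun z => a * h z) = a * integral_RT3 h.
  by move=> ph; rewrite /integral_RT3 [LHS](RintegralZl a (measurable_strip R) ph).
rewrite /pairing.
have -> : (fun z => kconv (fun=> 0%N) f z * psi z) =
   (fun z => \sum_r c r * (kcoef r f z.1 * (Bfac r z.2 * psi z))).
  apply/funext => z; rewrite /kconv mulr_suml; apply: eq_bigr => r _.
  by rewrite kfac0 -/(c r); ring.
have -> : (fun z => f z * kconv (fun=> 0%N) psi z) =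
   (fun z => \sum_r c r * (kcoef r psi z.1 * (Bfac r z.2 * f z))).
  apply/funext => z; rewrite /kconv mulr_sumr; apply: eq_bigr => r _.
  by rewrite kfac0 -/(c r); ring.
rewrite !pairing_sum; try by move=> r; exact: pc.
apply: eq_bigr => r _; rewrite !Zc//; congr (_ * _).
rewrite (Rintegral_coef lpsi (p1 r)) (Rintegral_coef lf (p2 r)).
by apply: eq_Rintegral => t _; exact: mulrC.
Qed.

End duality.

(** * Mollified test functions *)

Section test_functions.
Context (R : realType) (q : nat).
Local Notation spacetime := (spacetime R).
Local Notation idx := {ffun 'I_3 -> 'I_q.*2.+4.+1}.
Local Notation kconv := (@kconv R q).
Implicit Types (f phi : spacetime -> R) (r : idx).

Definition smooth_time (g : R -> R) := forall n (t : R), derivable (derive1n n g) t 1.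

Lemma smooth_time_continuous g : smooth_time g -> continuous g.
Proof. by move=> sg t; apply/differentiable_continuous/derivable1_diffP; exact: (sg 0%N). Qed.

Lemma smooth_time_derive1 g : smooth_time g ->
  (forall t : R, derivable g t 1) /\ smooth_time (derive1 g).
Proof.
move=> sg; split=> [t|n t]; first exact: (sg 0%N).
by rewrite -derive1Sn; exact: sg.
Qed.

Lemma derive_periodic (W : normedModType R) (F : spacetime -> W) h :
  Defs.periodic F -> Defs.periodic ('D_h F).
Proof.
move=> pF z k; rewrite /derive.
have -> // : (fun a : R => a^-1 *: (F (a *: h + (z.1, z.2 + map_mx intr k)) -
    F (z.1, z.2 + map_mx intr k))) = (fun a : R => a^-1 *: (F (a *: h + z) - F z)).
apply/funext => a; rewrite pF -(pF (a *: h + z) k).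
by congr (_ *: (F _ - _)); congr pair; rewrite /= addrA.
Qed.

Lemma iter_derive_periodic (W : normedModType R) (F : spacetime -> W) s :
  Defs.periodic F -> Defs.periodic (iter_derive s F).
Proof. by move=> pF; elim: s => //= h s IH; exact: derive_periodic. Qed.

Lemma derive_tsupp M f (h : spacetime) : tsupp M f -> tsupp M ('D_h f).
Proof.
move=> sf z zM; rewrite -[RHS](derive_cst (0 : R) z h); apply: near_eq_derive.
have : \forall w \near z, M < `|w.1|.
  have c1 : continuous (fun w : spacetime => `|w.1|) by apply: continuous_norm_fun => w; exact: cvg_fst.
  exact: (cvgr_gt _ (c1 z) _ zM).
by apply: filterS => w wM; rewrite sf.
Qed.

Lemma iter_derive_tsupp M f s : tsupp M f -> tsupp M (iter_derive s f).
Proof. by move=> sf; elim: s => //= h s IH; exact: derive_tsupp. Qed.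

Lemma test_function_iter phi s : test_function phi -> test_function (iter_derive s phi).
Proof.
move=> [pphi sphi [M HM]]; split; first exact: iter_derive_periodic.
  by move=> s'; have H := sphi (s' ++ s); rewrite /iter_derive foldr_cat in H; exact: H.
by exists M; exact: iter_derive_tsupp.
Qed.

Lemma coef_smooth_time r phi : test_function phi -> smooth_time (kcoef r phi).
Proof.
move=> tphi n t; suff H : derive1n n (kcoef r phi) = kcoef r (iter_derive (nseq n (e_t R)) phi).
  have [_ sphi _] := tphi; have [c0 d0] := sphi (nseq n (e_t R)).
  have [c1 _] := sphi (nseq n.+1 (e_t R)).
  by rewrite H; have [] := coef_is_derive r t c0 (fun z => d0 z _) c1.
elim: n => [|n IH] //; rewrite derive1nS IH; apply/funext => s; rewrite derive1E.
have [_ sphi _] := tphi; have [c0 d0] := sphi (nseq n (e_t R)).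
have [c1 _] := sphi (nseq n.+1 (e_t R)).
exact: (@derive_val _ _ _ _ _ _ _ (coef_is_derive r s c0 (fun z => d0 z _) c1)).
Qed.

(** Makes the mollified test function admissible in the weak equations of the original flow. *)
Lemma test_function_kconv m phi : test_function phi -> test_function (kconv m phi).
Proof.
move=> tphi; have SK : tpoly smooth_time (kconv m phi).
  by apply: tpoly_kconv => r; exact: coef_smooth_time.
split; first exact: kconv_periodic.
- move=> s; have Ss : tpoly smooth_time (iter_derive s (kconv m phi)).
    by apply: tpoly_iter_derive => //; right; exact: smooth_time_derive1.
  split; first by apply: tpoly_continuous Ss; exact: smooth_time_continuous.
  by move=> z h; apply: tpoly_derivable Ss; right; exact: smooth_time_derive1.
- have [_ _ [M HM]] := tphi; exists M => z zM.
  by rewrite /kconv big1// => r _; rewrite (@coef_tsupp _ _ M)// mulr0.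
Qed.

Lemma derive_kconv_t m f z : continuous f -> (forall z, derivable f z (e_t R)) ->
  continuous ('D_(e_t R) f) -> 'D_(e_t R) (kconv m f) z = kconv m ('D_(e_t R) f) z.
Proof.
move=> cf df cdf; apply: derive_val; rewrite /kconv; elim: (index_enum _) => [|r s IH].
  under eq_fun do rewrite big_nil; rewrite big_nil; exact: is_derive_cst.
under eq_fun do rewrite big_cons; rewrite big_cons.
apply: is_deriveD.
have h1 : is_derive z (e_t R) (fun z : spacetime => kcoef r f z.1) (kcoef r ('D_(e_t R) f) z.1).
  apply: (@is_derive_linear_comp _ _ (fun z : spacetime => z.1)) => //.
  exact: coef_is_derive.
have h2 : is_derive z (e_t R) (fun z : spacetime => Afac m r z.2) 0.
  have E : (fun a : R => a^-1 *: (Afac m r (a *: e_t R + z).2 - Afac m r z.2)) = cst 0.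
    by apply/funext => a; rewrite /= scaler0 add0r subrr scaler0.
  by split; rewrite /derivable /derive E; [exact: is_cvg_cst|exact: lim_cst].
apply: is_derive_eq (is_deriveM h2 h1) _.
by rewrite scaler0 addr0 /GRing.scale.
Qed.

Lemma derive_kconv_x f z j : Defs.periodic f -> continuous f ->
  (forall z, derivable f z (e_x R j)) -> continuous ('D_(e_x R j) f) ->
  forall m, 'D_(e_x R j) (kconv m f) z = kconv m ('D_(e_x R j) f) z.
Proof.
move=> pf cf df cdf m; rewrite kconv_derive//; apply: derive_val.
exact: is_derive_kconv.
Qed.

End test_functions.

(** * Commutator estimates *)

Section osc.
Context (R : realType).
Local Notation spacetime := (spacetime R).
Implicit Types (f g : spacetime -> R).

(** Up to 1/4 the mean value theorem applies, with slope at least pi cos(pi/4) >= 1; between 1/4 and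
    1/2 the sine is at least sin(pi/4) >= 1/2. *)
Lemma normr_le_sinpi (u : R) : `|u| <= 1 / 2 -> `|u| <= `|sin (pi * u)|.
Proof.
wlog u0 : u / 0 <= u => [H|].
  have [/H//|u0 hu] := leP 0 u.
  by have := H (- u); rewrite oppr_ge0 normrN mulrN sinN normrN; apply => //; exact: ltW.
rewrite (ger0_norm u0) => u2.
have p0 : 0 < pi :> R := pi_gt0 R.
have p2 : 2 <= pi :> R := pi_ge2 R.
have q0 : 0 < pi / 4 :> R by rewrite divr_gt0.
(* From cos(pi/2) = 0 by the doubling formula. *)
have c4 : cos (pi / 4) ^+ 2 = 1 / 2 :> R.
  have := cos2Dsin2 (pi / 4 : R); have := cos_pihalf R.
  have -> : pi / 2 = pi / 4 + pi / 4 :> R by field.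
  rewrite cosD -!expr2; lra.
have s4 : sin (pi / 4) ^+ 2 = 1 / 2 :> R by have := cos2Dsin2 (pi / 4 : R); lra.
have c40 : 0 < cos (pi / 4 : R).
  by rewrite cos_gt0_pihalf//; apply/andP; split; lra.
have s40 : 0 < sin (pi / 4 : R).
  by rewrite sin_gt0_pi//; apply/andP; split => //; lra.
have c41 : 1 / 2 <= cos (pi / 4 : R) by nra.
have s41 : 1 / 2 <= sin (pi / 4 : R) by nra.
apply: le_trans (ler_norm _).
have [u4|u4] := leP u (1 / 4).
  have H (s : R) : is_derive s 1 (fun s => sin (pi * s)) (pi * cos (pi * s)) := is_derive_sinpi s.
  have cS (i : interval R) : {within [set` i], continuous (fun s => sin (pi * s))}.
    by apply: derivable_within_continuous => s _; have [] := H s.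
  have [c] := MVT_segment u0 (fun s _ => H s) (cS _).
  rewrite in_itv/= => /andP[c0 cu]; rewrite mulr0 sin0 !subr0 => ->.
  have cc : cos (pi / 4) <= cos (pi * c).
    rewrite leNgt; apply/negP; rewrite ltr_cos ?in_itv/=.
    - by rewrite ltNge => /negP; apply; rewrite ler_pM2l//; lra.
    - by apply/andP; split; lra.
    - apply/andP; split; first by rewrite mulr_ge0// ltW.
      by rewrite ler_piMr ?ltW//; lra.
  by rewrite -[leLHS]mul1r ler_wpM2r//; nra.
rewrite (le_trans u2)// (le_trans s41)// leNgt; apply/negP.
rewrite ltr_sin ?in_itv/=.
- by rewrite ltNge => /negP; apply; rewrite ler_pM2l//; lra.
- by apply/andP; split; nra.
- by apply/andP; split; lra.
Qed.


Lemma derive_lipschitz (phi dphi : R -> R) (A d : R) :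
  (forall s : R, is_derive s 1 phi (dphi s)) -> (forall s, `|dphi s| <= A) ->
  `|phi d - phi 0| <= A * `|d|.
Proof.
move=> dp bA.
have cp (i : interval R) : {within [set` i], continuous phi}.
  by apply: derivable_within_continuous => s _; have [] := dp s.
have [d0|d0] := leP 0 d.
  have [c _ ->] := MVT_segment d0 (fun s _ => dp s) (cp _).
  by rewrite subr0 normrM ler_wpM2r.
have [c _ E] := MVT_segment (ltW d0) (fun s _ => dp s) (cp _).
by rewrite distrC E sub0r normrM normrN ler_wpM2r.
Qed.

(* Lipschitz bound in space for the distance sum_i |sin(pi(x_i - y_i))| on T^3. *)
Definition osc (A : R) f := forall t (x y : 'rV[R]_3),
  `|f (t, y) - f (t, x)| <= A * \sum_i `|sin (pi * (x 0 i - y 0 i))|.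

Lemma osc_coord f (A t d : R) (x : 'rV[R]_3) i :
  (forall z, derivable f z (e_x R i)) -> (forall z, `|'D_(e_x R i) f z| <= A) ->
  `|f (t, x + d *: delta_mx 0 i) - f (t, x)| <= A * `|d|.
Proof.
move=> df bA.
have H (s : R) : is_derive s 1 (fun s => f (t, x + s *: delta_mx 0 i))
    ('D_(e_x R i) f (t, x + s *: delta_mx 0 i)).
  apply: (@is_derive_line _ _ _ f (fun s => (t, x + s *: delta_mx 0 i)) s (e_x R i)) => // h.
  by congr pair; rewrite /= ?scaler0 ?add0r// scalerDl addrCA.
have := derive_lipschitz d H (fun s => bA _).
by rewrite scale0r addr0.
Qed.

(** By periodicity y is replaced by its integer translate nearest to x, so that each coordinate
    moves by at most 1/2 and [normr_le_sinpi] applies. The path from x to y runs along the axes,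
    since only derivatives in coordinate directions are available. *)
Lemma osc_derive f (A : R) : Defs.periodic f ->
  (forall i z, derivable f z (e_x R i)) -> (forall i z, `|'D_(e_x R i) f z| <= A) ->
  osc A f.
Proof.
move=> pf df bA t x y.
have A0 : 0 <= A by apply: le_trans (bA 0 0).
(* Rounding x_i - y_i to a nearest integer gives a displacement [d i] in [-1/2, 1/2]. *)
pose k : 'rV[int]_3 := \row_i Num.floor (x 0 i - y 0 i + 1 / 2).
pose d i : R := y 0 i + (k 0 i)%:~R - x 0 i.
have dk i : `|d i| <= 1 / 2.
  rewrite /d /k mxE ler_norml.
  have /andP[l u] := real_floor_itv (num_real (x 0 i - y 0 i + 1 / 2)).
  by move: l u; rewrite intrD; lra.
have dsin i : `|d i| <= `|sin (pi * (x 0 i - y 0 i))|.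
  rewrite (le_trans (normr_le_sinpi (dk i)))//.
  have -> : pi * d i = - (pi * (x 0 i - y 0 i + - (k 0 i)%:~R)) by rewrite /d; ring.
  rewrite sinN normrN -intrN.
  have p (v : R) : `|sin (pi * (v + 1))| = `|sin (pi * v)|.
    by rewrite mulrDr mulr1 sinD cospi sinpi mulr0 addr0 mulrN1 normrN.
  by rewrite (@periodic_int R (fun v => `|sin (pi * v)|) p).
rewrite -(pf (t, y) k) /=.
have yE : y + map_mx intr k = x + d ord0 *: delta_mx 0 ord0 + d (lift ord0 ord0) *: delta_mx 0 (lift ord0 ord0)
    + d (lift ord0 (lift ord0 ord0)) *: delta_mx 0 (lift ord0 (lift ord0 ord0)).
  apply/rowP => i; rewrite !mxE /d; move: i => -[[|[|[|//]]] Hi];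
    rewrite /= ?mulr1 ?mulr0 ?addr0 ?mxE.
  - have -> : Ordinal Hi = ord0 by exact/val_inj.
    by ring.
  - have -> : Ordinal Hi = lift ord0 ord0 by exact/val_inj.
    by ring.
  - have -> : Ordinal Hi = lift ord0 (lift ord0 ord0) by exact/val_inj.
    by ring.
rewrite yE !big_ord_recl big_ord0 addr0.
set x1 := x + d ord0 *: _; set x2 := x1 + _.
have h1 := @osc_coord f A t (d ord0) x ord0 (df _) (bA _).
have h2 := @osc_coord f A t (d (lift ord0 ord0)) x1 (lift ord0 ord0) (df _) (bA _).
have h3 := @osc_coord f A t (d (lift ord0 (lift ord0 ord0))) x2 (lift ord0 (lift ord0 ord0)) (df _) (bA _).
have -> : f (t, x2 + d (lift ord0 (lift ord0 ord0)) *: delta_mx 0 (lift ord0 (lift ord0 ord0))) - f (t, x) =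
  (f (t, x1) - f (t, x)) + ((f (t, x2) - f (t, x1)) +
  (f (t, x2 + d (lift ord0 (lift ord0 ord0)) *: delta_mx 0 (lift ord0 (lift ord0 ord0))) - f (t, x2))) by ring.
rewrite !(mulrDr A) (le_trans (ler_normD _ _))// lerD//.
  by apply: (le_trans h1); rewrite ler_wpM2l.
rewrite (le_trans (ler_normD _ _))// lerD//.
  by apply: (le_trans h2); rewrite ler_wpM2l.
by apply: (le_trans h3); rewrite ler_wpM2l.
Qed.

End osc.

(** * Weighted oscillation and the bound with all derivatives on the kernel *)

Section commutator.
Context (R : realType) (q : nat).
Local Notation spacetime := (spacetime R).
Local Notation kconv := (@kconv R q).
Local Notation nu := (kscale R q).
Local Notation mol := (kconv (fun=> 0%N)).
Implicit Types (f g : spacetime -> R) (m : 'I_3 -> nat) (s : seq 'I_3).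

Definition multi s : 'I_3 -> nat := fun i => count_mem i s.

Lemma incr_multi s j : multi_incr (multi s) j = multi (j :: s).
Proof. by apply/funext => i; rewrite /multi_incr /multi /= addnC eq_sym. Qed.

Lemma sum_multi s : (\sum_i multi s i)%N = size s.
Proof.
elim: s => [|j s IH]; first by rewrite big1.
rewrite -incr_multi /multi_incr big_split /= IH (bigD1 j)//= eqxx big1 ?addn1// => i /negbTE ->//.
Qed.

Lemma multi_le s i : (multi s i <= size s)%N.
Proof. exact: count_size. Qed.

Lemma nabla_seq_kconv s f : nabla_seq s (mol f) = kconv (multi s) f.
Proof.
elim: s => [|j s IH] //; rewrite /nabla_seq /= -/(nabla_seq s (mol f)) IH.
by apply/funext => z; rewrite -incr_multi; apply: derive_val; exact: is_derive_kconv.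
Qed.

Lemma nu_gt0 : 0 < nu. Proof. exact: lt_le_trans ltr01 (kscale_ge1 R q). Qed.

Definition weight (u : 'rV[R]_3) := \prod_i kweight q (u 0 i).

(** In the distances a, b, c measured in kernel widths 1/nu, the comparisons of oscillation and
    weight become polynomial inequalities without parameters. *)
Lemma weightE (u : 'rV[R]_3) : exists a b c : R,
  [/\ 0 <= a, 0 <= b, 0 <= c,
   \sum_i `|sin (pi * u 0 i)| = (a + b + c) / nu &
   weight u = (1 + a ^+ 2) * (1 + b ^+ 2) * (1 + c ^+ 2)].
Proof.
exists (nu * `|sin (pi * u 0 ord0)|), (nu * `|sin (pi * u 0 (lift ord0 ord0))|),
  (nu * `|sin (pi * u 0 (lift ord0 (lift ord0 ord0)))|).
have n0 := ltW nu_gt0; split; try by rewrite mulr_ge0.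
  rewrite !big_ord_recl big_ord0 addr0; field; rewrite gt_eqF ?nu_gt0//.
rewrite /weight !big_ord_recl big_ord0 mulr1 /kweight !exprMn !real_normK ?num_real//.
by rewrite sqr_kscale mulrA.
Qed.

Lemma weight_ge1 (u : 'rV[R]_3) : 1 <= weight u.
Proof.
have [a [b [c [a0 b0 c0 _ ->]]]] := weightE u.
have := sqr_ge0 a; have := sqr_ge0 b; have := sqr_ge0 c.
move: (a ^+ 2) (b ^+ 2) (c ^+ 2) => A B C C0 B0 A0.
have h : 1 <= (1 + A) * (1 + B) by nra.
by nra.
Qed.

Lemma sum_sin_weight (u : 'rV[R]_3) : \sum_i `|sin (pi * u 0 i)| <= 3 / nu * weight u.
Proof.
have [a [b [c [a0 b0 c0 -> ->]]]] := weightE u.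
rewrite mulrAC ler_pM2r ?invr_gt0 ?nu_gt0//.
have hA : a <= 1 + a ^+ 2 by have := sqr_ge0 (a - 1); nra.
have hB : b <= 1 + b ^+ 2 by have := sqr_ge0 (b - 1); nra.
have hC : c <= 1 + c ^+ 2 by have := sqr_ge0 (c - 1); nra.
have := sqr_ge0 a; have := sqr_ge0 b; have := sqr_ge0 c; move: hA hB hC.
move: (a ^+ 2) (b ^+ 2) (c ^+ 2) => A B C hA hB hC C0 B0 A0.
have AB : 0 <= A * B by rewrite mulr_ge0.
have BC : 0 <= B * C by rewrite mulr_ge0.
have AC : 0 <= A * C by rewrite mulr_ge0.
have ABC : 0 <= A * B * C by rewrite mulr_ge0.
nra.
Qed.

Lemma sum_sin_sqr_weight (u : 'rV[R]_3) :
  (\sum_i `|sin (pi * u 0 i)|) ^+ 2 <= 3 / nu ^+ 2 * weight u.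
Proof.
have [a [b [c [a0 b0 c0 -> ->]]]] := weightE u.
rewrite exprMn exprVn [leRHS]mulrAC ler_pM2r ?invr_gt0 ?exprn_gt0 ?nu_gt0//.
apply: (@le_trans _ _ (3 * (a ^+ 2 + b ^+ 2 + c ^+ 2))).
  have := sqr_ge0 (a - b); have := sqr_ge0 (b - c); have := sqr_ge0 (a - c); nra.
have := sqr_ge0 a; have := sqr_ge0 b; have := sqr_ge0 c.
move: (a ^+ 2) (b ^+ 2) (c ^+ 2) => A B C C0 B0 A0.
have AB : 0 <= A * B by rewrite mulr_ge0.
have BC : 0 <= B * C by rewrite mulr_ge0.
have AC : 0 <= A * C by rewrite mulr_ge0.
have ABC : 0 <= A * B * C by rewrite mulr_ge0.
nra.
Qed.

Lemma kconv_weight_bound m f t (x : 'rV[R]_3) M : continuous f -> 0 <= M -> (forall i, m i <= 3)%N ->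
  (forall y : 'rV[R]_3, `|f (t, y)| <= M * weight (x - y)) ->
  `|kconv m f (t, x)| <= M * (kern_const R ^+ 3 * nu ^+ (\sum_i m i)).
Proof.
move=> cf M0 m3 H; apply: kconv_bound => // y; rewrite (le_trans (H y))// /weight.
by under eq_bigr do rewrite !mxE.
Qed.

Lemma kconv_sup m f z M : continuous f -> (forall i, m i <= 3)%N -> (forall z, `|f z| <= M) ->
  `|kconv m f z| <= M * (kern_const R ^+ 3 * nu ^+ (\sum_i m i)).
Proof.
case: z => t x cf m3 H; have M0 : 0 <= M by apply: le_trans (H (t, x)).
apply: kconv_weight_bound => // y; rewrite (le_trans (H _))// ler_peMr// weight_ge1//.
Qed.

(** The difference f - f(t, x) is at most A times the distance to x, hence at most 3 A / nu times
    the weight: vanishing at the evaluation point gains one kernel width. *)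
Lemma kconv_osc m f t (x : 'rV[R]_3) A : continuous f -> 0 <= A -> osc A f -> (forall i, m i <= 3)%N ->
  `|kconv m (fun z => f z - f (t, x)) (t, x)| <= A * (3 / nu) * (kern_const R ^+ 3 * nu ^+ (\sum_i m i)).
Proof.
move=> cf A0 oA m3; apply: kconv_weight_bound => //.
- by apply: continuousB_fun => //; exact: continuous_cst_fun.
- by rewrite mulr_ge0// divr_ge0// ltW// nu_gt0.
- move=> y; rewrite (le_trans (oA _ _ _))// -mulrA ler_wpM2l//.
  have := sum_sin_weight (x - y); by under eq_bigr do rewrite !mxE.
Qed.

Lemma kconv_osc2 m f g t (x : 'rV[R]_3) A B : continuous f -> continuous g -> 0 <= A -> 0 <= B ->
  osc A f -> osc B g -> (forall i, m i <= 3)%N ->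
  `|kconv m (fun z => (f z - f (t, x)) * (g z - g (t, x))) (t, x)| <=
    A * B * (3 / nu ^+ 2) * (kern_const R ^+ 3 * nu ^+ (\sum_i m i)).
Proof.
move=> cf cg A0 B0 oA oB m3; apply: kconv_weight_bound => //.
- by apply: continuousM_fun; apply: continuousB_fun => //; exact: continuous_cst_fun.
- by rewrite !mulr_ge0// invr_ge0 exprn_ge0// ltW// nu_gt0.
- move=> y; rewrite normrM (le_trans (ler_pM _ _ (oA _ _ _) (oB _ _ _)))//.
  rewrite mulrACA -expr2 -(mulrA (A * B) (3 / _)); apply: ler_wpM2l; first exact: mulr_ge0.
  have := sum_sin_sqr_weight (x - y); by under eq_bigr do rewrite !mxE.
Qed.

(* The splittings of a list of derivatives occurring in Leibniz' rule. *)
Fixpoint splits s : seq (seq 'I_3 * seq 'I_3) :=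
  if s is j :: s' then
    [seq (j :: p.1, p.2) | p <- splits s'] ++ [seq (p.1, j :: p.2) | p <- splits s']
  else [:: ([::], [::])].

Lemma size_splits s : size (splits s) = (2 ^ size s)%N.
Proof. by elim: s => //= j s IH; rewrite size_cat !size_map IH expnS mul2n addnn. Qed.

Lemma splits_size s p : p \in splits s -> (size p.1 + size p.2)%N = size s.
Proof.
elim: s p => [|j s IH] p /=; first by rewrite inE => /eqP ->.
by rewrite mem_cat => /orP[] /mapP[p' /IH <- ->] /=; rewrite ?addSn ?addnS.
Qed.

Lemma is_derive_bigsum (I : eqType) (r : seq I) (F : I -> spacetime -> R) (dF : I -> R) z h :
  (forall i, i \in r -> is_derive z h (F i) (dF i)) ->
  is_derive z h (fun z => \sum_(i <- r) F i z) (\sum_(i <- r) dF i).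
Proof.
elim: r => [|i r IH] H.
  under eq_fun do rewrite big_nil; rewrite big_nil; exact: is_derive_cst.
under eq_fun do rewrite big_cons; rewrite big_cons.
apply: is_deriveD; first by apply: H; rewrite mem_head.
by apply: IH => k kr; apply: H; rewrite inE kr orbT.
Qed.

(** Stated for any family indexed by two lists of derivatives, because it serves both the product of
    two mollified functions and the commutator itself. The bound on [size a + size b] accounts for
    fields with finitely many derivatives. *)
Lemma nabla_leibniz (Phi : seq 'I_3 -> seq 'I_3 -> spacetime -> R) n s :
  (forall a b z j, (size a + size b < n)%N ->
     is_derive z (e_x R j) (Phi a b) (Phi (j :: a) b z + Phi a (j :: b) z)) ->
  (size s <= n)%N ->
  nabla_seq s (Phi [::] [::]) = fun z => \sum_(p <- splits s) Phi p.1 p.2 z.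
Proof.
move=> dPhi; elim: s => [_|j s IH sn].
  by apply/funext => z; rewrite big_seq1.
rewrite /nabla_seq /= -/(nabla_seq s _) IH; last exact: ltnW.
apply/funext => z; rewrite big_cat /= !big_map -big_split /=; apply: derive_val.
apply: is_derive_bigsum => p ps; apply: dPhi.
by rewrite (splits_size ps).
Qed.

Lemma nabla_seq_bigsum (I : eqType) (r : seq I) (F : I -> spacetime -> R) s :
  (forall i, i \in r -> forall s z j, derivable (nabla_seq s (F i)) z (e_x R j)) ->
  nabla_seq s (fun z => \sum_(i <- r) F i z) = fun z => \sum_(i <- r) nabla_seq s (F i) z.
Proof.
move=> dF; elim: s => [//|j s IH]; rewrite /nabla_seq /= -/(nabla_seq s _) IH.
apply/funext => z; apply: derive_val; apply: is_derive_bigsum => i ir.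
by apply: DeriveDef => //; exact: dF.
Qed.

Definition commutator f g : spacetime -> R := fun z => mol f z * mol g z - mol (fun z => f z * g z) z.

Lemma kconvD m f g z : continuous f -> continuous g ->
  kconv m (fun z => f z + g z) z = kconv m f z + kconv m g z.
Proof.
move=> cf cg; have := @kconv_linear _ q m f g 1 1 z cf cg; rewrite !mul1r => <-.
by congr (kconv m _ z); apply/funext => w; rewrite !mul1r.
Qed.

Lemma molB f (c : R) : continuous f -> mol (fun z => f z - c) = (fun z => mol f z - c).
Proof.
move=> cf; apply/funext => z; rewrite kconvB//; first by rewrite kconv_cst.
exact: continuous_cst_fun.
Qed.

(** [mol] is linear and fixes constants, since K has integral 1, so the cross terms cancel. *)
Lemma comm_shift f g (c d : R) : continuous f -> continuous g ->
  commutator (fun z => f z - c) (fun z => g z - d) = commutator f g.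
Proof.
move=> cf cg; apply/funext => z; rewrite /commutator !molB//.
have cfg := continuousM_fun cf cg.
have cdf : continuous (fun z => d * f z + c * g z).
  by apply: continuousD_fun; apply: continuousM_fun => //; exact: continuous_cst_fun.
have -> : (fun z => (f z - c) * (g z - d)) =
    (fun z => (f z * g z - (d * f z + c * g z)) - (- (c * d))) by apply/funext => w; ring.
rewrite molB; last exact: continuousB_fun.
rewrite kconvB// kconv_linear//; ring.
Qed.

Lemma tpoly_mol (m : 'I_3 -> nat) f : continuous f -> tpoly (fun g : R -> R => continuous g) (kconv m f).
Proof. by move=> cf; apply: tpoly_kconv => r; exact: coef_continuous. Qed.

Lemma tpoly_comm f g : continuous f -> continuous g -> tpoly (fun g : R -> R => continuous g) (commutator f g).
Proof.
move=> cf cg; apply: tpoly_sub; last by apply: tpoly_mol; exact: continuousM_fun.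
by apply: tpoly_mul; exact: tpoly_mol.
Qed.

Lemma tpoly_nabla f s : tpoly (fun g : R -> R => continuous g) f -> tpoly (fun g : R -> R => continuous g) (nabla_seq s f).
Proof. by move=> Sf; apply: tpoly_iter_derive => //; left => h /mapP[i _ ->]. Qed.

Lemma tpoly_nabla_continuous f s : tpoly (fun g : R -> R => continuous g) f -> continuous (nabla_seq s f).
Proof. by move=> /(tpoly_nabla s) S; apply: tpoly_continuous S. Qed.

Lemma tpoly_nabla_derivable f s z i : tpoly (fun g : R -> R => continuous g) f ->
  derivable (nabla_seq s f) z (e_x R i).
Proof. by move=> /(tpoly_nabla s) S; apply: tpoly_derivable S; left. Qed.

(** Leibniz' rule gives at most 2^3 = 8 products, each with constant 3 * 3 [kern_const]^6, and 72 <=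
    75; the second term is the bound of [kconv_osc2] on the convolved product. *)
Definition comm_const : R := 75 * kern_const R ^+ 6 + 3 * kern_const R ^+ 3.

Lemma nabla_comm_bound f g A B s z : continuous f -> continuous g -> 0 <= A -> 0 <= B ->
  osc A f -> osc B g -> (size s <= 3)%N ->
  `|nabla_seq s (commutator f g) z| <= comm_const * (A * B) * (nu ^+ size s / nu ^+ 2).
Proof.
case: z => t x cf cg A0 B0 oA oB s3.
have n0 := nu_gt0; have k0 := kern_const_gt0 R.
(* The constants are fixed at the evaluation point before differentiating. The commutator is
   unchanged as a function, hence so are all its derivatives. *)
rewrite -(comm_shift (f (t, x)) (g (t, x)) cf cg).
set F := fun z => f z - _; set G := fun z => g z - _.
have cF : continuous F by apply: continuousB_fun => //; exact: continuous_cst_fun.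
have cG : continuous G by apply: continuousB_fun => //; exact: continuous_cst_fun.
have E : nabla_seq s (commutator F G) = fun z => (\sum_(p <- splits s) kconv (multi p.1) F z * kconv (multi p.2) G z) -
    kconv (multi s) (fun z => F z * G z) z.
  have L : nabla_seq s (fun z => mol F z * mol G z) =
      fun z => \sum_(p <- splits s) kconv (multi p.1) F z * kconv (multi p.2) G z.
    apply: (@nabla_leibniz (fun a b z => kconv (multi a) F z * kconv (multi b) G z) (size s)) => //.
    move=> a b w j _ /=; rewrite -!incr_multi.
    apply: is_derive_eq (is_deriveM (@is_derive_kconv R q (multi a) F w j)
      (@is_derive_kconv R q (multi b) G w j)) _.
    by rewrite /GRing.scale/=; ring.
  have SF := tpoly_mol (fun=> 0%N) cF; have SG := tpoly_mol (fun=> 0%N) cG.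
  have SFG := tpoly_mol (fun=> 0%N) (continuousM_fun cF cG).
  have SP := tpoly_mul SF SG.
  rewrite -nabla_seq_kconv.
  have -> : nabla_seq s (commutator F G) = fun z => nabla_seq s (fun z => mol F z * mol G z) z -
     nabla_seq s (mol (fun z => F z * G z)) z.
    elim: (s) => [//|j s' IH]; rewrite /nabla_seq /= -!/(nabla_seq s' _) IH.
    apply/funext => w; apply: derive_val; apply: is_deriveB;
      by apply: DeriveDef => //; exact: tpoly_nabla_derivable.
  by rewrite L.
have bsum p : p \in splits s -> `|kconv (multi p.1) F (t, x) * kconv (multi p.2) G (t, x)| <=
    9 * kern_const R ^+ 6 * (A * B) * (nu ^+ size s / nu ^+ 2).
  move=> ps; have sp := splits_size ps.
  have m1 i : (multi p.1 i <= 3)%N.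
    by rewrite (leq_trans (multi_le _ _))// (leq_trans _ s3)// -sp leq_addr.
  have m2 i : (multi p.2 i <= 3)%N.
    by rewrite (leq_trans (multi_le _ _))// (leq_trans _ s3)// -sp leq_addl.
  rewrite normrM.
  apply: le_trans (ler_pM (normr_ge0 _) (normr_ge0 _)
    (@kconv_osc _ f t x A cf A0 oA m1) (@kconv_osc _ g t x B cg B0 oB m2)) _.
  rewrite !sum_multi -sp exprD le_eqVlt; apply/orP; left; apply/eqP.
  by field; rewrite gt_eqF.
rewrite E (le_trans (ler_normB _ _))//.
have -> : comm_const * (A * B) * (nu ^+ size s / nu ^+ 2) =
   75 * kern_const R ^+ 6 * (A * B) * (nu ^+ size s / nu ^+ 2) +
   A * B * (3 / nu ^+ 2) * (kern_const R ^+ 3 * nu ^+ (size s)).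
  by rewrite /comm_const; ring.
apply: lerD; last first.
  rewrite -(sum_multi s); apply: kconv_osc2 => // i.
  exact: leq_trans (multi_le _ _) s3.
apply: (le_trans (ler_norm_sum _ _ _)).
rewrite big_seq (le_trans (ler_sum _ bsum))// -big_seq big_const_seq count_predT size_splits.
rewrite iter_addr addr0.
have [Y [Y0 YE]] : exists Y, 0 <= Y /\ Y = kern_const R ^+ 6 * (A * B) * (nu ^+ size s / nu ^+ 2).
  exists (kern_const R ^+ 6 * (A * B) * (nu ^+ size s / nu ^+ 2)); split => //.
  have X0 : 0 <= nu ^+ size s / nu ^+ 2 := divr_ge0 (exprn_ge0 _ (ltW n0)) (exprn_ge0 _ (ltW n0)).
  exact: (mulr_ge0 (mulr_ge0 (exprn_ge0 6 (ltW k0)) (mulr_ge0 A0 B0)) X0).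
have -> : 9 * kern_const R ^+ 6 * (A * B) * (nu ^+ size s / nu ^+ 2) = 9 * Y by rewrite YE; ring.
have -> : 75 * kern_const R ^+ 6 * (A * B) * (nu ^+ size s / nu ^+ 2) = 75 * Y by rewrite YE; ring.
rewrite -[leLHS]mulr_natl mulrA; apply: ler_wpM2r => //.
rewrite -natrM ler_nat.
have : (2 ^ size s <= 2 ^ 3)%N by rewrite leq_exp2l.
lia.
Qed.

End commutator.

(** * Leibniz' rule for the commutator *)

Section leibniz_comm.
Context (R : realType) (q : nat).
Local Notation spacetime := (spacetime R).
Local Notation kconv := (@kconv R q).
Local Notation nu := (kscale R q).
Local Notation mol := (kconv (fun=> 0%N)).
Local Notation commutator := (@commutator R q).
Implicit Types (f g : spacetime -> R) (s : seq 'I_3).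

Lemma nabla_seq_cat (W : normedModType R) (F : spacetime -> W) s1 s2 :
  nabla_seq (s1 ++ s2) F = nabla_seq s1 (nabla_seq s2 F).
Proof. by rewrite /nabla_seq /iter_derive map_cat foldr_cat. Qed.

Lemma nabla_seq_periodic (W : normedModType R) (F : spacetime -> W) s :
  Defs.periodic F -> Defs.periodic (nabla_seq s F).
Proof. exact: iter_derive_periodic. Qed.

(** [kconv_derive] moves each derivative from the kernel to the field, so a derivative of a
    commutator is again a sum of commutators and the quadratic gain persists. *)
Lemma is_derive_comm f g z j : Defs.periodic f -> Defs.periodic g ->
  continuous f -> continuous g ->
  (forall z, derivable f z (e_x R j)) -> (forall z, derivable g z (e_x R j)) ->
  continuous ('D_(e_x R j) f) -> continuous ('D_(e_x R j) g) ->
  is_derive z (e_x R j) (commutator f g) (commutator ('D_(e_x R j) f) g z + commutator f ('D_(e_x R j) g) z).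
Proof.
move=> pf pg cf cg df dg cdf cdg.
have dfg w : is_derive w (e_x R j) (fun z => f z * g z) (f w * 'D_(e_x R j) g w + 'D_(e_x R j) f w * g w).
  apply: is_derive_eq (is_deriveM (derivableP (df w)) (derivableP (dg w))) _.
  by rewrite /GRing.scale/=; ring.
have Dfg : 'D_(e_x R j) (fun z => f z * g z) = fun w => f w * 'D_(e_x R j) g w + 'D_(e_x R j) f w * g w.
  by apply/funext => w; exact: derive_val.
have c1 : continuous (fun w => f w * 'D_(e_x R j) g w) by exact: continuousM_fun.
have c2 : continuous (fun w => 'D_(e_x R j) f w * g w) by exact: continuousM_fun.
have h1 := @is_derive_kconv R q (fun=> 0%N) f z j.
have h2 := @is_derive_kconv R q (fun=> 0%N) g z j.
have h3 := @is_derive_kconv R q (fun=> 0%N) (fun z => f z * g z) z j.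
apply: is_derive_eq (is_deriveB (is_deriveM h1 h2) h3) _.
have e1 : kconv (multi_incr (fun=> 0%N) j) f z = mol ('D_(e_x R j) f) z by rewrite kconv_derive.
have e2 : kconv (multi_incr (fun=> 0%N) j) g z = mol ('D_(e_x R j) g) z by rewrite kconv_derive.
have pfg : Defs.periodic (fun z => f z * g z) by move=> w k; rewrite pf pg.
have cfg : continuous (fun z => f z * g z) by exact: continuousM_fun.
have dfg' w : derivable (fun z => f z * g z) w (e_x R j) by have [] := dfg w.
have cdfg : continuous ('D_(e_x R j) (fun z => f z * g z)) by rewrite Dfg; exact: continuousD_fun.
have e3 : kconv (multi_incr (fun=> 0%N) j) (fun z => f z * g z) z =
    mol (fun w => f w * 'D_(e_x R j) g w) z + mol (fun w => 'D_(e_x R j) f w * g w) z.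
  by rewrite -(@kconv_derive R q _ _ z j pfg cfg dfg' cdfg) Dfg kconvD.
rewrite e1 e2 e3 /commutator /GRing.scale/=.
move: (mol f z) (mol g z) (mol ('D_(e_x R j) f) z) (mol ('D_(e_x R j) g) z)
  (mol (fun w => f w * 'D_(e_x R j) g w) z) (mol (fun w => 'D_(e_x R j) f w * g w) z).
by move=> a b c d e h; ring.
Qed.

Lemma nabla_comm L f g s : Defs.periodic f -> Defs.periodic g ->
  nabla_continuous L f -> nabla_continuous L g -> (size s <= L)%N ->
  nabla_seq s (commutator f g) = fun z => \sum_(p <- splits s) commutator (nabla_seq p.1 f) (nabla_seq p.2 g) z.
Proof.
move=> pf pg nf ng sL.
apply: (@nabla_leibniz R (fun a b => commutator (nabla_seq a f) (nabla_seq b g)) L s _ sL).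
move=> a b z j ab.
have aL : (size a < L)%N by exact: leq_ltn_trans (leq_addr _ _) ab.
have bL : (size b < L)%N by exact: leq_ltn_trans (leq_addl _ _) ab.
have [ca /(_ aL) da] := nf a (ltnW aL); have [cb /(_ bL) db] := ng b (ltnW bL).
have [cja _] := nf (j :: a) aL; have [cjb _] := ng (j :: b) bL.
apply: is_derive_comm; [exact: nabla_seq_periodic|exact: nabla_seq_periodic|exact: ca|exact: cb
  |by move=> ?; exact: da|by move=> ?; exact: db|exact: cja|exact: cjb].
Qed.

Lemma nabla_mol L f s1 s2 : Defs.periodic f -> nabla_continuous L f -> (size s2 <= L)%N ->
  nabla_seq (s1 ++ s2) (mol f) = kconv (multi s1) (nabla_seq s2 f).
Proof.
move=> pf nf sL; rewrite nabla_seq_cat -nabla_seq_kconv; congr nabla_seq.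
elim: s2 sL => [//|j s IH] sL; rewrite /nabla_seq /= -!/(nabla_seq s _) (IH (ltnW sL)).
have [c /(_ sL) d] := nf s (ltnW sL); have [cj _] := nf (j :: s) sL.
by apply/funext => z; apply: derive_kconv_x => //; exact: nabla_seq_periodic.
Qed.

Lemma osc_nabla L f s (Xi V : R) : Defs.periodic f -> nabla_continuous L f -> (size s < L)%N ->
  (forall s z, (1 <= size s <= L)%N -> `|nabla_seq s f z| <= Xi ^+ size s * V) ->
  osc (Xi ^+ (size s).+1 * V) (nabla_seq s f).
Proof.
move=> pf nf sL bf; apply: osc_derive; first exact: nabla_seq_periodic.
  by move=> i z; have [_ /(_ sL)] := nf s (ltnW sL); apply.
by move=> i z; apply: (bf (i :: s)).
Qed.

(** The derivatives [s2] are distributed on f and g, those of [s1] fall on the kernel. Each factor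
    needs one further derivative for its oscillation bound: hence [size s2 <= 2], and the exponent
    [size s2 + 2] of Xi. The factor 4 counts the splittings of two derivatives. *)
Lemma nabla_comm_estimate f g s1 s2 (Xi V : R) z :
  Defs.periodic f -> Defs.periodic g -> nabla_continuous 3 f -> nabla_continuous 3 g ->
  0 <= Xi -> 0 <= V ->
  (forall s z, (1 <= size s <= 3)%N -> `|nabla_seq s f z| <= Xi ^+ size s * V) ->
  (forall s z, (1 <= size s <= 3)%N -> `|nabla_seq s g z| <= Xi ^+ size s * V) ->
  (size s1 <= 3)%N -> (size s2 <= 2)%N ->
  `|nabla_seq (s1 ++ s2) (commutator f g) z| <=
    4 * comm_const R * (Xi ^+ (size s2 + 2) * V ^+ 2) * (nu ^+ size s1 / nu ^+ 2).
Proof.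
move=> pf pg nf ng X0 V0 bf bg s13 s22.
rewrite nabla_seq_cat (nabla_comm pf pg nf ng); last exact: leq_trans s22 _.
have cp p : p \in splits s2 -> [/\ (size p.1 < 3)%N, (size p.2 < 3)%N,
    continuous (nabla_seq p.1 f) & continuous (nabla_seq p.2 g)].
  move=> ps; have sp := splits_size ps.
  have p1 : (size p.1 < 3)%N by rewrite ltnS (leq_trans _ s22)// -sp leq_addr.
  have p2 : (size p.2 < 3)%N by rewrite ltnS (leq_trans _ s22)// -sp leq_addl.
  by split => //; [have [] := nf p.1 (ltnW p1)|have [] := ng p.2 (ltnW p2)].
rewrite nabla_seq_bigsum; last first.
  move=> p /cp[_ _ c1 c2] s w j; apply: tpoly_nabla_derivable; exact: tpoly_comm.
have bp p : p \in splits s2 -> `|nabla_seq s1 (commutator (nabla_seq p.1 f) (nabla_seq p.2 g)) z| <=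
    comm_const R * (Xi ^+ (size s2 + 2) * V ^+ 2) * (nu ^+ size s1 / nu ^+ 2).
  move=> ps; have [p1 p2 c1 c2] := cp _ ps.
  have A0 k : 0 <= Xi ^+ k * V by exact: mulr_ge0 (exprn_ge0 _ X0) V0.
  have := @nabla_comm_bound R q _ _ _ _ s1 z c1 c2 (A0 _) (A0 _)
    (osc_nabla pf nf p1 bf) (osc_nabla pg ng p2 bg) s13.
  suff -> : Xi ^+ (size p.1).+1 * V * (Xi ^+ (size p.2).+1 * V) = Xi ^+ (size s2 + 2) * V ^+ 2 by [].
  rewrite -(splits_size ps) mulrACA -exprD -expr2; congr (_ ^+ _ * _).
  by rewrite addnS addSn addn2.
apply: (le_trans (ler_norm_sum _ _ _)).
rewrite big_seq (le_trans (ler_sum _ bp))// -big_seq big_const_seq count_predT size_splits.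
rewrite iter_addr addr0.
(* There is always at least one splitting, and its bound dominates an absolute value. *)
have D0 : 0 <= comm_const R * (Xi ^+ (size s2 + 2) * V ^+ 2) * (nu ^+ size s1 / nu ^+ 2).
  case: (splits s2) (size_splits s2) bp => [|p r _ bp].
    by move=> /esym/eqP; rewrite expn_eq0.
  by apply: le_trans (bp p (mem_head _ _)).
have -> : 4 * comm_const R * (Xi ^+ (size s2 + 2) * V ^+ 2) * (nu ^+ size s1 / nu ^+ 2) =
  4 * (comm_const R * (Xi ^+ (size s2 + 2) * V ^+ 2) * (nu ^+ size s1 / nu ^+ 2)) by ring.
rewrite -[leLHS]mulr_natl; apply: ler_wpM2r => //.
rewrite ler_nat.
have : (2 ^ size s2 <= 2 ^ 2)%N by rewrite leq_exp2l.
by [].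
Qed.

End leibniz_comm.

(** * From components to tensor norms *)

Section components.
Context (R : realType).
Local Notation spacetime := (spacetime R).
Variables (m n : nat).
Implicit Types (F : spacetime -> 'M[R]_(m, n)) (s : seq 'I_3).

Lemma nabla_seq_mx L F s : (forall i j, nabla_continuous L (fun z => F z i j)) -> (size s <= L)%N ->
  nabla_seq s F = fun z => \matrix_(i, j) nabla_seq s (fun z => F z i j) z.
Proof.
move=> nF; elim: s => [_|k s IH sL].
  by apply/funext => z; apply/matrixP => i j; rewrite mxE.
rewrite /nabla_seq /= -/(nabla_seq s F) (IH (ltnW sL)); apply/funext => z.
rewrite derive_mx; last first.
  apply/derivable_mxP => i j; have [_ /(_ sL z k) d] := nF i j s (ltnW sL).
  by under eq_fun do rewrite mxE.
by apply/matrixP => i j; rewrite !mxE; under eq_fun do rewrite mxE.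
Qed.

Lemma nabla_continuous_mx L F : (forall i j, nabla_continuous L (fun z => F z i j)) ->
  nabla_continuous L F.
Proof.
move=> nF s sL; rewrite (nabla_seq_mx nF sL); split.
  apply: continuous_mx => i j; under eq_fun do rewrite mxE.
  by have [] := nF i j s sL.
move=> sL' z k; apply/derivable_mxP => i j; under eq_fun do rewrite mxE.
by have [_ /(_ sL')] := nF i j s sL; apply.
Qed.

Lemma nabla_seq_coord L F s i j : nabla_continuous L F -> (size s <= L)%N ->
  nabla_seq s (fun z => F z i j) = fun z => nabla_seq s F z i j.
Proof.
move=> nF; elim: s => [//|k s IH sL].
rewrite /nabla_seq /= -!/(nabla_seq s _) (IH (ltnW sL)); apply/funext => z.
have [_ /(_ sL z k) d] := nF s (ltnW sL).
by rewrite derive_mx// mxE.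
Qed.

Lemma nabla_continuous_coord L F i j : nabla_continuous L F -> nabla_continuous L (fun z => F z i j).
Proof.
move=> nF s sL; rewrite (nabla_seq_coord i j nF sL); have [cF dF] := nF s sL; split.
  move=> z; apply: (@continuous_comp _ _ _ (nabla_seq s F) (fun M : 'M[R]_(m, n) => M i j)).
    exact: cF.
  exact: coord_continuous.
move=> sL' z k; exact: ((derivable_mxP _ _ _).1 (dF sL' z k)).
Qed.

Lemma nabla_norm_coord k F z (s : seq 'I_3) i j : size s = k ->
  `|nabla_seq s F z i j| <= nabla_norm k F z.
Proof.
move=> sk; rewrite -sqrtr_sqr ler_sqrt; last by do 3!apply: sumr_ge0 => ? _; exact: sqr_ge0.
have sk' : size s == k by exact/eqP.
rewrite (bigD1 (Tuple sk'))//= (bigD1 i)//= (bigD1 j)//= -!addrA lerDl.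
rewrite addr_ge0 ?addr_ge0//; do ?[apply: sumr_ge0 => ? _]; exact: sqr_ge0.
Qed.

Lemma C0_nablaP k F (B : R) : (C0_nabla k F <= B%:E)%E <-> forall z, nabla_norm k F z <= B.
Proof.
split=> [H z|H].
  rewrite -lee_fin (le_trans _ H)//; apply: ereal_sup_ubound.
  by exists z => //; rewrite ger0_norm// sqrtr_ge0.
apply: ub_ereal_sup => _ [z _ <-]; rewrite lee_fin ger0_norm ?sqrtr_ge0//.
Qed.

(** The tensor has at most 3^5 * 3 * 3 = 2187 components, and 47^2 = 2209. *)
Lemma C0_nabla_le k F (b : R) : (k <= 5)%N -> (m <= 3)%N -> (n <= 3)%N -> 0 <= b ->
  (forall s z i j, size s = k -> `|nabla_seq s F z i j| <= b) ->
  (C0_nabla k F <= (47 * b)%:E)%E.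
Proof.
move=> k5 m3 n3 b0 H; apply/C0_nablaP => z.
rewrite -(@ger0_norm _ (47 * b)) ?mulr_ge0// -sqrtr_sqr ler_sqrt ?sqr_ge0//.
apply: (@le_trans _ _ (\sum_(I : k.-tuple 'I_3) \sum_(i < m) \sum_(j < n) b ^+ 2)).
  do 3!apply: ler_sum => ? _; rewrite -[leLHS]real_normK ?num_real// ler_pXn2r//.
  by apply: H; rewrite size_tuple.
rewrite !sumr_const card_tuple !card_ord -!mulrnA -[leLHS]mulr_natl exprMn.
apply: ler_wpM2r; first exact: sqr_ge0.
rewrite -natrX ler_nat.
have : (3 ^ k <= 3 ^ 5)%N by rewrite leq_exp2l.
move=> h; apply: leq_trans (_ : 3 * 3 * 3 ^ 5 <= _)%N => //.
by rewrite -mulnA; do 2?apply: leq_mul.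
Qed.

End components.

(** * The mollified flow *)

Section support.
Context (R : realType).
Local Notation spacetime := (spacetime R).

(** A tube argument. The witness w for (s, y) has the same time but need not depend continuously on
    it. If no point over t were in the closure of P, compactness of the cube would give a
    neighbourhood of t over which P misses the whole cube, hence over which Q is empty. *)
Lemma closure_cube (P Q : set spacetime) t x :
  (forall s y, Q (s, y) -> exists2 w, cube R w & P (s, row3 w)) ->
  closure Q (t, x) -> exists y, closure P (t, y).
Proof.
move=> QP clQ; apply: contrapT => /forallNP nP.
have /compact_near_coveringP cc := @compact_cube R.
have : \forall s \near t, forall w, cube R w -> ~ P (s, row3 w).
  apply: (cc R (nbhs t) (fun s w => ~ P (s, row3 w))) => w cw.
  have := nP (row3 w); rewrite /closure => /existsNP[B] /not_implyP[nB PB].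
  have cF : continuous (fun p : (R * R * R) * R => (p.2, row3 p.1) : spacetime).
    apply: continuous_pair => p; first exact: cvg_snd.
    by apply: (@continuous_comp _ _ _ fst (@row3 R)); [exact: cvg_fst|exact: row3_continuous].
  have [[U V] /= [nU nV] UV] := cF (w, t) B nB.
  exists (U, V) => // p /UV Bp Pp.
  by apply: PB; exists (p.2, row3 p.1).
move=> nt; have := clQ [set z | forall w, cube R w -> ~ P (z.1, row3 w)].
case.
  have cf : continuous (fun z : spacetime => z.1) by move=> z; exact: cvg_fst.
  exact: (cf (t, x) _ nt).
by move=> [s y] [/QP[w cw Pw] /(_ w cw)].
Qed.

Lemma kconv_eq0 (q : nat) m (f : spacetime -> R) t x :
  (forall w, cube R w -> f (t, row3 w) = 0) -> kconv q m f (t, x) = 0.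
Proof.
move=> f0; rewrite /kconv big1// => r _; rewrite /kcoef.
rewrite (@eq_Rintegral _ _ _ _ _ (fun=> 0)); last first.
  by move=> w /set_mem cw; rewrite f0// mulr0.
by rewrite Rintegral_cst ?mul0r ?mulr0//; exact: measurable_cube.
Qed.

End support.

(** * The weak equations for the mollified flow *)

Section mollified_flow.
Context (R : realType) (q : nat).
Local Notation spacetime := (spacetime R).
Local Notation mol := (@kconv R q (fun=> 0%N)).
Local Notation commutator := (@commutator R q).
Variables (v0 : spacetime -> 'rV[R]_3) (p0 : spacetime -> R) (R0 : spacetime -> 'M[R]_3).

Implicit Types (f g al phi : spacetime -> R) (h : spacetime).

Definition vcomp l : spacetime -> R := fun z => v0 z 0 l.
Definition Rcomp j l : spacetime -> R := fun z => R0 z j l.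
Definition mol_v : spacetime -> 'rV[R]_3 := fun z => \row_l mol (vcomp l) z.
Definition mol_p : spacetime -> R := mol p0.
Definition stress j l : spacetime -> R := fun z => mol (Rcomp j l) z + commutator (vcomp j) (vcomp l) z.
Definition mol_R : spacetime -> 'M[R]_3 := fun z => \matrix_(j, l) stress j l z.

Hypothesis er0 : euler_reynolds v0 p0 R0.
Hypothesis cv : forall l, continuous (vcomp l).
Hypothesis cR : forall j l, continuous (Rcomp j l).

Let Cts := fun g : R -> R => continuous g.

Lemma tpoly_stress j l : tpoly Cts (stress j l).
Proof. by apply: tpoly_add; [exact: tpoly_mol|exact: tpoly_comm]. Qed.

Lemma tpoly_cts f : tpoly Cts f -> continuous f.
Proof. exact: tpoly_continuous. Qed.

Lemma periodic_vcomp l : Defs.periodic (vcomp l).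
Proof. by move=> z k; rewrite /vcomp (er_periodic_v er0). Qed.

Lemma periodic_Rcomp j l : Defs.periodic (Rcomp j l).
Proof. by move=> z k; rewrite /Rcomp (er_periodic_R er0). Qed.

Lemma pairing_split (f c al ga : spacetime -> R) (b be : 'I_3 -> spacetime -> R) :
  pairable (fun z => f z * al z) -> (forall j, pairable (fun z => b j z * be j z)) ->
  pairable (fun z => c z * ga z) ->
  integral_RT3 (fun z => f z * al z + \sum_(j < 3) b j z * be j z + c z * ga z) =
  pairing f al + \sum_(j < 3) pairing (b j) (be j) + pairing c ga.
Proof.
move=> pf pb pc; rewrite /pairing.
rewrite -(pairing_sum _ pb).
have ps : pairable (fun z => \sum_(j < 3) b j z * be j z).
  have := @integrable_sum _ _ _ (leb4 R) _ (measurable_strip R) _ (index_enum 'I_3) xpredT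
    (fun j => EFin \o ((fun z => b j z * be j z) \o @of_coords R)) (fun j _ => pb j).
  apply: eq_integrable; first exact: measurable_strip.
  by move=> z _; rewrite /= sumEFin.
have pfs : pairable (fun z => f z * al z + \sum_(j < 3) b j z * be j z).
  have := integrableD (measurable_strip R) pf ps.
  by apply: eq_integrable; first exact: measurable_strip.
rewrite /integral_RT3.
rewrite [LHS](RintegralD (measurable_strip R) pfs pc); congr (_ + _).
exact: (RintegralD (measurable_strip R) pf ps).
Qed.

Lemma pairable_test f phi h : loc_integrable f -> test_function phi ->
  pairable (fun z => f z * 'D_h phi z).
Proof.
move=> lf tphi; have [_ _ [M HM]] := tphi.
have [_ /(_ [::])[cD _] _] := test_function_iter [:: h] tphi.
by apply: (@pairableM R M); [exact: lf|exact: cD|exact: derive_tsupp].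
Qed.

Lemma derive_mol_t phi : test_function phi -> 'D_(e_t R) (mol phi) = mol ('D_(e_t R) phi).
Proof.
move=> [pphi sphi _]; have [cphi dphi] := sphi [::].
have [cD _] := sphi [:: e_t R].
by apply/funext => z; apply: derive_kconv_t.
Qed.

Lemma derive_mol_x phi j : test_function phi -> 'D_(e_x R j) (mol phi) = mol ('D_(e_x R j) phi).
Proof.
move=> [pphi sphi _]; have [cphi dphi] := sphi [::].
have [cD _] := sphi [:: e_x R j].
by apply/funext => z; apply: derive_kconv_x.
Qed.

Lemma pairing_derive_mol f phi h : loc_integrable f -> test_function phi ->
  'D_h (mol phi) = mol ('D_h phi) -> pairing f ('D_h (mol phi)) = pairing (mol f) ('D_h phi).
Proof.
move=> lf tphi ->; have [_ _ [M HM]] := tphi.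
have [_ /(_ [::])[cD _] _] := test_function_iter [:: h] tphi.
by rewrite (@pairing_kconv R q M f ('D_h phi))//; exact: derive_tsupp.
Qed.

Lemma pairing_sub f g al : pairable (fun z => f z * al z) -> pairable (fun z => g z * al z) ->
  pairing (fun z => f z - g z) al = pairing f al - pairing g al.
Proof.
move=> pf pg; rewrite /pairing.
have -> : (fun z => (f z - g z) * al z) = (fun z => f z * al z - g z * al z).
  by apply/funext => z; rewrite mulrBl.
exact: (RintegralB (measurable_strip R) pf pg).
Qed.

Lemma pairing_add f g al : pairable (fun z => f z * al z) -> pairable (fun z => g z * al z) ->
  pairing (fun z => f z + g z) al = pairing f al + pairing g al.
Proof.
move=> pf pg; rewrite /pairing.
have -> : (fun z => (f z + g z) * al z) = (fun z => f z * al z + g z * al z).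
  by apply/funext => z; rewrite mulrDl.
exact: (RintegralD (measurable_strip R) pf pg).
Qed.

(** The original equation is tested with [mol phi] and each pairing is transposed. Replacing [mol]
    of v^j v^l by the product of the mollified velocities costs a commutator, which is exactly what
    [stress] adds on the other side. *)
Lemma momentum (l : 'I_3) (phi : spacetime -> R) : test_function phi ->
  integral_RT3 (fun z => mol (vcomp l) z * 'D_(e_t R) phi z
      + \sum_(j < 3) mol (vcomp j) z * mol (vcomp l) z * 'D_(e_x R j) phi z
      + mol_p z * 'D_(e_x R l) phi z)
    = integral_RT3 (fun z => \sum_(j < 3) stress j l z * 'D_(e_x R j) phi z).
Proof.
(* Here e is the total pairing of the commutators, which occurs on both sides of the transposed
   equation. *)
have cancel (a b c d e : R) : a + (b - e) + c = d - e -> a + b + c = d by lra.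
move=> tphi; have tpsi := @test_function_kconv R q (fun=> 0%N) phi tphi.
have lv j : loc_integrable (vcomp j) := er_int_v er0 j.
have lvv j : loc_integrable (fun z => vcomp j z * vcomp l z) := er_int_vv er0 j l.
have lp : loc_integrable p0 := er_int_p er0.
have lR j : loc_integrable (Rcomp j l) := er_int_R er0 j l.
have lmol f : continuous f -> loc_integrable (mol f).
  by move=> cf; apply: continuous_loc_integrable; apply: tpoly_cts; exact: tpoly_mol.
have lmv j : loc_integrable (fun z => mol (vcomp j) z * mol (vcomp l) z).
  by apply: continuous_loc_integrable; apply: continuousM_fun; apply: tpoly_cts; exact: tpoly_mol.
have lcomm j : loc_integrable (commutator (vcomp j) (vcomp l)).
  by apply: continuous_loc_integrable; apply: tpoly_cts; exact: tpoly_comm.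
have lstress j : loc_integrable (stress j l).
  by apply: continuous_loc_integrable; apply: tpoly_cts; exact: tpoly_stress.
have lmp : loc_integrable mol_p by exact: kconv_loc_integrable.
have E0 := er_momentum er0 l tpsi.
rewrite (@pairing_split (vcomp l) p0 _ _ (fun j z => vcomp j z * vcomp l z)
  (fun j => 'D_(e_x R j) (mol phi))) in E0; [|exact: pairable_test|by move=> j; exact: pairable_test|exact: pairable_test].
rewrite (@pairing_sum R _ _ (fun j z => Rcomp j l z * 'D_(e_x R j) (mol phi) z)) in E0;
  last by move=> j; exact: pairable_test.
rewrite (@pairing_split (mol (vcomp l)) mol_p _ _ (fun j z => mol (vcomp j) z * mol (vcomp l) z)
  (fun j => 'D_(e_x R j) phi)); [|exact/pairable_test/tphi/lmol|by move=> j; exact: pairable_test|exact: pairable_test].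
rewrite (@pairing_sum R _ _ (fun j z => stress j l z * 'D_(e_x R j) phi z));
  last by move=> j; exact: pairable_test.
have F0 : pairing (vcomp l) ('D_(e_t R) (mol phi)) = pairing (mol (vcomp l)) ('D_(e_t R) phi).
  exact: (pairing_derive_mol (lv l) tphi (derive_mol_t tphi)).
have F1 j : pairing (fun z => vcomp j z * vcomp l z) ('D_(e_x R j) (mol phi)) =
    pairing (fun z => mol (vcomp j) z * mol (vcomp l) z) ('D_(e_x R j) phi) -
    pairing (commutator (vcomp j) (vcomp l)) ('D_(e_x R j) phi).
  rewrite (pairing_derive_mol (lvv j) tphi (derive_mol_x j tphi)).
  rewrite -(pairing_sub (pairable_test (e_x R j) (lmv j) tphi) (pairable_test (e_x R j) (lcomm j) tphi)).
  congr pairing; apply/funext => z; rewrite /commutator.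
  by move: (mol (vcomp j) z) (mol (vcomp l) z) (mol _ z) => a b c; ring.
have F2 : pairing p0 ('D_(e_x R l) (mol phi)) = pairing mol_p ('D_(e_x R l) phi).
  exact: (pairing_derive_mol lp tphi (derive_mol_x l tphi)).
have F3 j : pairing (Rcomp j l) ('D_(e_x R j) (mol phi)) =
   pairing (stress j l) ('D_(e_x R j) phi) - pairing (commutator (vcomp j) (vcomp l)) ('D_(e_x R j) phi).
  rewrite (pairing_derive_mol (lR j) tphi (derive_mol_x j tphi)).
  rewrite (pairing_add (pairable_test (e_x R j) (lmol _ (@cR j l)) tphi) (pairable_test (e_x R j) (lcomm j) tphi)).
  by move: (pairing _ _) (pairing _ _) => a b; rewrite addrK.
have E1 : \sum_(j < 3) pairing (fun z => vcomp j z * vcomp l z) ('D_(e_x R j) (mol phi)) =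
    \sum_(j < 3) pairing (fun z => mol (vcomp j) z * mol (vcomp l) z) ('D_(e_x R j) phi) -
    \sum_(j < 3) pairing (commutator (vcomp j) (vcomp l)) ('D_(e_x R j) phi).
  by rewrite -sumrB; apply: eq_bigr => j _; exact: F1.
have E3 : \sum_(j < 3) integral_RT3 (fun z => Rcomp j l z * 'D_(e_x R j) (mol phi) z) =
    \sum_(j < 3) integral_RT3 (fun z => stress j l z * 'D_(e_x R j) phi z) -
    \sum_(j < 3) pairing (commutator (vcomp j) (vcomp l)) ('D_(e_x R j) phi).
  by rewrite -sumrB; apply: eq_bigr => j _; exact: F3.
exact: cancel (etrans (esym (congr2 +%R (congr2 +%R F0 E1) F2)) (etrans E0 E3)).
Qed.

Lemma div_free phi : test_function phi ->
  integral_RT3 (fun z => \sum_(j < 3) mol (vcomp j) z * 'D_(e_x R j) phi z) = 0.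
Proof.
move=> tphi; have tpsi := @test_function_kconv R q (fun=> 0%N) phi tphi.
have lv j : loc_integrable (vcomp j) := er_int_v er0 j.
have E0 := er_div_free er0 tpsi.
rewrite (@pairing_sum R _ _ (fun j z => vcomp j z * 'D_(e_x R j) (mol phi) z)) in E0;
  last by move=> j; exact: pairable_test.
rewrite (@pairing_sum R _ _ (fun j z => mol (vcomp j) z * 'D_(e_x R j) phi z)); last first.
  by move=> j; apply: pairable_test => //; exact: kconv_loc_integrable.
rewrite -[RHS]E0; apply: eq_bigr => j _; apply/esym.
exact: (pairing_derive_mol (lv j) tphi (derive_mol_x j tphi)).
Qed.

Lemma euler_reynolds_mol : euler_reynolds mol_v mol_p mol_R.
Proof.
have vE l : (fun z => mol_v z 0 l) = mol (vcomp l) by apply/funext => z; rewrite mxE.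
have RE j l : (fun z => mol_R z j l) = stress j l by apply/funext => z; rewrite mxE.
have cmv l : continuous (mol (vcomp l)) by apply: tpoly_cts; exact: tpoly_mol.
have pm f : Defs.periodic (mol f) by exact: kconv_periodic.
split.
- by move=> z k; apply/rowP => l; rewrite !mxE pm.
- exact: pm.
- by move=> z k; apply/matrixP => j l; rewrite !mxE /stress /commutator !pm.
- move=> z; apply/matrixP => j l; rewrite !mxE /stress /commutator; congr (_ + (_ - _)).
  + congr (mol _ z); apply/funext => w; rewrite /Rcomp.
    by rewrite -[in LHS](er_sym er0 w) mxE.
  + exact: mulrC.
  + by congr (mol _ z); apply/funext => w; exact: mulrC.
- by move=> l; rewrite vE; exact: continuous_loc_integrable.
- move=> j l; have -> : (fun z => mol_v z 0 j * mol_v z 0 l) = (fun z => mol (vcomp j) z * mol (vcomp l) z).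
    by apply/funext => z; rewrite !mxE.
  by apply: continuous_loc_integrable; exact: continuousM_fun.
- by apply: kconv_loc_integrable; exact: er_int_p er0.
- by move=> j l; rewrite RE; apply: continuous_loc_integrable; apply: tpoly_cts; exact: tpoly_stress.
- move=> l phi tphi.
  have -> : (fun z => mol_v z 0 l * 'D_(e_t R) phi z +
      \sum_(j < 3) mol_v z 0 j * mol_v z 0 l * 'D_(e_x R j) phi z + mol_p z * 'D_(e_x R l) phi z) =
    (fun z => mol (vcomp l) z * 'D_(e_t R) phi z +
      \sum_(j < 3) mol (vcomp j) z * mol (vcomp l) z * 'D_(e_x R j) phi z + mol_p z * 'D_(e_x R l) phi z).
    apply/funext => z; have mE j : mol_v z 0 j = mol (vcomp j) z by rewrite mxE.
    by rewrite mE; congr (_ + _ + _); apply: eq_bigr => j _; rewrite mE.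
  have -> : (fun z => \sum_(j < 3) mol_R z j l * 'D_(e_x R j) phi z) =
      (fun z => \sum_(j < 3) stress j l z * 'D_(e_x R j) phi z).
    by apply/funext => z; apply: eq_bigr => j _; rewrite mxE.
  exact: momentum.
- move=> phi tphi; rewrite -[RHS](div_free tphi); congr integral_RT3; apply/funext => z.
  by apply: eq_bigr => j _; rewrite mxE.
Qed.

End mollified_flow.

(** * Estimates at the scale N Xi *)

Section estimates.
Context (R : realType).
Local Notation spacetime := (spacetime R).
Local Notation K := (kern_const R ^+ 3).

Lemma expr_scale (x N Xi : R) a b c : 0 <= x -> 0 <= N -> 0 <= Xi -> x <= 2 * (N * Xi) -> (a <= c)%N ->
  x ^+ a * Xi ^+ b <= 2 ^+ c * (N ^+ a * Xi ^+ (a + b)).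
Proof.
move=> x0 N0 X0 xN ac.
apply: (@le_trans _ _ ((2 * (N * Xi)) ^+ a * Xi ^+ b)).
  by apply: ler_wpM2r; [exact: exprn_ge0|apply: lerXn2r => //; rewrite nnegrE ?mulr_ge0].
rewrite exprMn exprMn -!mulrA -exprD; apply: ler_wpM2r.
  by rewrite mulr_ge0// exprn_ge0.
by apply: ler_weXn2l => //; rewrite ler1n.
Qed.

(** With q the integer part of x^2, the number q + 2 lies between x^2 and x^2 + 2 <= 4 x^2. *)
Lemma kscale_scale (x : R) : 3 <= x -> exists q, x <= kscale R q <= 2 * x.
Proof.
move=> x3; have x0 : 0 <= x by lra.
have := truncn_itv (sqr_ge0 x); set q := Num.truncn _ => /andP[lq uq].
have s1 : x = Num.sqrt (x ^+ 2) by rewrite sqrtr_sqr ger0_norm.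
have s2 : 2 * x = Num.sqrt ((2 * x) ^+ 2) by rewrite sqrtr_sqr ger0_norm// mulr_ge0.
exists q; rewrite s2 {1}s1 /kscale !ler_sqrt ?sqr_ge0//.
have -> : q.+2%:R = q%:R + 2 :> R by rewrite -addn2 natrD.
move: lq uq; rewrite -natr1 => lq uq; apply/andP; split; first by lra.
by rewrite exprMn; nra.
Qed.

Lemma tpoly_nabla_continuousL L (f : spacetime -> R) :
  tpoly (fun g : R -> R => continuous g) f -> nabla_continuous L f.
Proof.
move=> Sf s _; split; first exact: tpoly_nabla_continuous.
by move=> _ z i; exact: tpoly_nabla_derivable.
Qed.

Lemma nabla_seqD (f g : spacetime -> R) s :
  tpoly (fun g : R -> R => continuous g) f -> tpoly (fun g : R -> R => continuous g) g ->
  nabla_seq s (fun z => f z + g z) = fun z => nabla_seq s f z + nabla_seq s g z.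
Proof.
move=> Sf Sg; elim: s => [//|j s IH]; rewrite /nabla_seq /= -!/(nabla_seq s _) IH.
apply/funext => z; apply: derive_val; apply: is_deriveD;
  by apply: DeriveDef => //; exact: tpoly_nabla_derivable.
Qed.

Lemma comm_const_ge0 : 0 <= comm_const R.
Proof.
have k0 := ltW (kern_const_gt0 R); rewrite /comm_const.
exact: addr_ge0 (mulr_ge0 (ler0n _ _) (exprn_ge0 _ k0)) (mulr_ge0 (ler0n _ _) (exprn_ge0 _ k0)).
Qed.

Variables (q : nat) (N Xi V eR : R).
Hypotheses (N1 : 1 <= N) (Xi3 : 3 <= Xi) (V0 : 0 <= V) (eR0 : 0 < eR).
Hypothesis NV : V ^+ 2 = N ^+ 2 * eR.
Hypothesis nuN : N * Xi <= kscale R q <= 2 * (N * Xi).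
Local Notation nu := (kscale R q).
Local Notation mol := (@kconv R q (fun=> 0%N)).

Let N0 : 0 <= N. Proof. exact: le_trans ler01 N1. Qed.
Let X0 : 0 <= Xi. Proof. by apply: le_trans Xi3. Qed.
Let n0 : 0 <= nu. Proof. exact: ltW (nu_gt0 R q). Qed.
Let nle : nu <= 2 * (N * Xi). Proof. by case/andP: nuN. Qed.
Let nge : N * Xi <= nu. Proof. by case/andP: nuN. Qed.
Let K0 : 0 <= K. Proof. exact: exprn_ge0 (ltW (kern_const_gt0 R)). Qed.

(* All derivatives but [r] fall on the field, the remaining ones on the kernel. *)
Lemma mol_estimate L (f : spacetime -> R) (B : R) s r c z : Defs.periodic f -> nabla_continuous L f ->
  (size s - r <= L)%N -> (r <= 3)%N -> (r <= c)%N -> (r <= size s)%N -> 0 <= B ->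
  (forall s' z, size s' = (size s - r)%N -> `|nabla_seq s' f z| <= Xi ^+ size s' * B) ->
  `|nabla_seq s (mol f) z| <= K * 2 ^+ c * (N ^+ r * Xi ^+ size s * B).
Proof.
move=> pf nf sL r3 rc rs B0 bf.
have sdL : (size (drop r s) <= L)%N by rewrite size_drop.
rewrite -[in leLHS](cat_take_drop r s) (@nabla_mol R q L f _ _ pf nf sdL).
have st : size (take r s) = r by rewrite size_takel.
have [cf _] := nf (drop r s) sdL.
have m3 i : (multi (take r s) i <= 3)%N by rewrite (leq_trans (multi_le _ _))// st.
have bd w : `|nabla_seq (drop r s) f w| <= Xi ^+ size (drop r s) * B by apply: bf; rewrite size_drop.
apply: (le_trans (@kconv_sup R q _ _ z _ cf m3 bd)); rewrite sum_multi st size_drop.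
have h := expr_scale (size s - r) n0 N0 X0 nle rc; rewrite subnKC// in h.
have -> : Xi ^+ (size s - r) * B * (K * nu ^+ r) = (K * B) * (nu ^+ r * Xi ^+ (size s - r)) by ring.
have -> : K * 2 ^+ c * (N ^+ r * Xi ^+ size s * B) = (K * B) * (2 ^+ c * (N ^+ r * Xi ^+ size s)) by ring.
by apply: ler_wpM2l h; exact: mulr_ge0.
Qed.

(** The first [size s - 2] derivatives, at most three, go to the kernel and the last two at most to
    the fields. The constant is 32 = 4 * 2^3, the power of 2 coming from nu <= 2 N Xi. *)
Lemma comm_estimate (f g : spacetime -> R) s z :
  Defs.periodic f -> Defs.periodic g -> nabla_continuous 3 f -> nabla_continuous 3 g ->
  (forall s z, (1 <= size s <= 3)%N -> `|nabla_seq s f z| <= Xi ^+ size s * V) ->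
  (forall s z, (1 <= size s <= 3)%N -> `|nabla_seq s g z| <= Xi ^+ size s * V) ->
  (size s <= 5)%N ->
  `|nabla_seq s (@commutator R q f g) z| <= 32 * comm_const R * (N ^+ (size s - 2) * Xi ^+ size s * eR).
Proof.
move=> pf pg nf ng bf bg s5; set r := (size s - 2)%N.
have r3 : (r <= 3)%N by rewrite leq_subLR.
have st : size (take r s) = r by rewrite size_takel// leq_subr.
have sd : size (drop r s) = (size s - r)%N by rewrite size_drop.
have sd2 : (size (drop r s) <= 2)%N by rewrite sd /r; lia.
have := @nabla_comm_estimate R q f g (take r s) (drop r s) Xi V z pf pg nf ng X0 V0 bf bg _ sd2.
rewrite cat_take_drop st => /(_ r3) h; apply: (le_trans h).
have NX0 : 0 < N * Xi by rewrite mulr_gt0//; [exact: lt_le_trans N1|exact: lt_le_trans Xi3].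
have nu2 : (N * Xi) ^+ 2 <= nu ^+ 2 by apply: lerXn2r => //; rewrite nnegrE// ltW.
have h2 := expr_scale (size s - r) n0 N0 X0 nle r3.
rewrite subnKC ?leq_subr// in h2.
have nu20 : 0 < nu ^+ 2 by apply: lt_le_trans nu2; rewrite exprn_gt0.
rewrite sd.
have -> : 4 * comm_const R * (Xi ^+ (size s - r + 2) * V ^+ 2) * (nu ^+ r / nu ^+ 2) =
   (4 * comm_const R) * ((nu ^+ r * Xi ^+ (size s - r)) * (Xi ^+ 2 * V ^+ 2 / nu ^+ 2)).
  by rewrite exprD; ring.
have -> : 32 * comm_const R * (N ^+ r * Xi ^+ size s * eR) =
   (4 * comm_const R) * ((2 ^+ 3 * (N ^+ r * Xi ^+ size s)) * eR) by ring.
apply: ler_wpM2l; first exact: mulr_ge0 (ler0n _ _) comm_const_ge0.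
have e0 : 0 <= nu ^+ r * Xi ^+ (size s - r) := mulr_ge0 (exprn_ge0 _ n0) (exprn_ge0 _ X0).
(* This inequality dictates the kernel width: nu >= N Xi together with V^2 = N^2 eR brings the
   quadratic error down to eR. *)
have e1 : Xi ^+ 2 * V ^+ 2 / nu ^+ 2 <= eR.
  rewrite ler_pdivrMr// NV mulrA -exprMn mulrC (mulrC Xi).
  by apply: ler_wpM2l => //; exact: ltW.
have e2 : 0 <= Xi ^+ 2 * V ^+ 2 / nu ^+ 2.
  by apply: mulr_ge0; [apply: mulr_ge0; exact: sqr_ge0|rewrite invr_ge0 ltW].
exact: ler_pM e0 e2 h2 e1.
Qed.

(** As K has integral 1, the difference is the convolution of f - f(t, x) at (t, x). Its oscillation
    gains Xi / nu <= 1 / N over V. *)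
Lemma mol_close (f : spacetime -> R) z : Defs.periodic f -> nabla_continuous 3 f ->
  (forall s z, (1 <= size s <= 3)%N -> `|nabla_seq s f z| <= Xi ^+ size s * V) ->
  `|mol f z - f z| <= 3 * K * (V / N).
Proof.
case: z => t x pf nf bf; have [cf _] := nf [::] isT.
have cc := @continuous_cst_fun R spacetime (f (t, x)).
have o := @osc_nabla R 3 f [::] Xi V pf nf isT bf.
have XV0 : 0 <= Xi ^+ 1 * V by rewrite mulr_ge0// exprn_ge0.
have := @kconv_osc R q (fun=> 0%N) f t x (Xi ^+ 1 * V) cf XV0 o (fun=> isT).
rewrite kconvB// kconv_cst big1// expr0 mulr1 expr1 => h; apply: (le_trans h).
have NX0 : 0 < N * Xi by rewrite mulr_gt0//; [exact: lt_le_trans N1|exact: lt_le_trans Xi3].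
have nu0 := nu_gt0 R q.
have -> : Xi * V * (3 / nu) * K = (3 * K * V) * (Xi / nu) by ring.
have -> : 3 * K * (V / N) = (3 * K * V) * N^-1 by ring.
apply: ler_wpM2l; first exact: mulr_ge0 (mulr_ge0 (ler0n _ _) K0) V0.
rewrite ler_pdivrMr// mulrC ler_pdivlMr; last exact: lt_le_trans N1.
by rewrite mulrC.
Qed.

End estimates.

(** * Choice of the scale and assembly of the bounds *)

Unset Implicit Arguments.
Set Strict Implicit.
Set Printing Implicit Defensive.

Theorem lemma3p1 (R : realType) :
  exists C0 : R,
    forall (Xi ev eR : R) (J : set R)
      (v0 : spacetime R -> 'rV[R]_3) (p0 : spacetime R -> R)
      (R0 : spacetime R -> 'M[R]_3),
      3 <= Xi -> eR <= ev -> 0 < eR ->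
      is_interval J ->
      euler_reynolds v0 p0 R0 ->
      freq_energy_levels 3 Xi ev eR v0 R0 ->
      supp_t v0 `|` supp_t R0 `<=` J ->
      let N := Num.sqrt (ev / eR) in
      exists (v : spacetime R -> 'rV[R]_3) (p : spacetime R -> R)
        (Rey : spacetime R -> 'M[R]_3),
        euler_reynolds v p Rey /\
        supp_t v `|` supp_t Rey `<=` J /\
        (forall k : nat, (1 <= k <= 5)%N ->
           (C0_nabla k v <=
              (C0 * N ^+ (k - 3) * Xi ^+ k * Num.sqrt ev)%:E)%E) /\
        (forall k : nat, (k <= 5)%N ->
           (C0_nabla k Rey <= (C0 * N ^+ (k - 2) * Xi ^+ k * eR)%:E)%E) /\
        (C0_nabla 0 (fun z => (v z - v0 z)%R) <= (C0 * Num.sqrt eR)%:E)%E /\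
        (forall L : nat, nabla_continuous L v /\ nabla_continuous L Rey).
Proof.
(* Subtraction is truncated: n - 3 derivatives go to the kernel, and between one and three stay on
   v, whose derivative of order 0 carries no bound. For the stress the split is n - 2 and at most
   two. *)
have hs3 (n : nat) : (1 <= n <= 5)%N ->
  [/\ n - (n - 3) <= 3, n - 3 <= 3, n - 3 <= n & 1 <= n - (n - 3)]%N by move=> ?; split; lia.
have hs2 (n : nat) : (n <= 5)%N ->
  [/\ n - (n - 2) <= 2, n - 2 <= 3 & n - 2 <= n]%N by move=> ?; split; lia.
have e8 : 2 ^+ 3 = 8 :> R by rewrite -natrX.
pose K := kern_const R ^+ 3; pose cc := comm_const R.
have K0 : 0 <= K by exact: exprn_ge0 (ltW (kern_const_gt0 R)).
have cc0 : 0 <= cc := comm_const_ge0 R.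
(* 47 passes from components to tensor norms, 8 = 2^3 comes from nu <= 2 N Xi with at most three
   derivatives on the kernel, and [32 * cc] is the commutator. *)
exists (47 * (K * 8 + 32 * cc)).
move=> Xi ev eR J v0 p0 R0 X3 eRev eR0 iJ er0 fe sJ N.
have ev0 : 0 < ev := lt_le_trans eR0 eRev.
pose V := Num.sqrt ev.
have V0 : 0 <= V := sqrtr_ge0 ev.
have r0 : 0 <= ev / eR := divr_ge0 (ltW ev0) (ltW eR0).
have N1 : 1 <= N by rewrite /N -(@sqrtr1 R) ler_sqrt// ler_pdivlMr// mul1r.
have N2 : N ^+ 2 = ev / eR by rewrite sqr_sqrtr.
have V2 : V ^+ 2 = ev by rewrite sqr_sqrtr// ltW.
have VE : V ^+ 2 = N ^+ 2 * eR by rewrite V2 N2 divfK// gt_eqF.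
have VN : V / N = Num.sqrt eR.
  have NE : N * Num.sqrt eR = V by rewrite /N -sqrtrM// divfK// gt_eqF.
  by rewrite -NE mulrC mulKf// gt_eqF// (lt_le_trans ltr01 N1).
have NX3 : 3 <= N * Xi.
  by rewrite -[leLHS]mul1r; apply: ler_pM.
have [q qN] := kscale_scale NX3.
have X0 : 0 <= Xi by exact: le_trans X3.
have N0 : 0 <= N by exact: le_trans N1.
have [cv cR bv bR] := fe.
have nv l : nabla_continuous 3 (vcomp v0 l) by exact: nabla_continuous_coord.
have nR j l : nabla_continuous 3 (Rcomp R0 j l) by exact: nabla_continuous_coord.
have pv l := periodic_vcomp er0 l.
have pR j l := periodic_Rcomp er0 j l.
have cvc l : continuous (vcomp v0 l) by have [] := nv l [::] isT.
have cRc j l : continuous (Rcomp R0 j l) by have [] := nR j l [::] isT.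
have bvc l s z : (1 <= size s <= 3)%N -> `|nabla_seq s (vcomp v0 l) z| <= Xi ^+ size s * V.
  move=> s13; have /C0_nablaP/(_ z) b := bv _ s13.
  rewrite (nabla_seq_coord 0 l cv); last by case/andP: s13.
  by apply: le_trans b; exact: nabla_norm_coord.
have bRc j l s z : (size s <= 3)%N -> `|nabla_seq s (Rcomp R0 j l) z| <= Xi ^+ size s * eR.
  move=> s3; have /C0_nablaP/(_ z) b := bR _ s3.
  rewrite (nabla_seq_coord j l cR)//.
  by apply: le_trans b; exact: nabla_norm_coord.
pose v := mol_v q v0; pose Rey := mol_R q v0 R0.
have Sv l : tpoly (fun g : R -> R => continuous g) (kconv q (fun=> 0%N) (vcomp v0 l)).
  exact: tpoly_mol.
have SR j l := tpoly_stress q cvc cRc j l.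
have vE l : (fun z => v z 0 l) = kconv q (fun=> 0%N) (vcomp v0 l) by apply/funext => z; rewrite mxE.
have RE j l : (fun z => Rey z j l) = stress q v0 R0 j l by apply/funext => z; rewrite mxE.
have nvL L (i : 'I_1) l : nabla_continuous L (fun z => v z i l).
  by rewrite (ord1 i) vE; exact: tpoly_nabla_continuousL.
have nRL L j l : nabla_continuous L (fun z => Rey z j l).
  by rewrite RE; exact: tpoly_nabla_continuousL.
have CC x : 0 <= x -> 47 * (K * 8 * x) <= 47 * (K * 8 + 32 * cc) * x.
  move=> x0; rewrite -(mulrA 47 (K * 8 + 32 * cc)); apply: ler_wpM2l => //; rewrite mulrDl lerDl.
  by apply: mulr_ge0 x0; exact: mulr_ge0.
exists v, (mol_p q p0), Rey; split; [|split; [|split; [|split; [|split]]]].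
- exact: euler_reynolds_mol.
- move=> t tS; apply: sJ.
  (* Every term of [v] and [Rey] at time s is built from integrals over the slice at the same
     time. *)
  have zero s : (forall w, cube R w -> v0 (s, row3 w) = 0 /\ R0 (s, row3 w) = 0) ->
      forall y, v (s, y) = 0 /\ Rey (s, y) = 0.
    move=> H y.
    have z1 l : kconv q (fun=> 0%N) (vcomp v0 l) (s, y) = 0.
      by apply: kconv_eq0 => w /H[]; rewrite /vcomp => -> _; rewrite mxE.
    have z2 j l : kconv q (fun=> 0%N) (Rcomp R0 j l) (s, y) = 0.
      by apply: kconv_eq0 => w /H[_]; rewrite /Rcomp => ->; rewrite mxE.
    have z3 j l : kconv q (fun=> 0%N) (fun z => vcomp v0 j z * vcomp v0 l z) (s, y) = 0.
      by apply: kconv_eq0 => w /H[]; rewrite /vcomp => -> _; rewrite mxE mul0r.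
    split; first by apply/rowP => l; rewrite !mxE z1.
    by apply/matrixP => j l; rewrite !mxE /stress /commutator z1 z2 z3 mul0r subrr addr0.
  have wit s y : (v (s, y) != 0) \/ (Rey (s, y) != 0) ->
      exists2 w, cube R w & ([set z | v0 z != 0] `|` [set z | R0 z != 0]) (s, row3 w).
    move=> nz; apply: contrapT => /forall2NP nw.
    have [|e1 e2] := zero s _ y; last by move: nz; rewrite e1 e2 !eqxx => -[].
    move=> w cw; have [//|/not_orP[/negP h1 /negP h2]] := nw w.
    by split; apply/eqP; rewrite -[_ == _]negbK.
  (* [Rey] involves both [v0] and [R0], so the union of the two nonvanishing sets is treated at
     once; the closure of the union then splits into the two supports. *)
  have [y] : exists y, closure ([set z | v0 z != 0] `|` [set z | R0 z != 0]) (t, y).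
    case: tS => -[x clx].
      by apply: closure_cube clx => s y nz; apply: (wit s y); left.
    by apply: closure_cube clx => s y nz; apply: (wit s y); right.
  by rewrite closureU => -[]; [left|right]; exists y.
- move=> k /andP[k1 k5].
  have x0 : 0 <= N ^+ (k - 3) * Xi ^+ k * V by rewrite !mulr_ge0 ?exprn_ge0.
  have b0 := mulr_ge0 (mulr_ge0 K0 (ler0n R 8)) x0.
  have bnd s z (i : 'I_1) l : size s = k ->
      `|nabla_seq s v z i l| <= K * 8 * (N ^+ (k - 3) * Xi ^+ k * V).
    move=> sk; rewrite (nabla_seq_mx (nvL k) (eq_leq sk)) mxE (ord1 i) vE -sk.
    have [|h1 h2 h3 h0] := hs3 (size s); first by rewrite sk k1.
    have h4 s' w : size s' = (size s - (size s - 3))%N ->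
        `|nabla_seq s' (vcomp v0 l) w| <= Xi ^+ size s' * V.
      by move=> ss; apply: bvc; rewrite ss h0.
    have := @mol_estimate R q N Xi N1 X3 qN 3 (vcomp v0 l) V s (size s - 3) 3 z (pv l) (nv l) h1 h2 h2 h3 V0 h4.
    by rewrite e8.
  apply: (le_trans (@C0_nabla_le R 1 3 k v _ k5 isT isT b0 bnd)); rewrite lee_fin.
  by have := CC _ x0; rewrite !mulrA.
- move=> k k5.
  have x0 : 0 <= N ^+ (k - 2) * Xi ^+ k * eR.
    exact: mulr_ge0 (mulr_ge0 (exprn_ge0 _ N0) (exprn_ge0 _ X0)) (ltW eR0).
  have b0 := mulr_ge0 (addr_ge0 (mulr_ge0 K0 (ler0n R 8)) (mulr_ge0 (ler0n R 32) cc0)) x0.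
  have bnd s z j l : size s = k ->
      `|nabla_seq s Rey z j l| <= (K * 8 + 32 * cc) * (N ^+ (k - 2) * Xi ^+ k * eR).
    move=> sk; rewrite (nabla_seq_mx (nRL k) (eq_leq sk)) mxE RE -sk.
    have h5 : (size s <= 5)%N by rewrite sk.
    have [h0 h2 h3] := hs2 _ h5; have h1 := leq_trans h0 (leqnSn 2).
    have h4 s' w : size s' = (size s - (size s - 2))%N ->
        `|nabla_seq s' (Rcomp R0 j l) w| <= Xi ^+ size s' * eR.
      by move=> ss; apply: bRc; rewrite ss.
    (* The mollified [R0] is split like the commutator, with at most two derivatives on the field,
       so both parts of the stress carry the same power of N. *)
    have m := @mol_estimate R q N Xi N1 X3 qN 3 (Rcomp R0 j l) eR s (size s - 2) 3 z (pR j l) (nR j l) h1 h2 h2 h3 (ltW eR0) h4.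
    have c := @comm_estimate R q N Xi V eR N1 X3 V0 eR0 VE qN _ _ s z (pv j) (pv l) (nv j) (nv l) (bvc j) (bvc l) h5.
    rewrite /stress nabla_seqD; [|exact: tpoly_mol|exact: tpoly_comm].
    rewrite e8 in m; rewrite mulrDl; apply: le_trans (ler_normD _ _) _.
    exact: lerD m c.
  apply: (le_trans (@C0_nabla_le R 3 3 k Rey _ k5 isT isT b0 bnd)); rewrite lee_fin.
  by rewrite !mulrA.
- have x0 := sqrtr_ge0 eR.
  have b0 := mulr_ge0 (mulr_ge0 K0 (ler0n R 8)) x0.
  have bnd s z (i : 'I_1) l : size s = 0%N ->
      `|nabla_seq s (fun z => v z - v0 z) z i l| <= K * 8 * Num.sqrt eR.
    move=> /size0nil ->; rewrite (ord1 i) !mxE -VN.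
    have c := @mol_close R q N Xi V N1 X3 V0 qN _ z (pv l) (nv l) (bvc l).
    (* The factor 3 from the oscillation is absorbed into the 8 of the common constant. *)
    apply: (le_trans c); rewrite (mulrC 3); apply: ler_wpM2r.
      by rewrite VN.
    by apply: ler_wpM2l => //; rewrite ler_nat.
  apply: (le_trans (@C0_nabla_le R 1 3 0 (fun z => v z - v0 z) _ isT isT isT b0 bnd)); rewrite lee_fin.
  exact: CC.
- by move=> L; split; apply: nabla_continuous_mx.
Qed.
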